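(* Let $D\supset[0,1]$ and $E$ be topological disks. With the uniform norms on $C^\omega(D)$ and $C^\omega(E)$, the space $\mathbf B^{D,E}$ is a real Banach manifold, modeled on a finite-codimensional subspace of the real slice of the Banach space $C^\omega(D)\times C^\omega(E)$.
   Context: $[a,b]$ denotes the closed interval with endpoints $a,b$. A $C^r$-smooth critical commuting pair $\zeta=(\eta,\xi)$ consists of two orientation preserving interval homeomorphisms $\eta:I_\eta\to\eta(I_\eta)$, $\xi:I_\xi\to\xi(I_\xi)$, $I_\eta=[0,\xi(0)]$, $I_\xi=[\eta(0),0]$, such that: both have $C^r$ homeomorphic extensions to interval neighborhoods of their domains, which commute, $\eta\circ\xi=\xi\circ\eta$; $\xi\circ\eta(0)\in I_\eta$; $\eta'\neq0$ on $I_\eta\setminus\{0\}$, $\xi'\ne0$ on $I_\xi\setminus\{0\}$; and $\eta'(0)=\eta''(0)=\xi'(0)=\xi''(0)=0$, $\eta'''(0)\neq0\neq\xi'''(0)$. $\mathbf B$ (almost commuting pairs) is the set of $C^3$-smooth critical commuting pairs such that each of $\eta,\xi$ (on its interval of definition) extends complex-analytically to a neighborhood of that interval; equivalently, the analytic extensions satisfy $\eta\circ\xi(x)-\xi\circ\eta(x)=o(x^3)$ at $x=0$ (instead of exact commutation). The disks $D,E$ are symmetric about $\mathbb R$. $C^\omega(W)$ is the complex Banach space of bounded holomorphic functions on $W$ with the uniform norm; the real slice of a complex Banach space of functions is the real Banach space of its real-symmetric elements ($f(\bar z)=\overline{f(z)}$). $\mathbf B^{D,E}$ is the set of pairs in $\mathbf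 B$, viewed as a subset of the real slice of $C^\omega(D)\times C^\omega(E)$, such that $\eta,\xi$ have bounded analytic continuations to $D$ and $E$ respectively, $[\eta(0),0]\subset E$, $0$ is the only critical point of $\eta$ and $\xi$ on a neighborhood of $I_\eta$, $I_\xi$ respectively, $\xi(0)=1$, and $\frac1{2C_0}<|\eta(0)|<2C_0$. Here $C_0>1$ is a fixed universal constant (the constant of the real a priori bounds, which bounds the ratios of lengths of adjacent intervals of all sufficiently deep dynamical partitions of $C^3$-smooth commuting pairs).
   Formalization: The pairs with ξ(η(0)) = 0 are excluded from B^{D,E}: with the closed condition ξ(η(0)) ∈ [0, ξ(0)] they are boundary points, e.g. (z³−1, z³+1), and the set is not a submanifold there. *)

(* Defs.v *)
From Stdlib Require Import Reals Lra List FunctionalExtensionality ProofIrrelevance.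
From Coquelicot Require Import Coquelicot.
Import ListNotations.
Open Scope R_scope.

Definition topological_disk (W : C -> Prop) : Prop :=
  open W /\
  exists f g : C -> C,
    (forall z, W z -> Cmod (f z) < 1 /\ g (f z) = z) /\
    (forall w, Cmod w < 1 -> W (g w) /\ f (g w) = w) /\
    continuous_on W f /\
    continuous_on (fun w => Cmod w < 1) g.

Definition symmetric_about_R (W : C -> Prop) : Prop :=
  forall z, W z -> W (Cconj z).

Definition holomorphic (W : C -> Prop) (f : C -> C) : Prop :=
  forall z, W z -> ex_derive (K := C_AbsRing) (V := C_NormedModule) f z.

Definition bounded_on (W : C -> Prop) (f : C -> C) : Prop :=
  exists M : R, forall z, W z -> Cmod (f z) <= M.

Definition real_symmetric (f : C -> C) : Prop :=
  forall z, f (Cconj z) = Cconj (f z).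

(** An element of the real slice of [C^omega(W)] is a function on [W]; it is
    represented by the unique function on [C] that extends it by [0] outside
    [W], so that Leibniz equality is equality of functions on [W]. Since the
    domains of interest are symmetric, [real_symmetric] may be required on all
    of [C]. *)
Record real_slice (W : C -> Prop) : Type := RealSlice {
  slice_fun :> C -> C;
  slice_holomorphic : holomorphic W slice_fun;
  slice_bounded : bounded_on W slice_fun;
  slice_symmetric : real_symmetric slice_fun;
  slice_support : forall z, ~ W z -> slice_fun z = RtoC 0 }.

Section RealSlice.
Variable W : C -> Prop.

Lemma slice_ext (f g : real_slice W) : (forall z, f z = g z) -> f = g.
Proof.
  destruct f as [f f1 f2 f3 f4], g as [g g1 g2 g3 g4]; simpl; intros H.
  assert (E : f = g) by (apply functional_extensionality; exact H).
  subst g; f_equal; apply proof_irrelevance.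
Qed.

Lemma C_ext (x y : C) : fst x = fst y -> snd x = snd y -> x = y.
Proof. destruct x, y; simpl; congruence. Qed.

Definition slice_plus (f g : real_slice W) : real_slice W.
Proof.
  refine (RealSlice W (fun z => Cplus (f z) (g z)) _ _ _ _).
  - intros z Hz; apply (ex_derive_plus (K := C_AbsRing) (V := C_NormedModule));
      now apply slice_holomorphic.
  - destruct (slice_bounded W f) as [A HA], (slice_bounded W g) as [B HB].
    exists (A + B); intros z Hz.
    eapply Rle_trans; [apply Cmod_triangle | apply Rplus_le_compat; auto].
  - intros z; rewrite (slice_symmetric W f), (slice_symmetric W g).
    apply C_ext; simpl; ring.
  - intros z Hz; rewrite (slice_support W f z Hz), (slice_support W g z Hz); ring.
Defined.

Definition slice_scal (a : R) (f : real_slice W) : real_slice W.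
Proof.
  refine (RealSlice W (fun z => Cmult (RtoC a) (f z)) _ _ _ _).
  - intros z Hz; destruct (slice_holomorphic W f z Hz) as [l Hl].
    exists (Cmult (RtoC a) l).
    eapply filterdiff_ext_lin.
    + apply (filterdiff_scal_r_fct (K := C_AbsRing)
               (U := AbsRing_NormedModule C_AbsRing) (V := C_NormedModule)
               (RtoC a) f _ Cmult_comm Hl).
    + intros y; simpl; apply C_ext; simpl; unfold mult; simpl; ring.
  - destruct (slice_bounded W f) as [A HA].
    exists (Rabs a * A); intros z Hz.
    rewrite Cmod_mult, Cmod_R.
    apply Rmult_le_compat_l; [apply Rabs_pos | auto].
  - intros z; rewrite (slice_symmetric W f); apply C_ext; simpl; ring.
  - intros z Hz; rewrite (slice_support W f z Hz); ring.
Defined.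

Definition slice_zero : real_slice W.
Proof.
  refine (RealSlice W (fun _ => RtoC 0) _ _ _ _).
  - intros z Hz; apply (ex_derive_const (K := C_AbsRing) (V := C_NormedModule)).
  - exists 0; intros z _; rewrite Cmod_0; apply Rle_refl.
  - intros z; apply C_ext; simpl; ring.
  - reflexivity.
Defined.

Definition slice_opp (f : real_slice W) : real_slice W := slice_scal (-1) f.

(** [Lub_Rbar] is finite here unless [W] is empty, in which case the norm is
    [real m_infty = 0]. *)
Definition slice_norm (f : real_slice W) : R :=
  real (Lub_Rbar (fun r => exists z, W z /\ r = Cmod (f z))).

Lemma slice_norm_pos (f : real_slice W) : 0 <= slice_norm f.
Proof.
  unfold slice_norm.
  destruct (Classical_Prop.classic (exists y, W y)) as [[y Hy] | Hn].
  - destruct (Lub_Rbar_correct (fun r => exists z, W z /\ r = Cmod (f z)))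
      as [Hub _].
    specialize (Hub (Cmod (f y)) (ex_intro _ y (conj Hy eq_refl))).
    destruct (Lub_Rbar _) as [l | | ]; simpl in *; try apply Rle_refl.
    eapply Rle_trans; [apply (Cmod_ge_0 (f y)) | exact Hub].
  - rewrite (is_lub_Rbar_unique _ m_infty); [apply Rle_refl |].
    split; [intros r [y [Hy _]]; exfalso; eauto | intros b _; now destruct b].
Qed.

Lemma slice_norm_ge (f : real_slice W) (z : C) : Cmod (f z) <= slice_norm f.
Proof.
  destruct (Classical_Prop.classic (W z)) as [Hz | Hz].
  - destruct (slice_bounded W f) as [M HM]; unfold slice_norm.
    destruct (Lub_Rbar_correct (fun r => exists z, W z /\ r = Cmod (f z)))
      as [Hub Hlub].
    specialize (Hub (Cmod (f z)) (ex_intro _ z (conj Hz eq_refl))).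
    specialize (Hlub (Finite M)).
    destruct (Lub_Rbar _) as [l | | ]; simpl in *; auto; [| contradiction].
    exfalso; apply Hlub; intros r [y [Hy ->]]; simpl; auto.
  - rewrite (slice_support W f z Hz), Cmod_0; apply slice_norm_pos.
Qed.

Lemma slice_norm_le (f : real_slice W) (M : R) :
  0 <= M -> (forall z, Cmod (f z) <= M) -> slice_norm f <= M.
Proof.
  intros HM H; unfold slice_norm.
  destruct (Lub_Rbar_correct (fun r => exists z, W z /\ r = Cmod (f z)))
    as [_ Hlub].
  specialize (Hlub (Finite M)).
  destruct (Lub_Rbar _) as [l | | ]; simpl in *; auto.
  apply Hlub; intros r [y [_ ->]]; simpl; auto.
Qed.

Definition slice_AbelianMonoid_mixin : AbelianMonoid.mixin_of (real_slice W).
Proof.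
  apply (AbelianMonoid.Mixin _ slice_plus slice_zero).
  - intros f g; apply slice_ext; intros z; apply Cplus_comm.
  - intros f g h; apply slice_ext; intros z; apply Cplus_assoc.
  - intros f; apply slice_ext; intros z; apply Cplus_0_r.
Defined.

Canonical slice_AbelianMonoid :=
  AbelianMonoid.Pack (real_slice W) slice_AbelianMonoid_mixin (real_slice W).

Definition slice_AbelianGroup_mixin : AbelianGroup.mixin_of slice_AbelianMonoid.
Proof.
  apply (AbelianGroup.Mixin _ slice_opp).
  intros f; apply slice_ext; intros z; simpl; apply C_ext; simpl; ring.
Defined.

Canonical slice_AbelianGroup :=
  AbelianGroup.Pack (real_slice W)
    (AbelianGroup.Class _ slice_AbelianMonoid_mixin slice_AbelianGroup_mixin)
    (real_slice W).

Definition slice_ModuleSpace_mixin :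
  ModuleSpace.mixin_of R_Ring slice_AbelianGroup.
Proof.
  apply (ModuleSpace.Mixin _ slice_AbelianGroup slice_scal); intros; apply slice_ext; intros z; apply C_ext; simpl;
    unfold mult, plus, one; simpl; ring.
Defined.

Canonical slice_ModuleSpace :=
  ModuleSpace.Pack R_Ring (real_slice W)
    (ModuleSpace.Class R_Ring _ (AbelianGroup.class slice_AbelianGroup)
       slice_ModuleSpace_mixin)
    (real_slice W).

Lemma slice_norm_triangle (f g : real_slice W) :
  slice_norm (plus f g) <= slice_norm f + slice_norm g.
Proof.
  apply slice_norm_le.
  - apply Rplus_le_le_0_compat; apply slice_norm_pos.
  - intros z; eapply Rle_trans; [apply Cmod_triangle |].
    apply Rplus_le_compat; apply slice_norm_ge.
Qed.

Lemma slice_norm_scal (a : R) (f : real_slice W) :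
  slice_norm (scal a f) <= Rabs a * slice_norm f.
Proof.
  apply slice_norm_le.
  - apply Rmult_le_pos; [apply Rabs_pos | apply slice_norm_pos].
  - intros z.
    change (Cmod (Cmult (RtoC a) (f z)) <= Rabs a * slice_norm f).
    rewrite Cmod_mult, Cmod_R.
    apply Rmult_le_compat_l; [apply Rabs_pos | apply slice_norm_ge].
Qed.

Lemma slice_norm_0 : slice_norm slice_zero = 0.
Proof.
  apply Rle_antisym; [| apply slice_norm_pos].
  apply slice_norm_le; [apply Rle_refl |].
  intros z; change (Cmod (RtoC 0) <= 0); rewrite Cmod_0; apply Rle_refl.
Qed.

Lemma slice_norm_eq_0 (f : real_slice W) : slice_norm f = 0 -> f = zero.
Proof.
  intros H; apply slice_ext; intros z.
  apply Cmod_eq_0, Rle_antisym; [| apply Cmod_ge_0].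
  rewrite <- H; apply slice_norm_ge.
Qed.

Definition slice_UniformSpace_mixin : UniformSpace.mixin_of (real_slice W).
Proof.
  apply (UniformSpace.Mixin _ slice_zero (fun f e g => slice_norm (minus g f) < e)).
  - intros f e; rewrite minus_eq_zero; change (slice_norm slice_zero < e).
    rewrite slice_norm_0; apply cond_pos.
  - intros f g e H; eapply Rle_lt_trans; [| exact H].
    replace (minus f g) with (scal (-1) (minus g f)).
    + eapply Rle_trans; [apply slice_norm_scal |].
      rewrite (Rabs_left (-1)) by lra; lra.
    + apply slice_ext; intros z; apply C_ext; simpl; ring.
  - intros f g h e1 e2 H1 H2.
    replace (minus h f) with (plus (minus g f) (minus h g)).
    + eapply Rle_lt_trans; [apply slice_norm_triangle |].
      now apply Rplus_lt_compat.
    + apply slice_ext; intros z; apply C_ext; simpl; ring.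
Defined.

Canonical slice_UniformSpace :=
  UniformSpace.Pack (real_slice W) slice_UniformSpace_mixin (real_slice W).

Canonical slice_NormedModuleAux :=
  NormedModuleAux.Pack R_AbsRing (real_slice W)
    (NormedModuleAux.Class R_AbsRing _ (ModuleSpace.class _ slice_ModuleSpace)
       slice_UniformSpace_mixin)
    (real_slice W).

Definition slice_NormedModule_mixin :
  NormedModule.mixin_of R_AbsRing slice_NormedModuleAux.
Proof.
  apply (NormedModule.Mixin _ slice_NormedModuleAux slice_norm 1).
  - exact slice_norm_triangle.
  - exact slice_norm_scal.
  - intros f g e H; exact H.
  - intros f g e H; rewrite Rmult_1_l; exact H.
  - exact slice_norm_eq_0.
Defined.

Canonical slice_NormedModule :=
  NormedModule.Pack R_AbsRing (real_slice W)
    (NormedModule.Class R_AbsRing _ (NormedModuleAux.class _ slice_NormedModuleAux)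
       slice_NormedModule_mixin)
    (real_slice W).

End RealSlice.

(** The real slice of [C^omega(D) x C^omega(E)]; the norm of Coquelicot on a
    product, [sqrt (|f|^2 + |g|^2)], is equivalent to the maximum of the norms. *)
Definition pair_space (D E : C -> Prop) : NormedModule R_AbsRing :=
  prod_NormedModule R_AbsRing (slice_NormedModule D) (slice_NormedModule E).

(** The closed interval with endpoints [a] and [b], in either order. *)
Definition segment (a b x : R) : Prop := Rmin a b <= x <= Rmax a b.

Definition increasing_homeo (I : R -> Prop) (f : R -> R) : Prop :=
  continuous_on I f /\
  forall x y, I x -> I y -> x < y -> f x < f y.

Definition open_interval (J : R -> Prop) : Prop :=
  exists a b, forall x, J x <-> a < x < b.

Definition C_r (r : nat) (J : R -> Prop) (f : R -> R) : Prop :=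
  forall x, J x ->
    (forall k, (k <= r)%nat -> ex_derive_n f k x) /\
    continuous (Derive_n f r) x.

(** [r >= 3] is understood. The pair is given by two functions on [R] of which
    only the restrictions to [I_eta] and [I_xi] matter. Derivatives on these
    closed intervals are those of the [C^r] extensions [eta1], [xi1]: up to
    order [r] they do not depend on the extensions. The extensions commute
    wherever both compositions are defined. *)
Definition critical_commuting_pair (r : nat) (eta xi : R -> R) : Prop :=
  let I_eta := segment 0 (xi 0) in
  let I_xi := segment (eta 0) 0 in
  increasing_homeo I_eta eta /\
  increasing_homeo I_xi xi /\
  I_eta (xi (eta 0)) /\
  exists (J_eta J_xi : R -> Prop) (eta1 xi1 : R -> R),
    (open_interval J_eta /\ (forall x, I_eta x -> J_eta x /\ eta1 x = eta x) /\
     increasing_homeo J_eta eta1 /\ C_r r J_eta eta1) /\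
    (open_interval J_xi /\ (forall x, I_xi x -> J_xi x /\ xi1 x = xi x) /\
     increasing_homeo J_xi xi1 /\ C_r r J_xi xi1) /\
    (forall x, J_eta x -> J_xi x -> J_eta (xi1 x) -> J_xi (eta1 x) ->
       eta1 (xi1 x) = xi1 (eta1 x)) /\
    (forall x, I_eta x -> x <> 0 -> Derive eta1 x <> 0) /\
    (forall x, I_xi x -> x <> 0 -> Derive xi1 x <> 0) /\
    (Derive eta1 0 = 0 /\ Derive_n eta1 2 0 = 0 /\ Derive_n eta1 3 0 <> 0) /\
    (Derive xi1 0 = 0 /\ Derive_n xi1 2 0 = 0 /\ Derive_n xi1 3 0 <> 0).

Definition extends_analytically (I : R -> Prop) (f : R -> R) : Prop :=
  exists (N : C -> Prop) (g : C -> C),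
    open N /\ holomorphic N g /\
    forall x, I x -> N (RtoC x) /\ g (RtoC x) = RtoC (f x).

Definition almost_commuting_pair (eta xi : R -> R) : Prop :=
  critical_commuting_pair 3 eta xi /\
  extends_analytically (segment 0 (xi 0)) eta /\
  extends_analytically (segment (eta 0) 0) xi.

Definition only_critical_point_0 (W : C -> Prop) (I : R -> Prop) (f : C -> C) : Prop :=
  exists N : C -> Prop,
    open N /\ (forall x, I x -> N (RtoC x)) /\ (forall z, N z -> W z) /\
    forall z, N z ->
      (is_derive (K := C_AbsRing) (V := C_NormedModule) f z (RtoC 0)
       <-> z = RtoC 0).

Definition real_trace (f : C -> C) (x : R) : R := Re (f (RtoC x)).

(** The space [B^{D,E}], for a given value of the constant [C0].

    The last clause says that the point [xi (eta 0)] of [I_eta] is not the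
    endpoint [0]; that it is not the endpoint [1 = xi 0] is automatic. Pairs
    with [xi (eta 0) = 0], for instance [eta z = z^3 - 1], [xi z = z^3 + 1],
    are boundary points of the set that the other clauses define: near them
    this set is cut out of a submanifold by the inequality
    [eta 1 = xi (eta 0) >= 0]. *)
Definition B_DE (C0 : R) (D E : C -> Prop) (p : pair_space D E) : Prop :=
  let eta := real_trace (fst p) in
  let xi := real_trace (snd p) in
  almost_commuting_pair eta xi /\
  (forall x, segment (eta 0) 0 x -> E (RtoC x)) /\
  only_critical_point_0 D (segment 0 (xi 0)) (fst p) /\
  only_critical_point_0 E (segment (eta 0) 0) (snd p) /\
  xi 0 = 1 /\
  / (2 * C0) < Rabs (eta 0) < 2 * C0 /\
  xi (eta 0) <> 0.

Section BanachManifold.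
Context {X : NormedModule R_AbsRing}.

(** A linear subspace that is a Banach space for the induced norm; in
    particular it is closed. *)
Definition banach_subspace (F : X -> Prop) : Prop :=
  F zero /\
  (forall x y, F x -> F y -> F (plus x y)) /\
  (forall (a : R) x, F x -> F (scal a x)) /\
  (forall u : nat -> X, (forall n, F (u n)) -> cauchy (filtermap u eventually) ->
     exists l, F l /\ filterlim u eventually (locally l)).

Definition finite_codimension (F : X -> Prop) : Prop :=
  exists (n : nat) (e : nat -> X), forall x, exists (y : X) (c : nat -> R),
    F y /\ x = plus y (sum_n (fun i => scal (c i) (e i)) n).

Definition relatively_open (S U : X -> Prop) : Prop :=
  exists O : X -> Prop, open O /\ forall x, U x <-> S x /\ O x.

Definition norm_product (v : list X) : R :=
  fold_right (fun h r => norm h * r) 1 v.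

(** [f] is [C^infinity] on the relatively open subset [V] of the linear
    subspace [S]: [d x [h_1; ...; h_n]] is the [n]-th Frechet derivative of [f]
    at [x], applied to [h_1, ..., h_n] in [S]; the derivative of
    [x |-> d x v] in the direction [h] is [d x (h :: v)], uniformly in [v] in
    the sense of the norm of [n]-linear maps on [S]. *)
Definition smooth_on {Y : NormedModule R_AbsRing} (S V : X -> Prop) (f : X -> Y)
  : Prop :=
  exists d : X -> list X -> Y,
    (forall x, V x -> d x [] = f x) /\
    (forall x v h k (a : R), V x -> List.Forall S v -> S h -> S k ->
       d x (plus (scal a h) k :: v) = plus (scal a (d x (h :: v))) (d x (k :: v))) /\
    (forall x (n : nat), V x -> exists M : R, forall v,
       length v = n -> List.Forall S v -> norm (d x v) <= M * norm_product v) /\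
    (forall x (n : nat) (eps : posreal), V x -> exists delta : posreal, forall h v,
       S h -> V (plus x h) -> norm h < delta -> length v = n -> List.Forall S v ->
       norm (minus (minus (d (plus x h) v) (d x v)) (d x (h :: v)))
         <= eps * norm h * norm_product v).

(** The maps matter only on [chart_dom] and [chart_cod]; the model space is a
    subspace of [X], so both are maps from [X] to [X]. *)
Record chart : Type := Chart {
  chart_dom : X -> Prop;
  chart_cod : X -> Prop;
  chart_map : X -> X;
  chart_inv : X -> X }.

Definition is_chart (M F : X -> Prop) (c : chart) : Prop :=
  relatively_open M (chart_dom c) /\
  relatively_open F (chart_cod c) /\
  (forall x, chart_dom c x ->
     chart_cod c (chart_map c x) /\ chart_inv c (chart_map c x) = x) /\
  (forall y, chart_cod c y ->
     chart_dom c (chart_inv c y) /\ chart_map c (chart_inv c y) = y) /\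
  continuous_on (chart_dom c) (chart_map c) /\
  continuous_on (chart_cod c) (chart_inv c).

Definition smooth_atlas (M F : X -> Prop) (A : chart -> Prop) : Prop :=
  (forall c, A c -> is_chart M F c) /\
  (forall x, M x -> exists c, A c /\ chart_dom c x) /\
  (forall c c', A c -> A c' ->
     smooth_on F (fun y => chart_cod c y /\ chart_dom c' (chart_inv c y))
       (fun y => chart_map c' (chart_inv c y))).

(** The smooth structure given by the charts is the one induced by [X]: charts
    are locally restrictions of smooth maps on open subsets of [X], and their
    inverses are smooth as maps to [X]. *)
Definition induced_structure (F : X -> Prop) (A : chart -> Prop) : Prop :=
  forall c, A c ->
    smooth_on F (chart_cod c) (chart_inv c) /\
    forall x, chart_dom c x ->
      exists (O : X -> Prop) (g : X -> X),
        open O /\ O x /\ smooth_on (fun _ => True) O g /\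
        forall y, O y -> chart_dom c y -> g y = chart_map c y.

(** [M], with the topology and the smooth structure of a subset of [X], is a
    [C^infinity] Banach manifold modeled on [F]. *)
Definition banach_manifold (M F : X -> Prop) : Prop :=
  banach_subspace F /\
  exists A : chart -> Prop, smooth_atlas M F A /\ induced_structure F A.

End BanachManifold.

(* Main.v *)
Require Import Defs.
From Stdlib Require Import Reals Lra Lia List Classical ClassicalEpsilon.
From Coquelicot Require Import Coquelicot.
Import ListNotations.
Open Scope R_scope.

(** A pair lies in [B^{D,E}] if and only if it satisfies the seven equations [xi 0 = 1],
    [xi' 0 = xi'' 0 = eta' 0 = eta'' 0 = 0], [eta 1 = xi a] and
    [eta' 1 * xi''' 0 = xi' a * eta''' 0], where [a = eta 0], together with strict inequalities. The last
    two equations compare the 3-jets at [0] of [eta o xi] and [xi o eta]; they suffice for commuting [C^3]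
    extensions because on each side of [0] one of the two maps may be chosen freely, so that the other
    one is obtained by conjugation, and the equations say that the pieces fit together at [0].

    The first five equations are affine, and the last two determine [eta 1] and [eta' 1] from the other
    data. The set is therefore an open piece of a graph over a common kernel of seven continuous linear
    functionals; two functions with prescribed 1-jet at [1] and vanishing 3-jet at [0] serve to adjust
    [eta 1] and [eta' 1]. The graph is smooth because [(a, xi) |-> xi^(j) a] is, by Cauchy estimates.
    These estimates also yield completeness of the space of bounded holomorphic functions, and they are
    derived from Goursat's theorem on the images of rectangles, by bisection. *)

(** Both composites have vanishing first and second derivatives at [0], because both maps do; so
    their 3-jets give exactly two conditions, on values and on third derivatives. The analytic
    extensions are determined by the pair, and their exact commutation would amount to infinitely
    many equations; the [C^3] extensions leave the freedom that reduces these to two.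

    The obstacle is that [xi] is evaluated at [a = eta 0], a point that moves with the pair, so
    these two equations are not linear. But [eta] is evaluated at the fixed points [0] and [1], and
    [eta 1], [eta' 1] occur to the first power with coefficients [1] and [xi''' 0 <> 0]. They are
    solved for explicitly, which gives one global chart. Smoothness asks for Frechet derivatives of
    all orders, so each building block (affine maps, evaluation at a moving point, products,
    reciprocals) comes with an explicit formula for them.

    Goursat's theorem is stated for images of rectangles because the linear homotopy between two
    circles is such an image: a single deformation to a small circle about an off-centre point
    yields Cauchy's formula. *)

Notation C_derivative := (is_derive (K := C_AbsRing) (V := C_NormedModule)).
Notation C_continuous := (continuous (U := C_UniformSpace)).
Notation CR_derive := (is_derive (V := C_R_NormedModule)).
Notation is_CInt := (is_RInt (V := C_R_NormedModule)).

(** * Elementary estimates and complex derivatives *)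

Lemma positive_lower_bound (l : list R) :
  List.Forall (Rlt 0) l -> exists d, 0 < d /\ List.Forall (Rle d) l.
Proof.
  induction 1 as [| x l Hx _ [d [Hd IH]]]; [exists 1; split; [lra | constructor] |].
  exists (Rmin x d); split; [now apply Rmin_case |]; constructor; [apply Rmin_l |].
  revert IH; apply List.Forall_impl; intros y Hy; eapply Rle_trans; [apply Rmin_r | exact Hy].
Qed.

(** Stands in for nested minima in the choice of radii. The bounds enter the context as [pos_below]
    and [le_below], mostly to be found by [lra]. *)
Ltac choose_below d l :=
  let H := fresh in let P := fresh "pos_below" in
  destruct (positive_lower_bound l) as [d [P H]];
  [repeat (apply List.Forall_cons;
     [first [lra | apply cond_pos | apply Rdiv_lt_0_compat; first [lra | nra | apply cond_pos]] |]); apply List.Forall_nil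
  | repeat match type of H with List.Forall _ (_ :: _) => let K := fresh "le_below" in
      apply List.Forall_cons_iff in H; destruct H as [K H] end; clear H].

(** The denominator [K + 1] admits [K = 0]. *)
Lemma small_mult (K t e : R) : 0 <= K -> 0 <= t -> t <= e / (K + 1) -> K * t <= e.
Proof.
  intros HK Ht H; apply (Rmult_le_compat_r (K + 1)) in H; [| lra].
  replace (e / (K + 1) * (K + 1)) with e in H by (field; lra); nra.
Qed.

Lemma ball_C (z w : C) (d : R) : Cmod (w - z) < d -> ball (M := C_UniformSpace) z d w.
Proof. intros H; apply C_NormedModule_mixin_compat1; exact H. Qed.

Lemma C_open_ball (W : C -> Prop) (z : C) :
  open W -> W z -> exists r, 0 < r /\ forall w, Cmod (w - z) < r -> W w.
Proof.
  intros HW Hz; destruct (HW z Hz) as [d Hd].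
  exists d; split; [apply cond_pos | intros w Hw; apply Hd, ball_C, Hw].
Qed.

Lemma ball_C_inv (eps : R) :
  0 < eps -> exists d : posreal, forall z w : C, ball (M := C_UniformSpace) z d w -> Cmod (w - z) < eps.
Proof.
  intros He; assert (Hs : 0 < sqrt 2) by (apply sqrt_lt_R0; lra).
  assert (Hp : 0 < eps / sqrt 2) by (apply Rdiv_lt_0_compat; lra).
  exists (mkposreal _ Hp); intros z w Hb; apply C_NormedModule_mixin_compat2 in Hb.
  eapply Rlt_le_trans; [exact Hb |]; simpl; right; field; lra.
Qed.

Lemma C_open_intro (W : C -> Prop) :
  (forall z, W z -> exists r, 0 < r /\ forall w, Cmod (w - z) < r -> W w) -> open W.
Proof.
  intros H z Hz; destruct (H z Hz) as [r [Hr Hw]]; destruct (ball_C_inv r Hr) as [d Hd].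
  exists d; intros w Hb; apply Hw, Hd, Hb.
Qed.

Lemma C_derivative_iff (f : C -> C) (z l : C) :
  C_derivative f z l <->
  forall eps, 0 < eps -> exists d, 0 < d /\ forall w, Cmod (w - z) < d ->
    Cmod (f w - f z - l * (w - z)) <= eps * Cmod (w - z).
Proof.
  split.
  - intros [_ H] eps He.
    destruct (H z (fun P HP => HP) (mkposreal eps He)) as [d Hd].
    exists d; split; [apply cond_pos |]; intros w Hw; specialize (Hd w Hw); simpl in Hd.
    replace (Cmod (f w - f z - l * (w - z))%C)
      with (Cmod (Cminus (Cminus (f w) (f z)) (Cmult (w - z) l))%C) by (f_equal; ring).
    exact Hd.
  - intros H; split; [apply is_linear_scal_l |].
    intros x Hx.
    apply (is_filter_lim_locally_unique (K := C_AbsRing) (V := AbsRing_NormedModule C_AbsRing)) in Hx.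
    subst x; intros eps; destruct (H eps (cond_pos eps)) as [d [Hd Hw]].
    exists (mkposreal d Hd); intros w Hb; specialize (Hw w Hb).
    replace (Cmod (f w - f z - l * (w - z))%C)
      with (Cmod (Cminus (Cminus (f w) (f z)) (Cmult (w - z) l))%C) in Hw by (f_equal; ring).
    exact Hw.
Qed.

(** The product and chain rules concern [C] as a module over itself, with its uniform structure
    given by [Cmod], whereas [C_NormedModule] carries the product structure. A derivative sees the
    target only through its norm, which is [Cmod] in both cases. *)
Lemma C_derivative_AbsRing (f : C -> C) (z l : C) :
  C_derivative f z l <-> is_derive (K := C_AbsRing) (V := AbsRing_NormedModule C_AbsRing) f z l.
Proof. split; intros [[h1 h2 h3] H]; (split; [constructor; assumption | exact H]). Qed.

Lemma C_derivative_mult (f g : C -> C) (z l1 l2 : C) :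
  C_derivative f z l1 -> C_derivative g z l2 -> C_derivative (fun w => f w * g w)%C z (l1 * g z + f z * l2)%C.
Proof.
  rewrite !C_derivative_AbsRing; intros Hf Hg; exact (is_derive_mult f g z l1 l2 Hf Hg Cmult_comm).
Qed.

Lemma C_derivative_comp_affine (f : C -> C) (z w h l : C) :
  C_derivative f (z * w + h)%C l -> C_derivative (fun u => f (u * w + h))%C z (l * w)%C.
Proof.
  intros H.
  assert (D : is_derive (K := C_AbsRing) (V := AbsRing_NormedModule C_AbsRing) (fun u => u * w + h)%C z w).
  { evar_last.
    - apply (is_derive_plus (K := C_AbsRing) (V := AbsRing_NormedModule C_AbsRing)); [| apply is_derive_const].
      apply (is_derive_mult (K := C_AbsRing) (fun u => u) (fun _ => w));
        [apply is_derive_id | apply is_derive_const | apply Cmult_comm].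
    - unfold plus, mult, one, zero; simpl; ring. }
  assert (R := is_derive_comp f (fun u => u * w + h)%C z l w H D).
  rewrite Cmult_comm; exact R.
Qed.

Lemma C_derivative_continuous (f : C -> C) (z l : C) :
  C_derivative f z l ->
  forall eps, 0 < eps -> exists d, 0 < d /\ forall w, Cmod (w - z) < d -> Cmod (f w - f z) < eps.
Proof.
  intros H eps He.
  destruct (proj1 (C_derivative_iff f z l) H 1 Rlt_0_1) as [d [Hd Hw]].
  assert (Hl := Cmod_ge_0 l).
  choose_below r [d; eps / (Cmod l + 2)]; exists r; split; [assumption |]; intros w Hr.
  specialize (Hw w ltac:(lra)); assert (h := Cmod_ge_0 (w - z)).
  assert (K : (Cmod l + 1) * r <= eps) by (apply small_mult; try lra; replace (Cmod l + 1 + 1) with (Cmod l + 2) by ring; assumption).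
  replace (f w - f z)%C with ((f w - f z - l * (w - z)) + l * (w - z))%C by ring.
  eapply Rle_lt_trans; [apply Cmod_triangle |]; rewrite Cmod_mult; nra.
Qed.

Lemma C_derivative_unique (f : C -> C) (z l1 l2 : C) :
  C_derivative f z l1 -> C_derivative f z l2 -> l1 = l2.
Proof.
  intros H1 H2.
  rewrite <- (is_C_derive_unique f z l1 H1); apply is_C_derive_unique, H2.
Qed.

Lemma is_derive_C (f : R -> C) (x : R) (l : C) :
  is_derive (fun t => Re (f t)) x (Re l) -> is_derive (fun t => Im (f t)) x (Im l) ->
  CR_derive f x l.
Proof.
  intros H1 H2.
  assert (H := is_derive_plus (K := R_AbsRing) (V := C_R_NormedModule) _ _ _ _ _
    (is_derive_scal_l (K := R_AbsRing) (V := C_R_NormedModule) _ _ _ (RtoC 1) H1)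
    (is_derive_scal_l (K := R_AbsRing) (V := C_R_NormedModule) _ _ _ Ci H2)).
  replace l with (plus (G := C_R_NormedModule) (scal (Re l) (RtoC 1 : C_R_NormedModule))
     (scal (Im l) (Ci : C_R_NormedModule))).
  - eapply is_derive_ext; [| exact H].
    intros t; apply C_ext; simpl; unfold plus, scal, mult; simpl; unfold mult; simpl; unfold Re, Im; ring.
  - apply C_ext; simpl; unfold plus, scal, mult; simpl; unfold mult; simpl; unfold Re, Im; ring.
Qed.

Lemma is_derive_C_parts (f : R -> C) (x : R) (l : C) :
  CR_derive f x l ->
  is_derive (fun t => Re (f t)) x (Re l) /\ is_derive (fun t => Im (f t)) x (Im l).
Proof.
  intros H; split.
  - apply (filterdiff_comp' (K := R_AbsRing) (U := R_NormedModule) (V := C_R_NormedModule)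
      (W := R_NormedModule) f Re x _ Re H).
    apply filterdiff_linear, is_linear_fst.
  - apply (filterdiff_comp' (K := R_AbsRing) (U := R_NormedModule) (V := C_R_NormedModule)
      (W := R_NormedModule) f Im x _ Im H).
    apply filterdiff_linear, is_linear_snd.
Qed.

Lemma is_derive_Cmult (f g : R -> C) (x : R) (f' g' : C) :
  CR_derive f x f' -> CR_derive g x g' ->
  CR_derive (fun t => f t * g t)%C x (f' * g x + f x * g')%C.
Proof.
  intros Hf Hg; apply is_derive_C_parts in Hf, Hg.
  destruct Hf as [f1 f2], Hg as [g1 g2].
  apply is_derive_C.
  - assert (H := is_derive_minus _ _ _ _ _ (is_derive_mult _ _ _ _ _ f1 g1 Rmult_comm)
      (is_derive_mult _ _ _ _ _ f2 g2 Rmult_comm)).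
    match type of H with is_derive _ _ ?l =>
      replace (Re (f' * g x + f x * g')%C) with l end.
    + eapply is_derive_ext; [| exact H]; intros t; simpl.
      unfold minus, plus, opp, mult; simpl; unfold Re, Im; simpl; ring.
    + unfold minus, plus, opp, mult; simpl; unfold Re, Im; simpl; ring.
  - assert (H := is_derive_plus _ _ _ _ _ (is_derive_mult _ _ _ _ _ f1 g2 Rmult_comm)
      (is_derive_mult _ _ _ _ _ f2 g1 Rmult_comm)).
    match type of H with is_derive _ _ ?l =>
      replace (Im (f' * g x + f x * g')%C) with l end.
    + eapply is_derive_ext; [| exact H]; intros t; simpl.
      unfold minus, plus, opp, mult; simpl; unfold Re, Im; simpl; ring.
    + unfold minus, plus, opp, mult; simpl; unfold Re, Im; simpl; ring.
Qed.

Lemma is_CInt_Cmult (A : C) (f : R -> C) (a b : R) (l : C) :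
  is_CInt f a b l -> is_CInt (fun t => A * f t)%C a b (A * l)%C.
Proof.
  intros H.
  assert (H1 := is_RInt_fct_extend_fst (U := R_NormedModule) (V := R_NormedModule) _ _ _ _ H).
  assert (H2 := is_RInt_fct_extend_snd (U := R_NormedModule) (V := R_NormedModule) _ _ _ _ H).
  apply (is_RInt_fct_extend_pair (U := R_NormedModule) (V := R_NormedModule)); simpl.
  - apply (is_RInt_minus (V := R_NormedModule)); apply (is_RInt_scal (V := R_NormedModule)); assumption.
  - apply (is_RInt_plus (V := R_NormedModule)); [apply (is_RInt_scal (V := R_NormedModule)); assumption |].
    apply (is_RInt_scal (V := R_NormedModule)); assumption.
Qed.

Lemma Cmod_norm_R (z : C) : Cmod z = norm (V := C_R_NormedModule) z.
Proof.
  unfold Cmod, norm; simpl; unfold prod_norm, norm; simpl.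
  unfold abs; simpl; f_equal; rewrite !Rmult_1_r, <- !Rabs_mult.
  rewrite !Rabs_pos_eq by apply Rle_0_sqr; reflexivity.
Qed.

Lemma is_CInt_bound (f : R -> C) (a b M : R) (l : C) :
  a <= b -> (forall x, a <= x <= b -> Cmod (f x) <= M) -> is_CInt f a b l -> Cmod l <= (b - a) * M.
Proof.
  intros Hab HM H.
  rewrite Cmod_norm_R; apply (norm_RInt_le_const f a b l M Hab); [| exact H].
  intros x Hx; rewrite <- Cmod_norm_R; apply HM, Hx.
Qed.

Lemma continuous_C (f : R -> C) (x : R) :
  (forall eps, 0 < eps -> exists d, 0 < d /\ forall y, Rabs (y - x) < d -> Cmod (f y - f x) < eps) ->
  C_continuous f x.
Proof.
  intros H; apply filterlim_locally; intros eps.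
  destruct (H eps (cond_pos eps)) as [d [Hd Hy]].
  exists (mkposreal d Hd); intros y Hb; apply ball_C, Hy, Hb.
Qed.

Lemma continuous_C_inv (f : R -> C) (x : R) :
  C_continuous f x ->
  forall eps, 0 < eps -> exists d, 0 < d /\ forall y, Rabs (y - x) < d -> Cmod (f y - f x) < eps.
Proof.
  intros H eps He; destruct (ball_C_inv eps He) as [d Hd].
  destruct (proj1 (filterlim_locally _ _) H d) as [d' Hd'].
  exists d'; split; [apply cond_pos |]; intros y Hy; apply Hd, Hd', Hy.
Qed.

Lemma continuous_Cmult (f g : R -> C) (x : R) : C_continuous f x -> C_continuous g x -> C_continuous (fun t => f t * g t)%C x.
Proof.
  assert (E : forall h : R -> C, C_continuous h x <-> continuous (U := AbsRing_UniformSpace C_AbsRing) h x).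
  { intros h; split; intros H P HP; apply H; apply locally_C; exact HP. }
  rewrite !E; apply (continuous_mult (K := C_AbsRing)).
Qed.

(** Rectangles are written [a b c d], for [[a, b] x [c, d]]. *)
Lemma additive_rectangle_function_zero (J : R -> R -> R -> R -> C) (a0 b0 c0 d0 : R) :
  a0 < b0 -> c0 < d0 ->
  (forall a m b c d, a0 <= a -> a <= m -> m <= b -> b <= b0 -> c0 <= c -> c <= d -> d <= d0 ->
     J a b c d = J a m c d + J m b c d)%C ->
  (forall a b c n d, a0 <= a -> a <= b -> b <= b0 -> c0 <= c -> c <= n -> n <= d -> d <= d0 ->
     J a b c d = J a b c n + J a b n d)%C ->
  (forall t s, a0 <= t <= b0 -> c0 <= s <= d0 -> forall eps, 0 < eps -> exists del, 0 < del /\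
     forall a b c d, a0 <= a -> a <= t <= b -> b <= b0 -> c0 <= c -> c <= s <= d -> d <= d0 ->
       (b - a) + (d - c) < del -> Cmod (J a b c d) <= eps * ((b - a) + (d - c)) ^ 2) ->
  J a0 b0 c0 d0 = RtoC 0.
Proof.
  intros Hab Hcd HA1 HA2 Hloc.
  (* One of the four quarters carries at least a quarter of [Cmod (J a b c d)]; if the first three
     do not, the last one does, by additivity and the triangle inequality. *)
  pose (next := fun r : R * R * R * R => let '(a, b, c, d) := r in
    let m := (a + b) / 2 in let n := (c + d) / 2 in let k := Cmod (J a b c d) / 4 in
    if Rle_dec k (Cmod (J a m c n)) then (a, m, c, n)
    else if Rle_dec k (Cmod (J a m n d)) then (a, m, n, d)
    else if Rle_dec k (Cmod (J m b c n)) then (m, b, c, n) else (m, b, n, d)).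
  pose (r := fun n => Nat.iter n next (a0, b0, c0, d0)).
  pose (A := fun n => fst (fst (fst (r n)))).
  pose (B := fun n => snd (fst (fst (r n)))).
  pose (Cc := fun n => snd (fst (r n))).
  pose (Dd := fun n => snd (r n)).
  assert (HS : forall n,
    (a0 <= A n /\ A n <= B n /\ B n <= b0 /\ c0 <= Cc n /\ Cc n <= Dd n /\ Dd n <= d0) /\
    B n - A n = (b0 - a0) / 2 ^ n /\ Dd n - Cc n = (d0 - c0) / 2 ^ n /\
    Cmod (J a0 b0 c0 d0) / 4 ^ n <= Cmod (J (A n) (B n) (Cc n) (Dd n)) /\
    A n <= A (S n) /\ B (S n) <= B n /\ Cc n <= Cc (S n) /\ Dd (S n) <= Dd n).
  { assert (Hstep : forall a b c d, a0 <= a -> a <= b -> b <= b0 -> c0 <= c -> c <= d -> d <= d0 ->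
      exists a' b' c' d', next (a, b, c, d) = (a', b', c', d') /\ a <= a' /\ b' <= b /\ c <= c' /\ d' <= d /\
        a' <= b' /\ c' <= d' /\
        b' - a' = (b - a) / 2 /\ d' - c' = (d - c) / 2 /\
        Cmod (J a b c d) / 4 <= Cmod (J a' b' c' d')).
    { intros a b c d h1 h2 h3 h4 h5 h6; unfold next.
      set (m := (a + b) / 2); set (n := (c + d) / 2).
      assert (Hm : a <= m <= b) by (unfold m; lra).
      assert (Hn : c <= n <= d) by (unfold n; lra).
      assert (E : J a b c d = (J a m c n + J a m n d + (J m b c n + J m b n d))%C).
      { rewrite (HA1 a m b c d), (HA2 a m c n d), (HA2 m b c n d) by lra; reflexivity. }
      assert (T : Cmod (J a b c d) <= Cmod (J a m c n) + Cmod (J a m n d) + (Cmod (J m b c n) + Cmod (J m b n d))).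
      { rewrite E; eapply Rle_trans; [apply Cmod_triangle |]; apply Rplus_le_compat; apply Cmod_triangle. }
      destruct (Rle_dec _ _) as [k1 | k1]; [exists a, m, c, n | destruct (Rle_dec _ _) as [k2 | k2];
        [exists a, m, n, d | destruct (Rle_dec _ _) as [k3 | k3]; [exists m, b, c, n | exists m, b, n, d]]];
      (split; [reflexivity |]); unfold m, n in *; repeat split; lra. }
    intros n.
    assert (Hr : forall k, r (S k) = next (r k)) by reflexivity.
    assert (HN : forall k, r k = (A k, B k, Cc k, Dd k)).
    { intros k; unfold A, B, Cc, Dd; destruct (r k) as [[[x y] z] w]; reflexivity. }
    assert (HI : (a0 <= A n /\ A n <= B n /\ B n <= b0 /\ c0 <= Cc n /\ Cc n <= Dd n /\ Dd n <= d0) /\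
      B n - A n = (b0 - a0) / 2 ^ n /\ Dd n - Cc n = (d0 - c0) / 2 ^ n /\
      Cmod (J a0 b0 c0 d0) / 4 ^ n <= Cmod (J (A n) (B n) (Cc n) (Dd n))).
    { induction n as [| n IH].
      - unfold A, B, Cc, Dd; simpl; repeat split; lra.
      - destruct IH as [[i1 [i2 [i3 [i4 [i5 i6]]]]] [i7 [i8 i9]]].
        destruct (Hstep (A n) (B n) (Cc n) (Dd n)) as (a' & b' & c' & d' & E & h); try assumption.
        rewrite <- HN, <- Hr, HN in E; injection E; intros -> -> -> ->.
        assert (P2 : 0 < 2 ^ n) by (apply pow_lt; lra).
        assert (P4 : 0 < 4 ^ n) by (apply pow_lt; lra).
        repeat split; try lra; simpl.
        + replace ((b0 - a0) / (2 * 2 ^ n)) with ((b0 - a0) / 2 ^ n / 2) by (field; lra); lra.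
        + replace ((d0 - c0) / (2 * 2 ^ n)) with ((d0 - c0) / 2 ^ n / 2) by (field; lra); lra.
        + replace (Cmod (J a0 b0 c0 d0) / (4 * 4 ^ n)) with (Cmod (J a0 b0 c0 d0) / 4 ^ n / 4) by (field; lra); lra. }
    destruct HI as [[i1 [i2 [i3 [i4 [i5 i6]]]]] [i7 [i8 i9]]].
    destruct (Hstep (A n) (B n) (Cc n) (Dd n)) as (a' & b' & c' & d' & E & h); try assumption.
    rewrite <- HN, <- Hr, HN in E; injection E; intros -> -> -> ->.
    repeat split; try assumption; apply h. }
  assert (Hlim : forall u v : nat -> R, (forall n, u n <= v n) -> (forall n, u n <= u (S n)) ->
    (forall n, v (S n) <= v n) -> exists x, forall n, u n <= x <= v n).
  { intros u v Huv Hu Hv.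
    assert (Hu' : forall n k, u n <= u (k + n)%nat).
    { intros n k; induction k; simpl; [lra | eapply Rle_trans; [exact IHk | apply Hu]]. }
    assert (Hv' : forall n k, v (k + n)%nat <= v n).
    { intros n k; induction k; simpl; [lra | eapply Rle_trans; [apply Hv | exact IHk]]. }
    assert (Hall : forall n k, u n <= v k).
    { intros n k; apply Rle_trans with (u (k + n)%nat); [apply Hu' |].
      apply Rle_trans with (v (k + n)%nat); [apply Huv |]; rewrite Nat.add_comm; apply Hv'. }
    destruct (completeness (fun x => exists n, x = u n)) as [x [Hx1 Hx2]].
    - exists (v 0%nat); intros x [n ->]; apply Hall.
    - exists (u 0%nat), 0%nat; reflexivity.
    - exists x; intros n; split; [apply Hx1; now exists n |].
      apply Hx2; intros y [k ->]; apply Hall. }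
  destruct (Hlim A B) as [t Ht]; try (intros n; apply HS).
  destruct (Hlim Cc Dd) as [s Hs]; try (intros n; apply HS).
  apply Cmod_eq_0, Rle_antisym; [| apply Cmod_ge_0].
  apply Rnot_lt_le; intros Hpos.
  set (w := (b0 - a0) + (d0 - c0)).
  assert (Hw : 0 < w) by (unfold w; lra).
  set (K := Cmod (J a0 b0 c0 d0)) in *.
  (* With this [eps] the local bound at level [n] is half of [K / 4 ^ n], which the chosen
     rectangles are known to reach. *)
  assert (HeK : 0 < K / (2 * w ^ 2)) by (apply Rdiv_lt_0_compat; nra).
  destruct (HS 0%nat) as [[i1 [i2 [i3 [i4 [i5 i6]]]]] _].
  destruct (Hloc t s) with (eps := K / (2 * w ^ 2)) as [del [Hdel H]]; try assumption.
  { specialize (Ht 0%nat); lra. } { specialize (Hs 0%nat); lra. }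
  assert (HN : exists n, w / 2 ^ n < del).
  { destruct (pow_lt_1_zero (/ 2)) with (y := del / w) as [n Hn].
    - rewrite Rabs_pos_eq; lra.
    - apply Rdiv_lt_0_compat; assumption.
    - exists n; specialize (Hn n (Nat.le_refl n)).
      rewrite Rabs_pos_eq in Hn by (apply pow_le; lra).
      rewrite pow_inv in Hn.
      apply (Rmult_lt_compat_l w) in Hn; [| exact Hw].
      replace (w * (del / w)) with del in Hn by (field; lra).
      exact Hn. }
  destruct HN as [n Hn].
  destruct (HS n) as [[k1 [k2 [k3 [k4 [k5 k6]]]]] [k7 [k8 [k9 _]]]].
  assert (P2 : 0 < 2 ^ n) by (apply pow_lt; lra).
  assert (E : (B n - A n) + (Dd n - Cc n) = w / 2 ^ n).
  { rewrite k7, k8; unfold w; field; lra. }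
  specialize (H (A n) (B n) (Cc n) (Dd n) k1 (Ht n) k3 k4 (Hs n) k6).
  rewrite E in H; specialize (H Hn).
  assert (E4 : 4 ^ n = (2 ^ n) ^ 2).
  { rewrite <- pow_mult, Nat.mul_comm, pow_mult; f_equal; lra. }
  replace (K / (2 * w ^ 2) * (w / 2 ^ n) ^ 2) with (K / 4 ^ n / 2) in H by (rewrite E4; field; lra).
  assert (0 < K / 4 ^ n) by (apply Rdiv_lt_0_compat; [exact Hpos | apply pow_lt; lra]).
  lra.
Qed.

(** * Goursat's theorem and Cauchy's formula *)

Notation CInt := (RInt (V := C_R_CompleteNormedModule)).

Lemma is_derive_val {K : AbsRing} {V : NormedModule K} (f : K -> V) (x : K) (l l' : V) :
  is_derive f x l -> l = l' -> is_derive f x l'.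
Proof. intros H <-; exact H. Qed.

Lemma is_derive_continuous_C (f : R -> C) (x : R) (l : C) :
  CR_derive f x l -> C_continuous f x.
Proof.
  intros H; apply (ex_derive_continuous (V := C_R_NormedModule) f); exists l; exact H.
Qed.

Lemma continuous_holomorphic_comp (g : C -> C) (gam : R -> C) (x : R) (l : C) :
  C_derivative g (gam x) l -> C_continuous gam x ->
  C_continuous (fun t => g (gam t)) x.
Proof.
  intros Hg Hc; apply continuous_C; intros eps He.
  destruct (C_derivative_continuous _ _ _ Hg eps He) as [d [Hd H]].
  destruct (continuous_C_inv _ _ Hc d Hd) as [d' [Hd' H']].
  exists d'; split; auto.
Qed.

Lemma CInt_correct (f : R -> C) (a b : R) :
  a <= b -> (forall x, a <= x <= b -> C_continuous f x) ->
  is_CInt f a b (CInt f a b).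
Proof.
  intros Hab H; apply (RInt_correct (V := C_R_CompleteNormedModule)).
  apply (ex_RInt_continuous (V := C_R_CompleteNormedModule)).
  intros z Hz; rewrite Rmin_left, Rmax_right in Hz by lra; apply H, Hz.
Qed.

(** [H] is a primitive of the first-order Taylor polynomial of [g] at [z0]. The integral of that
    polynomial depends on the endpoints only, and the remainder is at most [e * r] along the
    path. *)
Lemma path_integral_linear_part (g : C -> C) (gam gam' : R -> C) (z0 l : C) (a b e r L : R) :
  a <= b -> 0 <= r -> 0 <= e ->
  (forall x, CR_derive gam x (gam' x)) ->
  (forall x, C_continuous gam' x) ->
  (forall x, a <= x <= b -> C_continuous (fun t => g (gam t)) x) ->
  (forall x, a <= x <= b -> Cmod (gam x - z0) <= r /\ Cmod (gam' x) <= L) ->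
  (forall w, Cmod (w - z0) <= r -> Cmod (g w - g z0 - l * (w - z0)) <= e * Cmod (w - z0)) ->
  let H := fun w : C => ((g z0 - l * z0) * w + l / 2 * (w * w))%C in
  Cmod (CInt (fun x => g (gam x) * gam' x)%C a b - (H (gam b) - H (gam a))) <= (b - a) * (e * r * L).
Proof.
  intros Hab Hr He Hd Hc Hg Hb Hl H.
  assert (I1 := CInt_correct (fun x => g (gam x) * gam' x)%C a b Hab
    (fun x Hx => continuous_Cmult _ _ x (Hg x Hx) (Hc x))).
  assert (Hgc : forall x, C_continuous gam x)
    by (intros x; eapply is_derive_continuous_C, Hd).
  assert (I2 : is_CInt (fun x => (g z0 - l * z0 + l * gam x) * gam' x)%C a b (H (gam b) - H (gam a))%C).
  { apply (is_RInt_derive (V := C_R_CompleteNormedModule) (fun x => H (gam x))).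
    - intros x _.
      assert (D1 := is_derive_Cmult _ _ x _ _
        (is_derive_const (V := C_R_NormedModule) (g z0 - l * z0)%C x) (Hd x)).
      assert (D2 := is_derive_Cmult _ _ x _ _
        (is_derive_const (V := C_R_NormedModule) (l / 2)%C x) (is_derive_Cmult _ _ x _ _ (Hd x) (Hd x))).
      assert (D := is_derive_plus (V := C_R_NormedModule) _ _ _ _ _ D1 D2).
      refine (is_derive_val _ _ _ _ D _).
      change (RtoC 0 * gam x + (g z0 - l * z0) * gam' x
        + (RtoC 0 * (gam x * gam x) + l / 2 * (gam' x * gam x + gam x * gam' x))
        = (g z0 - l * z0 + l * gam x) * gam' x)%C; field.
    - intros x _; apply continuous_Cmult; [| apply Hc].
      apply (continuous_plus (V := C_R_NormedModule) (fun _ => (g z0 - l * z0)%C) (fun t => (l * gam t)%C)).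
      + apply (continuous_const (V := C_UniformSpace)).
      + apply continuous_Cmult; [apply (continuous_const (V := C_UniformSpace)) | apply Hgc]. }
  assert (I := is_RInt_minus (V := C_R_NormedModule) _ _ _ _ _ _ I1 I2).
  eapply is_CInt_bound; [exact Hab | | exact I].
  intros x Hx; destruct (Hb x Hx) as [h1 h2].
  change (Cmod (g (gam x) * gam' x - (g z0 - l * z0 + l * gam x) * gam' x)%C <= e * r * L).
  replace (g (gam x) * gam' x - (g z0 - l * z0 + l * gam x) * gam' x)%C
    with ((g (gam x) - g z0 - l * (gam x - z0)) * gam' x)%C by ring.
  rewrite Cmod_mult; apply Rmult_le_compat; try apply Cmod_ge_0; [| exact h2].
  eapply Rle_trans; [apply (Hl _ h1) | apply Rmult_le_compat_l; assumption].
Qed.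

(** The boundary integral is additive under subdivision. On a small rectangle the endpoint terms of
    the Taylor polynomial cancel around the boundary, and what remains is small compared with the
    square of the size. The image may overlap itself, as it does for homotopies of closed curves. *)
Lemma Goursat (g : C -> C) (Gam Gt Gs : R -> R -> C) (a0 b0 c0 d0 L : R) :
  a0 < b0 -> c0 < d0 -> 0 <= L ->
  (forall t s, CR_derive (fun t => Gam t s) t (Gt t s)) ->
  (forall t s, CR_derive (fun s => Gam t s) s (Gs t s)) ->
  (forall t s, C_continuous (fun t => Gt t s) t) ->
  (forall t s, C_continuous (fun s => Gs t s) s) ->
  (forall t s, a0 <= t <= b0 -> c0 <= s <= d0 -> Cmod (Gt t s) <= L /\ Cmod (Gs t s) <= L) ->
  (forall t s t' s', a0 <= t <= b0 -> c0 <= s <= d0 -> a0 <= t' <= b0 -> c0 <= s' <= d0 ->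
     Cmod (Gam t s - Gam t' s') <= L * (Rabs (t - t') + Rabs (s - s'))) ->
  (forall t s, a0 <= t <= b0 -> c0 <= s <= d0 -> exists l, C_derivative g (Gam t s) l) ->
  (CInt (fun t => g (Gam t c0) * Gt t c0) a0 b0 + CInt (fun s => g (Gam b0 s) * Gs b0 s) c0 d0
   = CInt (fun t => g (Gam t d0) * Gt t d0) a0 b0 + CInt (fun s => g (Gam a0 s) * Gs a0 s) c0 d0)%C.
Proof.
  intros Hab Hcd HL Dt Ds Ct Cs Hb HLip Hg.
  set (P := fun s t => (g (Gam t s) * Gt t s)%C).
  set (Q := fun t s => (g (Gam t s) * Gs t s)%C).
  set (J := fun a b c d => (CInt (P c) a b + CInt (Q b) c d - CInt (P d) a b - CInt (Q a) c d)%C).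
  assert (Cgt : forall t s, a0 <= t <= b0 -> c0 <= s <= d0 ->
    C_continuous (fun t => g (Gam t s)) t).
  { intros t s h1 h2; destruct (Hg t s h1 h2) as [l Hl].
    apply (continuous_holomorphic_comp g (fun t => Gam t s) t l Hl).
    eapply is_derive_continuous_C, Dt. }
  assert (Cgs : forall t s, a0 <= t <= b0 -> c0 <= s <= d0 ->
    C_continuous (fun s => g (Gam t s)) s).
  { intros t s h1 h2; destruct (Hg t s h1 h2) as [l Hl].
    apply (continuous_holomorphic_comp g (fun s => Gam t s) s l Hl).
    eapply is_derive_continuous_C, Ds. }
  assert (ChP : forall s a m b, c0 <= s <= d0 -> a0 <= a -> a <= m -> m <= b -> b <= b0 ->
    CInt (P s) a b = (CInt (P s) a m + CInt (P s) m b)%C).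
  { intros s a m b hs h1 h2 h3 h4; symmetry.
    apply (RInt_Chasles (V := C_R_CompleteNormedModule)); eexists; (apply CInt_correct; [lra |]);
      intros x Hx; (apply continuous_Cmult; [apply Cgt; lra | apply Ct]). }
  assert (ChQ : forall t c n d, a0 <= t <= b0 -> c0 <= c -> c <= n -> n <= d -> d <= d0 ->
    CInt (Q t) c d = (CInt (Q t) c n + CInt (Q t) n d)%C).
  { intros t c n d hs h1 h2 h3 h4; symmetry.
    apply (RInt_Chasles (V := C_R_CompleteNormedModule)); eexists; (apply CInt_correct; [lra |]);
      intros x Hx; (apply continuous_Cmult; [apply Cgs; lra | apply Cs]). }
  assert (HJ : J a0 b0 c0 d0 = RtoC 0).
  { apply additive_rectangle_function_zero; try assumption.
    - intros a m b c d h1 h2 h3 h4 h5 h6 h7; unfold J.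
      rewrite (ChP c a m b), (ChP d a m b) by lra; ring.
    - intros a b c n d h1 h2 h3 h4 h5 h6 h7; unfold J.
      rewrite (ChQ a c n d), (ChQ b c n d) by lra; ring.
    - intros t0 s0 ht hs eps He.
      destruct (Hg t0 s0 ht hs) as [l Hl].
      (* The four sides together contribute at most [2 * e * L^2 * w^2]; the summand [1] admits
         [L = 0]. *)
      set (e := eps / (4 * (L * L + 1))).
      assert (HL2 : 0 < L * L + 1) by nra.
      assert (He' : 0 < e) by (apply Rdiv_lt_0_compat; lra).
      destruct (proj1 (C_derivative_iff _ _ _) Hl e He') as [d1 [Hd1 H1]].
      exists (d1 / (L + 1)); split; [apply Rdiv_lt_0_compat; lra |].
      intros a b c d h1 h2 h3 h4 h5 h6 h7.
      set (w := b - a + (d - c)) in *.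
      assert (Hw0 : 0 <= w) by (unfold w; lra).
      assert (Hr : L * w < d1).
      { apply (Rmult_lt_compat_r (L + 1)) in h7; [| lra].
        replace (d1 / (L + 1) * (L + 1)) with d1 in h7 by (field; lra); nra. }
      assert (Hlin : forall z, Cmod (z - Gam t0 s0) <= L * w ->
        Cmod (g z - g (Gam t0 s0) - l * (z - Gam t0 s0)) <= e * Cmod (z - Gam t0 s0)).
      { intros z Hz; apply H1; lra. }
      set (H := fun z : C => ((g (Gam t0 s0) - l * Gam t0 s0) * z + l / 2 * (z * z))%C).
      assert (Hdist : forall t s, a <= t <= b -> c <= s <= d -> Cmod (Gam t s - Gam t0 s0) <= L * w).
      { intros t s k1 k2; eapply Rle_trans; [apply HLip; lra |].
        apply Rmult_le_compat_l; [exact HL |].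
        apply Rplus_le_compat; apply Rabs_le; lra. }
      assert (KP : forall s, c <= s <= d ->
        Cmod (CInt (P s) a b - (H (Gam b s) - H (Gam a s))) <= (b - a) * (e * (L * w) * L)).
      { intros s k. apply (path_integral_linear_part g (fun t => Gam t s) (fun t => Gt t s) _ l); try lra.
        - nra.
        - intros x; apply Dt.
        - intros x; apply Ct.
        - intros x hx; apply Cgt; lra.
        - intros x hx; split; [apply Hdist; lra | apply Hb; lra].
        - exact Hlin. }
      assert (KQ : forall t, a <= t <= b ->
        Cmod (CInt (Q t) c d - (H (Gam t d) - H (Gam t c))) <= (d - c) * (e * (L * w) * L)).
      { intros t k. apply (path_integral_linear_part g (fun s => Gam t s) (fun s => Gs t s) _ l); try lra.
        - nra.
        - intros x; apply Ds.
        - intros x; apply Cs.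
        - intros x hx; apply Cgs; lra.
        - intros x hx; split; [apply Hdist; lra | apply Hb; lra].
        - exact Hlin. }
      assert (k1 := KP c ltac:(lra)); assert (k2 := KQ b ltac:(lra)).
      assert (k3 := KP d ltac:(lra)); assert (k4 := KQ a ltac:(lra)).
      match type of k1 with Cmod ?z <= _ => set (z1 := z) in * end.
      match type of k2 with Cmod ?z <= _ => set (z2 := z) in * end.
      match type of k3 with Cmod ?z <= _ => set (z3 := z) in * end.
      match type of k4 with Cmod ?z <= _ => set (z4 := z) in * end.
      replace (J a b c d) with (z1 + z2 + (- z3 + - z4))%C by (unfold J, z1, z2, z3, z4; ring).
      eapply Rle_trans; [apply Cmod_triangle |].
      assert (T1 := Cmod_triangle z1 z2); assert (T2 := Cmod_triangle (- z3) (- z4)).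
      rewrite !Cmod_opp in T2.
      assert (E : e * (L * w) * L * w * 2 <= eps * w ^ 2).
      { replace (e * (L * w) * L * w * 2) with (e * (L * L) * 2 * w ^ 2) by ring.
        apply Rmult_le_compat_r; [apply pow2_ge_0 |].
        assert (E1 : e * (L * L + 1) = eps / 4) by (unfold e; field; lra).
        nra. }
      assert (E2 : (b - a) * (e * (L * w) * L) + (d - c) * (e * (L * w) * L) = e * (L * w) * L * w) by (unfold w; ring).
      lra. }
  unfold J in HJ.
  apply Ceq_minus; rewrite <- HJ; unfold P, Q; ring.
Qed.

Definition cis (s : R) : C := (cos s, sin s).

Lemma Cmod_cis (s : R) : Cmod (cis s) = 1.
Proof.
  unfold Cmod, cis; simpl; rewrite !Rmult_1_r.
  rewrite Rplus_comm; change (sqrt (Rsqr (sin s) + Rsqr (cos s)) = 1).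
  rewrite sin2_cos2; apply sqrt_1.
Qed.

Lemma cis_neq_0 (s : R) : cis s <> RtoC 0.
Proof. apply Cmod_gt_0; rewrite Cmod_cis; lra. Qed.

Lemma is_derive_cis (s : R) : CR_derive cis s (Ci * cis s)%C.
Proof.
  apply is_derive_C; unfold cis, Re, Im; simpl.
  - auto_derive; [exact I | ring].
  - auto_derive; [exact I | ring].
Qed.

Lemma Cplus_cancel (a b c d : C) : (a + b = c + d)%C -> a = c -> b = d.
Proof.
  intros H <-; transitivity (a + b - a)%C; [ring | rewrite H; ring].
Qed.

Lemma Cmod_le_sum (x : C) : Cmod x <= Rabs (Re x) + Rabs (Im x).
Proof.
  replace x with (RtoC (Re x) + Ci * RtoC (Im x))%C at 1
    by (apply C_ext; unfold Re, Im; simpl; ring).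
  eapply Rle_trans; [apply Cmod_triangle |].
  rewrite Cmod_mult, Cmod_Ci, !Cmod_R; lra.
Qed.

Lemma cis_lipschitz (s s' : R) : Cmod (cis s - cis s') <= 2 * Rabs (s - s').
Proof.
  eapply Rle_trans; [apply Cmod_le_sum |]; unfold cis, Re, Im; simpl.
  assert (h1 : Rabs (cos s - cos s') <= 1 * Rabs (s - s')).
  { apply (bounded_variation cos (fun x => - sin x)); intros t _; split.
    - auto_derive; [exact I | ring].
    - apply Rabs_le; destruct (SIN_bound t); lra. }
  assert (h2 : Rabs (sin s - sin s') <= 1 * Rabs (s - s')).
  { apply (bounded_variation sin cos); intros t _; split.
    - auto_derive; [exact I | ring].
    - apply Rabs_le; destruct (COS_bound t); lra. }
  unfold Rminus in *; lra.
Qed.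

Definition circle_integral (g : C -> C) (z : C) (r : R) : C :=
  CInt (fun s => g (z + r * cis s) * (r * (Ci * cis s)))%C 0 (2 * PI).

(** [Gam] is the linear homotopy from the circle about [z] to that about [z + v]. The sides [s = 0]
    and [s = 2 * PI] of the parameter rectangle have the same image, so their integrals cancel. *)
Lemma circle_homotopy (g : C -> C) (z v : C) (rho k : R) :
  (forall t s, 0 <= t <= 1 -> exists l, C_derivative g (z + t * v + (rho + t * k)%R * cis s)%C l) ->
  circle_integral g z rho = circle_integral g (z + v) (rho + k).
Proof.
  intros Hg.
  set (Gam := fun t s : R => (z + t * v + (rho + t * k)%R * cis s)%C).
  set (Gt := fun t s : R => (v + k * cis s)%C).
  set (Gs := fun t s : R => ((rho + t * k)%R * (Ci * cis s))%C).
  assert (Hv := Cmod_ge_0 v); assert (Hr := Rabs_pos rho); assert (Hk := Rabs_pos k).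
  assert (HRK : forall t, 0 <= t <= 1 -> Rabs (rho + t * k) <= Rabs rho + Rabs k).
  { intros t Ht; eapply Rle_trans; [apply Rabs_triang |]; apply Rplus_le_compat_l.
    rewrite Rabs_mult, (Rabs_pos_eq t) by lra; nra. }
  assert (HGt : forall t s, Cmod (Gt t s) <= Cmod v + Rabs k).
  { intros t s; unfold Gt; eapply Rle_trans; [apply Cmod_triangle |].
    rewrite Cmod_mult, Cmod_R, Cmod_cis; lra. }
  assert (E := Goursat g Gam Gt Gs 0 1 0 (2 * PI) (Cmod v + 2 * Rabs rho + 2 * Rabs k)).
  match type of E with _ -> _ -> _ -> _ -> _ -> _ -> _ -> _ -> _ -> _ -> ?X => assert (E' : X) end.
  { assert (HPI := PI_RGT_0).
    apply E; clear E; try lra.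
    - intros t s; apply is_derive_C; unfold Gam, Gt, Re, Im; simpl; auto_derive; auto; ring.
    - intros t s; apply is_derive_C; unfold Gam, Gs, Re, Im; simpl; auto_derive; auto; ring.
    - intros t s; apply (continuous_const (V := C_UniformSpace)).
    - intros t s; apply continuous_Cmult; [apply (continuous_const (V := C_UniformSpace)) |].
      apply continuous_Cmult; [apply (continuous_const (V := C_UniformSpace)) |].
      eapply is_derive_continuous_C, is_derive_cis.
    - intros t s Ht Hs; split.
      + eapply Rle_trans; [apply HGt |]; lra.
      + unfold Gs; rewrite !Cmod_mult, Cmod_R, Cmod_Ci, Cmod_cis.
        specialize (HRK t Ht); lra.
    - intros t s t' s' Ht Hs Ht' Hs'.
      replace (Gam t s - Gam t' s')%C
        with (RtoC (t - t') * Gt t s + RtoC (rho + t' * k) * (cis s - cis s'))%C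
        by (apply C_ext; unfold Gam, Gt; simpl; ring).
      eapply Rle_trans; [apply Cmod_triangle |]; rewrite !Cmod_mult, !Cmod_R.
      assert (A1 : Rabs (t - t') * Cmod (Gt t s) <= Rabs (t - t') * (Cmod v + Rabs k))
        by (apply Rmult_le_compat_l; [apply Rabs_pos | apply HGt]).
      assert (A2 : Rabs (rho + t' * k) * Cmod (cis s - cis s') <= (Rabs rho + Rabs k) * (2 * Rabs (s - s')))
        by (apply Rmult_le_compat; [apply Rabs_pos | apply Cmod_ge_0 | apply HRK, Ht' | apply cis_lipschitz]).
      assert (B1 := Rabs_pos (t - t')); assert (B2 := Rabs_pos (s - s')); nra.
    - intros t s Ht _; apply Hg, Ht. }
  clear E.
  assert (E0 : CInt (fun t => g (Gam t 0) * Gt t 0)%C 0 1 = CInt (fun t => g (Gam t (2 * PI)%R) * Gt t (2 * PI)%R)%C 0 1).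
  { apply (RInt_ext (V := C_R_CompleteNormedModule)); intros t _.
    unfold Gam, Gt, cis; rewrite cos_2PI, sin_2PI, cos_0, sin_0; reflexivity. }
  assert (E1 := Cplus_cancel _ _ _ _ E' E0).
  unfold circle_integral; transitivity (CInt (fun s => g (Gam 0 s) * Gs 0 s)%C 0 (2 * PI)).
  - apply (RInt_ext (V := C_R_CompleteNormedModule)); intros s _; unfold Gam, Gs.
    replace (rho + 0 * k) with rho by ring.
    replace (z + RtoC 0 * v + RtoC rho * cis s)%C with (z + RtoC rho * cis s)%C by ring; reflexivity.
  - rewrite <- E1; apply (RInt_ext (V := C_R_CompleteNormedModule)); intros s _; unfold Gam, Gs.
    replace (rho + 1 * k) with (rho + k) by ring.
    replace (z + RtoC 1 * v + RtoC (rho + k) * cis s)%C with (z + v + RtoC (rho + k) * cis s)%C by ring; reflexivity.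
Qed.

Lemma C_derivative_inv (w : C) : w <> RtoC 0 -> C_derivative Cinv w (- / (w * w))%C.
Proof.
  intros Hw; assert (HD : 0 < Cmod w) by (apply Cmod_gt_0, Hw).
  apply C_derivative_iff; intros eps He.
  assert (He' : 0 < eps * Cmod w ^ 3 / 2) by (assert (0 < Cmod w ^ 3) by (apply pow_lt; lra); nra).
  choose_below d [Cmod w / 2; eps * Cmod w ^ 3 / 2].
  exists d; split; [assumption |]; intros u Hu; set (h := (u - w)%C) in *; assert (Hh := Cmod_ge_0 h).
  assert (HU : Cmod w / 2 <= Cmod u).
  { assert (T := Cmod_triangle u (- h)); rewrite Cmod_opp in T.
    replace (u + - h)%C with w in T by (unfold h; ring); lra. }
  assert (Hu0 : u <> RtoC 0) by (apply Cmod_gt_0; lra).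
  replace (/ u - / w - - / (w * w) * h)%C with (h * h / (u * (w * w)))%C by (unfold h; field; split; assumption).
  rewrite Cmod_div, !Cmod_mult by (repeat apply Cmult_neq_0; assumption).
  apply Rle_trans with (Cmod h * (eps * Cmod w ^ 3 / 2) / (Cmod w / 2 * (Cmod w * Cmod w))); [| right; field; lra].
  apply Rmult_le_compat; [nra | left; apply Rinv_0_lt_compat; repeat apply Rmult_lt_0_compat; lra | apply Rmult_le_compat_l; lra |].
  apply Rinv_le_contravar; [repeat apply Rmult_lt_0_compat; lra |]; apply Rmult_le_compat_r; [nra | exact HU].
Qed.

Lemma C_derivative_div_linear (f : C -> C) (z w l : C) :
  w <> z -> C_derivative f w l -> exists l', C_derivative (fun u => f u / (u - z))%C w l'.
Proof.
  intros Hwz Hf; eexists; apply C_derivative_mult; [exact Hf |].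
  apply (is_derive_ext (K := C_AbsRing) (V := C_NormedModule) (fun u => / (u * 1 + - z))%C); [intros u; f_equal; ring |].
  apply (C_derivative_comp_affine Cinv), C_derivative_inv.
  intros E; apply Hwz, Ceq_minus; rewrite <- E; ring.
Qed.

(** The circle is deformed to one of small radius [rho] about [z], where the integrand in [s] is
    [f * Ci] along the circle, which is close to the constant [f z * Ci]. The difference [D] is thus
    bounded by [2 * PI * eps] for every [eps]. *)
Lemma Cauchy_formula (f : C -> C) (c z : C) (R0 r : R) :
  (forall w, Cmod (w - c) < R0 -> exists l, C_derivative f w l) ->
  r < R0 -> Cmod (z - c) < r ->
  circle_integral (fun u => f u / (u - z))%C c r = (2 * PI * Ci * f z)%C.
Proof.
  intros Hf Hr Hz.
  assert (HPI := PI_RGT_0).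
  assert (Hz0 := Cmod_ge_0 (z - c)).
  assert (Hzc : Cmod (c - z) = Cmod (z - c)).
  { rewrite <- Cmod_opp; f_equal; ring. }
  set (D := (circle_integral (fun u => f u / (u - z)) c r - 2 * PI * Ci * f z)%C).
  assert (HD : forall eps, 0 < eps -> Cmod D <= 2 * PI * eps).
  { intros eps He.
    destruct (Hf z) as [l Hl]; [lra |].
    destruct (C_derivative_continuous _ _ _ Hl eps He) as [d [Hd H]].
    choose_below rho [d / 2; (r - Cmod (z - c)) / 2].
    assert (E := circle_homotopy (fun u => f u / (u - z))%C z (c - z) rho (r - rho)).
    replace (z + (c - z))%C with c in E by ring.
    replace (rho + (r - rho)) with r in E by ring.
    unfold D; rewrite <- E.
    - clear E.
      assert (Hcf : forall s, C_continuous (fun s => f (z + rho * cis s)%C * Ci)%C s).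
      { intros s; apply continuous_Cmult; [| apply (continuous_const (V := C_UniformSpace))].
        destruct (Hf (z + rho * cis s)%C) as [l' Hl'].
        - replace (z + rho * cis s - c)%C with ((z - c) + rho * cis s)%C by ring.
          eapply Rle_lt_trans; [apply Cmod_triangle |].
          rewrite Cmod_mult, Cmod_R, Cmod_cis, Rabs_pos_eq; lra.
        - apply (continuous_holomorphic_comp f (fun s => z + rho * cis s)%C s l' Hl').
          apply (continuous_plus (V := C_R_NormedModule) (fun _ => z) (fun s => rho * cis s)%C).
          + apply (continuous_const (V := C_UniformSpace)).
          + apply continuous_Cmult; [apply (continuous_const (V := C_UniformSpace)) |].
            eapply is_derive_continuous_C, is_derive_cis. }
      assert (I1 := CInt_correct _ 0 (2 * PI) ltac:(lra) (fun x _ => Hcf x)).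
      assert (I2 := is_RInt_const (V := C_R_NormedModule) 0 (2 * PI) (f z * Ci)%C).
      assert (I := is_RInt_minus (V := C_R_NormedModule) _ _ _ _ _ _ I1 I2).
      assert (E1 : circle_integral (fun u => f u / (u - z))%C z rho = CInt (fun s => f (z + rho * cis s) * Ci)%C 0 (2 * PI)).
      { apply (RInt_ext (V := C_R_CompleteNormedModule)); intros s _.
        replace (z + rho * cis s - z)%C with (rho * cis s)%C by ring.
        cbv beta; match goal with |- ?a = ?b => change (@eq C a b) end.
        field; split; [apply cis_neq_0 |]; intros E; apply RtoC_inj in E; lra. }
      rewrite E1.
      replace (2 * PI * eps) with ((2 * PI - 0) * eps) by ring.
      replace (2 * PI * Ci * f z)%C with (scal (V := C_R_NormedModule) (2 * PI - 0) (f z * Ci)%C).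
      + apply (fun B => is_CInt_bound _ 0 (2 * PI) eps _ ltac:(lra) B I).
        intros s _; change (Cmod (f (z + rho * cis s) * Ci - f z * Ci)%C <= eps).
        replace (f (z + rho * cis s) * Ci - f z * Ci)%C with ((f (z + rho * cis s) - f z) * Ci)%C by ring.
        rewrite Cmod_mult, Cmod_Ci, Rmult_1_r; left; apply H.
        replace (z + rho * cis s - z)%C with (rho * cis s)%C by ring.
        rewrite Cmod_mult, Cmod_R, Cmod_cis, Rabs_pos_eq; lra.
      + rewrite scal_R_Cmult; replace (2 * PI - 0) with (2 * PI) by ring.
        rewrite RtoC_mult; match goal with |- ?a = ?b => change (@eq C a b) end; ring.
    - intros t s Ht.
      set (u := (z + t * (c - z) + (rho + t * (r - rho))%R * cis s)%C).
      assert (Hpos : 0 < rho + t * (r - rho)) by nra.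
      assert (Ht1 : Cmod (t * (c - z)) = t * Cmod (z - c)).
      { rewrite Cmod_mult, Cmod_R, Rabs_pos_eq, Hzc by lra; reflexivity. }
      assert (Hcis : Cmod ((rho + t * (r - rho))%R * cis s) = rho + t * (r - rho)).
      { rewrite Cmod_mult, Cmod_R, Cmod_cis, Rabs_pos_eq by lra; ring. }
      (* At time [t] the centre has distance [t * Cmod (z - c)] from [z], and the radius exceeds
         this: [z] stays strictly inside. *)
      assert (Hu : u <> z).
      { intros Eu.
        assert (E' : ((rho + t * (r - rho))%R * cis s = - (t * (c - z)))%C).
        { apply Ceq_minus; transitivity (u - z)%C; [unfold u; ring | rewrite Eu; ring]. }
        rewrite E', Cmod_opp, Ht1 in Hcis; nra. }
      destruct (Hf u) as [l' Hl'].
      + replace (u - c)%C with (RtoC (1 - t) * (z - c) + (rho + t * (r - rho))%R * cis s)%C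
          by (unfold u; rewrite RtoC_minus; ring).
        eapply Rle_lt_trans; [apply Cmod_triangle |]; rewrite Hcis, Cmod_mult, Cmod_R, Rabs_pos_eq by lra.
        nra.
      + eapply C_derivative_div_linear; eassumption. }
  apply Ceq_minus; fold D; apply Cmod_eq_0, Rle_antisym; [| apply Cmod_ge_0].
  apply Rnot_lt_le; intros Hp.
  specialize (HD (Cmod D / (4 * PI))).
  replace (2 * PI * (Cmod D / (4 * PI))) with (Cmod D / 2) in HD by (field; lra).
  assert (0 < Cmod D / (4 * PI)) by (apply Rdiv_lt_0_compat; lra); lra.
Qed.

(** * Cauchy estimates *)

Definition hol_bounded (f : C -> C) (c : C) (r M : R) : Prop :=
  forall w, Cmod (w - c) < r -> (exists l, C_derivative f w l) /\ Cmod (f w) <= M.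

Lemma circle_integral_correct (g : C -> C) (c : C) (r : R) :
  (forall s, exists l, C_derivative g (c + r * cis s)%C l) ->
  is_CInt (fun s => g (c + r * cis s) * (r * (Ci * cis s)))%C 0 (2 * PI) (circle_integral g c r).
Proof.
  intros Hg; assert (HPI := PI_RGT_0); apply CInt_correct; [lra |]; intros s _.
  assert (Hc : C_continuous cis s) by (eapply is_derive_continuous_C, is_derive_cis).
  assert (Hk : forall k : C, C_continuous (fun _ : R => k) s)
    by (intros k; apply (continuous_const (V := C_UniformSpace))).
  apply continuous_Cmult; [| apply continuous_Cmult; [| apply continuous_Cmult]; auto].
  destruct (Hg s) as [l Hl].
  apply (continuous_holomorphic_comp g (fun s => c + r * cis s)%C s l Hl).
  apply (continuous_plus (V := C_R_NormedModule) (fun _ => c) (fun s => r * cis s)%C); [apply Hk |].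
  apply continuous_Cmult; auto.
Qed.

Lemma circle_integral_bound (g : C -> C) (c l : C) (r B : R) :
  0 <= r -> (forall s, Cmod (g (c + r * cis s)%C) <= B) ->
  is_CInt (fun s => g (c + r * cis s) * (r * (Ci * cis s)))%C 0 (2 * PI) l ->
  Cmod l <= 2 * PI * (B * r).
Proof.
  intros Hr HB H; assert (HPI := PI_RGT_0).
  replace (2 * PI * (B * r)) with ((2 * PI - 0) * (B * r)) by ring.
  refine (is_CInt_bound _ _ _ _ _ _ _ H); [lra |]; intros s _.
  rewrite !Cmod_mult, Cmod_R, Cmod_Ci, Cmod_cis, Rabs_pos_eq by exact Hr.
  rewrite !Rmult_1_r; apply Rmult_le_compat_r; auto.
Qed.

Lemma Cmod_2PiI : Cmod (2 * PI * Ci) = 2 * PI.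
Proof.
  assert (HPI := PI_RGT_0).
  rewrite !Cmod_mult, Cmod_Ci, !Cmod_R, !Rabs_pos_eq by lra; ring.
Qed.

Lemma derivative_of_quadratic_bound (f : C -> C) (c l : C) (K r : R) :
  0 <= K -> 0 < r ->
  (forall z, Cmod (z - c) <= r -> Cmod (f z - f c - l * (z - c)) <= K * Cmod (z - c) ^ 2) -> C_derivative f c l.
Proof.
  intros HK Hr H; apply C_derivative_iff; intros eps He.
  choose_below d [r; eps / (K + 1)]; exists d; split; [assumption |]; intros w Hw.
  eapply Rle_trans; [apply H; lra |].
  assert (h := Cmod_ge_0 (w - c)); assert (Q := small_mult K (Cmod (w - c)) eps HK h ltac:(lra)).
  simpl; rewrite Rmult_1_r, <- Rmult_assoc; apply Rmult_le_compat_r; assumption.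
Qed.

(** Cauchy's formula on the circle of radius [R0 / 2] is combined with the identity [1/(u-z) -
    1/(u-c) - (z-c)/(u-c)^2 = (z-c)^2 / ((u-z)(u-c)^2)]. For [Cmod (z - c) <= R0 / 4] the distance
    from [u] to [z] is at least [R0 / 4], whence the constant [8]. *)
Lemma Cauchy_estimates (f : C -> C) (c l : C) (R0 M : R) :
  0 < R0 -> hol_bounded f c R0 M -> C_derivative f c l ->
  Cmod l <= 2 * M / R0 /\
  forall z, Cmod (z - c) <= R0 / 4 -> Cmod (f z - f c - l * (z - c)) <= 8 * M / R0 ^ 2 * Cmod (z - c) ^ 2.
Proof.
  intros HR Hf Hl; assert (HPI := PI_RGT_0).
  set (r := R0 / 2); assert (Hr : 0 < r) by (unfold r; lra).
  assert (HM : 0 <= M).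
  { eapply Rle_trans; [apply Cmod_ge_0 |]; apply (Hf c).
    replace (c - c)%C with (RtoC 0) by ring; rewrite Cmod_0; exact HR. }
  assert (Hzeta : forall s, Cmod (r * cis s) = r).
  { intros s; rewrite Cmod_mult, Cmod_R, Cmod_cis, Rabs_pos_eq; lra. }
  assert (Hin : forall s, Cmod (c + r * cis s - c) < R0).
  { intros s; replace (c + r * cis s - c)%C with (r * cis s)%C by ring; rewrite Hzeta; unfold r; lra. }
  assert (Hne : forall z s, Cmod (z - c) <= r / 2 -> r / 2 <= Cmod (c + r * cis s - z)).
  { intros z s Hz.
    assert (T := Cmod_triangle (c + r * cis s - z) (z - c)).
    replace (c + r * cis s - z + (z - c))%C with (r * cis s)%C in T by ring; rewrite Hzeta in T; lra. }
  assert (Hneq : forall z s, Cmod (z - c) <= r / 2 -> (c + r * cis s)%C <> z).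
  { intros z s Hz E; specialize (Hne z s Hz); rewrite E in Hne.
    replace (z - z)%C with (RtoC 0) in Hne by ring; rewrite Cmod_0 in Hne; lra. }
  assert (Hcc : Cmod (c - c) <= r / 2) by (replace (c - c)%C with (RtoC 0) by ring; rewrite Cmod_0; lra).
  assert (D1 : forall z s, Cmod (z - c) <= r / 2 ->
    exists l, C_derivative (fun u => f u / (u - z))%C (c + r * cis s)%C l).
  { intros z s Hz; destruct (Hf _ (Hin s)) as [[l' Hl'] _].
    eapply C_derivative_div_linear; [apply Hneq, Hz | exact Hl']. }
  assert (D2 : forall s, exists l, C_derivative (fun u => f u / (u - c) / (u - c))%C (c + r * cis s)%C l).
  { intros s; destruct (D1 c s Hcc) as [l' Hl'].
    eapply C_derivative_div_linear; [apply Hneq, Hcc | exact Hl']. }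
  assert (I2 := circle_integral_correct (fun u => f u / (u - c) / (u - c))%C c r D2).
  set (A := circle_integral (fun u => f u / (u - c) / (u - c))%C c r) in *.
  assert (HA : Cmod A <= 2 * PI * (M / r ^ 2 * r)).
  { apply (circle_integral_bound (fun u => f u / (u - c) / (u - c))%C c A r); [lra | | exact I2].
    intros s; destruct (Hf _ (Hin s)) as [_ Hb].
    replace (c + r * cis s - c)%C with (r * cis s)%C by ring.
    assert (Hnz : (r * cis s)%C <> RtoC 0) by (apply Cmod_gt_0; rewrite Hzeta; exact Hr).
    rewrite !Cmod_div, Hzeta by assumption.
    replace (M / r ^ 2) with (M / r / r) by (field; lra).
    repeat (apply Rmult_le_compat_r; [left; apply Rinv_0_lt_compat, Hr |]); exact Hb. }
  assert (H2 : forall z, Cmod (z - c) <= R0 / 4 ->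
    Cmod (2 * PI * Ci * (f z - f c) - (z - c) * A) <= 2 * PI * (8 * M / R0 ^ 2 * Cmod (z - c) ^ 2)).
  { intros z Hz; assert (Hz' : Cmod (z - c) <= r / 2) by (unfold r; lra).
    assert (I0 := circle_integral_correct (fun u => f u / (u - z))%C c r (fun s => D1 z s Hz')).
    assert (I1 := circle_integral_correct (fun u => f u / (u - c))%C c r (fun s => D1 c s Hcc)).
    rewrite (Cauchy_formula f c z R0 r) in I0; [| apply Hf | unfold r; lra | unfold r in *; lra].
    rewrite (Cauchy_formula f c c R0 r) in I1; [| apply Hf | unfold r; lra | unfold r in *; lra].
    assert (I := is_RInt_minus (V := C_R_NormedModule) _ _ _ _ _ _
      (is_RInt_minus (V := C_R_NormedModule) _ _ _ _ _ _ I0 I1) (is_CInt_Cmult (z - c) _ _ _ _ I2)).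
    match type of I with is_RInt _ _ _ ?L =>
      replace (2 * PI * Ci * (f z - f c) - (z - c) * A)%C with L
        by (change (@eq C (2 * PI * Ci * f z - 2 * PI * Ci * f c - (z - c) * A)%C (2 * PI * Ci * (f z - f c) - (z - c) * A)%C); ring) end.
    replace (2 * PI * (8 * M / R0 ^ 2 * Cmod (z - c) ^ 2))
      with (2 * PI * (M * Cmod (z - c) ^ 2 / (r / 2 * r * r) * r)) by (unfold r; field; lra).
    eapply (circle_integral_bound (fun u => f u * ((z - c) * (z - c)) / ((u - z) * (u - c) * (u - c)))%C c);
      [lra | |].
    - intros s; destruct (Hf _ (Hin s)) as [_ Hb]; cbv beta.
      specialize (Hne z s Hz'); assert (Hq := Hneq z s Hz').
      replace (c + r * cis s - c)%C with (r * cis s)%C by ring.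
      assert (Hnz : (r * cis s)%C <> RtoC 0) by (apply Cmod_gt_0; rewrite Hzeta; exact Hr).
      assert (Hnz' : (c + r * cis s - z)%C <> RtoC 0) by (apply Cmod_gt_0; lra).
      rewrite Cmod_div by (apply Cmult_neq_0; [apply Cmult_neq_0 |]; assumption).
      rewrite !(Cmod_mult _ (r * cis s)), Hzeta, !Cmod_mult.
      assert (Hz0 := Cmod_ge_0 (z - c)).
      apply Rmult_le_compat.
      + apply Rmult_le_pos; [apply Cmod_ge_0 | nra].
      + left; apply Rinv_0_lt_compat; repeat apply Rmult_lt_0_compat; lra.
      + simpl; rewrite Rmult_1_r; apply Rmult_le_compat_r; [nra | exact Hb].
      + apply Rinv_le_contravar; [repeat apply Rmult_lt_0_compat; lra |].
        repeat apply Rmult_le_compat_r; lra.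
    - eapply is_RInt_ext; [| exact I]; intros s _.
      match goal with |- ?a = ?b => change (@eq C a b) end.
      set (u := (c + r * cis s)%C).
      assert (Hnz : (u - z)%C <> RtoC 0) by (intros E; apply (Hneq z s Hz'), Ceq_minus, E).
      assert (Hnz' : (u - c)%C <> RtoC 0) by (intros E; apply (Hneq c s Hcc), Ceq_minus, E).
      change (f u / (u - z) * (r * (Ci * cis s)) - f u / (u - c) * (r * (Ci * cis s))
        - (z - c) * (f u / (u - c) / (u - c) * (r * (Ci * cis s)))
        = f u * ((z - c) * (z - c)) / ((u - z) * (u - c) * (u - c)) * (r * (Ci * cis s)))%C.
      field; split; assumption. }
  assert (HPC : (2 * PI * Ci)%C <> RtoC 0) by (apply Cmod_gt_0; rewrite Cmod_2PiI; lra).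
  set (a := (A / (2 * PI * Ci))%C).
  assert (H3 : forall z, Cmod (z - c) <= R0 / 4 ->
    Cmod (f z - f c - a * (z - c)) <= 8 * M / R0 ^ 2 * Cmod (z - c) ^ 2).
  { intros z Hz; specialize (H2 z Hz).
    replace (f z - f c - a * (z - c))%C with ((2 * PI * Ci * (f z - f c) - (z - c) * A) / (2 * PI * Ci))%C.
    - rewrite Cmod_div, Cmod_2PiI by exact HPC.
      apply (Rmult_le_reg_l (2 * PI)); [lra |].
      eapply Rle_trans; [| exact H2]; right; field; lra.
    - unfold a; field; repeat split; [apply Ci_nz |]; intros E; apply RtoC_inj in E; lra. }
  (* The quadratic bound shows that [a], defined by an integral, is a derivative of [f] at [c];
     uniqueness identifies it with [l]. *)
  assert (Ea : l = a).
  { apply (C_derivative_unique f c); [exact Hl |].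
    apply (derivative_of_quadratic_bound f c a (8 * M / R0 ^ 2) (R0 / 4)); [apply Rdiv_le_0_compat; nra | lra | exact H3]. }
  rewrite Ea; split; [| exact H3].
  unfold a; rewrite Cmod_div, Cmod_2PiI by exact HPC.
  apply (Rmult_le_reg_l (2 * PI)); [lra |].
  replace (2 * PI * (Cmod A / (2 * PI))) with (Cmod A) by (field; lra).
  eapply Rle_trans; [exact HA |]; right; unfold r; field; lra.
Qed.

Lemma C_cauchy_sequence (u : nat -> C) :
  (forall eps, 0 < eps -> exists N, forall n m, (N <= n)%nat -> (N <= m)%nat -> Cmod (u n - u m) < eps) ->
  exists l, forall eps, 0 < eps -> exists N, forall n, (N <= n)%nat -> Cmod (u n - l) < eps.
Proof.
  intros H.
  destruct (proj1 (filterlim_locally_cauchy (U := C_R_CompleteNormedModule) (F := eventually) u)) as [l Hl].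
  - intros eps; destruct (H eps (cond_pos eps)) as [N HN]; exists (fun n => (N <= n)%nat); split; [now exists N |].
    intros n m Hn Hm; apply ball_C, HN; assumption.
  - exists l; intros eps He; destruct (ball_C_inv eps He) as [d Hd].
    destruct (proj1 (filterlim_locally _ _) Hl d) as [N HN]; exists N; intros n Hn; apply Hd, HN, Hn.
Qed.

(** Weierstrass' theorem at one point. By Cauchy's estimates for differences, the derivatives at [c]
    of the approximating functions form a Cauchy sequence, and the quadratic Taylor bound, whose
    constant is the same for all of them, passes to the limit. *)
Lemma uniform_limit_derivable (f : C -> C) (c : C) (r M : R) :
  0 < r -> (forall w, Cmod (w - c) < r -> Cmod (f w) <= M) ->
  (forall eps, 0 < eps -> exists g, forall w, Cmod (w - c) < r ->
     (exists l, C_derivative g w l) /\ Cmod (g w - f w) <= eps) ->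
  exists l, C_derivative f c l.
Proof.
  intros Hr HM Happ.
  assert (Hcc : Cmod (c - c) < r) by (replace (c - c)%C with (RtoC 0) by ring; rewrite Cmod_0; lra).
  pose (e := fun n : nat => / (INR n + 1)).
  assert (He : forall n, 0 < e n <= 1).
  { intros n; unfold e; assert (h := pos_INR n); split; [apply Rinv_0_lt_compat; lra |].
    rewrite <- Rinv_1; apply Rinv_le_contravar; lra. }
  assert (He0 : forall eps, 0 < eps -> exists N, forall n, (N <= n)%nat -> e n < eps).
  { intros eps Hp; destruct (archimed_cor1 eps Hp) as [N [HN HN0]]; exists N; intros n Hn.
    eapply Rlt_trans; [| exact HN]; unfold e; apply Rinv_lt_contravar.
    - apply Rmult_lt_0_compat; [now apply lt_0_INR |]; assert (h := pos_INR n); lra.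
    - apply le_INR in Hn; lra. }
  assert (Hex : forall n, exists gl : (C -> C) * C,
    (forall w, Cmod (w - c) < r -> (exists l, C_derivative (fst gl) w l) /\ Cmod (fst gl w - f w) <= e n) /\
    C_derivative (fst gl) c (snd gl)).
  { intros n; destruct (Happ (e n)) as [g Hg]; [apply He |].
    destruct (Hg c Hcc) as [[l Hl] _]; exists (g, l); split; assumption. }
  pose (G := fun n => proj1_sig (constructive_indefinite_description _ (Hex n))).
  assert (HG : forall n,
    (forall w, Cmod (w - c) < r -> (exists l, C_derivative (fst (G n)) w l) /\ Cmod (fst (G n) w - f w) <= e n) /\
    C_derivative (fst (G n)) c (snd (G n))).
  { intros n; unfold G; apply proj2_sig. }
  assert (Hcau : forall n m, Cmod (snd (G n) - snd (G m)) <= 2 * (e n + e m) / r).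
  { intros n m; destruct (HG n) as [g1 d1], (HG m) as [g2 d2].
    assert (D := is_derive_minus _ _ _ _ _ d1 d2).
    apply (Cauchy_estimates _ c _ r (e n + e m) Hr) in D; [apply D |].
    intros w Hw; destruct (g1 w Hw) as [[l1 h1] b1], (g2 w Hw) as [[l2 h2] b2]; split.
    - eexists; apply (is_derive_minus _ _ _ _ _ h1 h2).
    - change (Cmod (fst (G n) w - fst (G m) w)%C <= e n + e m).
      replace (fst (G n) w - fst (G m) w)%C with ((fst (G n) w - f w) + - (fst (G m) w - f w))%C by ring.
      eapply Rle_trans; [apply Cmod_triangle |]; rewrite Cmod_opp; lra. }
  destruct (C_cauchy_sequence (fun n => snd (G n))) as [l Hl].
  { intros eps Hp; destruct (He0 (eps * r / 5)) as [N HN]; [apply Rdiv_lt_0_compat; nra |].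
    exists N; intros n m Hn Hm; eapply Rle_lt_trans; [apply Hcau |].
    apply (Rmult_lt_reg_r r); [exact Hr |].
    replace (2 * (e n + e m) / r * r) with (2 * (e n + e m)) by (field; lra).
    specialize (HN n Hn) as h1; specialize (HN m Hm) as h2; nra. }
  assert (HM1 : 0 <= M) by (eapply Rle_trans; [apply Cmod_ge_0 | apply (HM c Hcc)]).
  (* [M + 1] bounds every approximating function, since [e n <= 1]. *)
  set (K := 8 * (M + 1) / r ^ 2).
  assert (HK : 0 <= K) by (unfold K; apply Rdiv_le_0_compat; nra).
  assert (HT : forall z, Cmod (z - c) <= r / 4 -> Cmod (f z - f c - l * (z - c)) <= K * Cmod (z - c) ^ 2).
  { intros z Hz; apply Rnot_lt_le; intros Hlt.
    set (gap := Cmod (f z - f c - l * (z - c)) - K * Cmod (z - c) ^ 2) in *.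
    assert (Hgap : 0 < gap) by (unfold gap; lra).
    destruct (He0 (gap / 4)) as [N1 HN1]; [lra |].
    destruct (Hl (gap / (4 * r))) as [N2 HN2]; [apply Rdiv_lt_0_compat; lra |].
    set (n := (N1 + N2)%nat).
    specialize (HN1 n ltac:(unfold n; lia)); specialize (HN2 n ltac:(unfold n; lia)).
    destruct (HG n) as [g d].
    assert (T : Cmod (fst (G n) z - fst (G n) c - snd (G n) * (z - c)) <= K * Cmod (z - c) ^ 2).
    { apply (Cauchy_estimates _ c _ r (M + 1) Hr); try assumption.
      intros w Hw; destruct (g w Hw) as [h1 h2]; split; [exact h1 |].
      replace (fst (G n) w) with (f w + (fst (G n) w - f w))%C by ring.
      eapply Rle_trans; [apply Cmod_triangle |]; specialize (HM w Hw); specialize (He n); lra. }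
    destruct (g z) as [_ b1]; [lra |]; destruct (g c Hcc) as [_ b2].
    assert (T2 : Cmod (f z - f c - l * (z - c)) <= Cmod (fst (G n) z - fst (G n) c - snd (G n) * (z - c))
       + (Cmod (fst (G n) z - f z) + Cmod (fst (G n) c - f c) + Cmod (snd (G n) - l) * Cmod (z - c))).
    { replace (f z - f c - l * (z - c))%C with ((fst (G n) z - fst (G n) c - snd (G n) * (z - c))
        + (- (fst (G n) z - f z) + (fst (G n) c - f c) + (snd (G n) - l) * (z - c)))%C by ring.
      eapply Rle_trans; [apply Cmod_triangle |]; apply Rplus_le_compat_l.
      eapply Rle_trans; [apply Cmod_triangle |]; rewrite Cmod_mult; apply Rplus_le_compat_r.
      eapply Rle_trans; [apply Cmod_triangle |]; rewrite Cmod_opp; lra. }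
    assert (T3 : Cmod (snd (G n) - l) * Cmod (z - c) <= gap / (4 * r) * r).
    { apply Rmult_le_compat; try apply Cmod_ge_0; lra. }
    replace (gap / (4 * r) * r) with (gap / 4) in T3 by (field; lra).
    unfold gap in *; lra. }
  exists l; apply (derivative_of_quadratic_bound f c l K (r / 4)); [exact HK | lra | exact HT].
Qed.

(** * Iterated derivatives and their values at real points *)

Fixpoint Dn (n : nat) (f : C -> C) : C -> C :=
  match n with O => f | S m => C_derive (Dn m f) end.

Lemma C_derive_spec (f : C -> C) (z : C) :
  (exists l, C_derivative f z l) -> C_derivative f z (C_derive f z).
Proof. intros [l Hl]; rewrite (is_C_derive_unique f z l Hl); exact Hl. Qed.

Lemma hol_bounded_sub (f : C -> C) (c c' : C) (r r' M : R) :
  Cmod (c' - c) + r' <= r -> hol_bounded f c r M -> hol_bounded f c' r' M.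
Proof.
  intros H Hf w Hw; apply Hf.
  replace (w - c)%C with ((w - c') + (c' - c))%C by ring.
  eapply Rle_lt_trans; [apply Cmod_triangle |]; lra.
Qed.

Lemma hol_bounded_center (f : C -> C) (c : C) (r M : R) :
  0 < r -> hol_bounded f c r M -> (exists l, C_derivative f c l) /\ Cmod (f c) <= M.
Proof.
  intros Hr H; apply H; replace (c - c)%C with (RtoC 0) by ring; rewrite Cmod_0; exact Hr.
Qed.

Lemma C_derivative_scal (f : C -> C) (z k l : C) :
  C_derivative f z l -> C_derivative (fun u => k * f u)%C z (k * l)%C.
Proof.
  intros H; refine (is_derive_val _ _ _ _ (C_derivative_mult (fun _ => k) f z (RtoC 0) l _ H) _).
  - apply (is_derive_const (K := C_AbsRing) (V := C_NormedModule)).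
  - change (0 * f z + k * l = k * l)%C; ring.
Qed.

(** The derivative is a locally uniform limit of difference quotients, which are holomorphic. *)
Lemma hol_bounded_derive (f : C -> C) (c : C) (r M : R) :
  0 < r -> hol_bounded f c r M -> hol_bounded (C_derive f) c (r / 2) (4 * M / r).
Proof.
  intros Hr Hf w Hw.
  assert (HM : 0 <= M) by (eapply Rle_trans; [apply Cmod_ge_0 | apply (hol_bounded_center f c r M Hr Hf)]).
  (* The radii add up to less than [r]: [r / 2] for [w], [r / 8] for [u], [r / 4] for the disc about
     [u]. *)
  assert (Hloc : forall u, Cmod (u - w) < r / 8 -> hol_bounded f u (r / 4) M).
  { intros u Hu; apply (hol_bounded_sub f c u r); [| exact Hf].
    replace (u - c)%C with ((u - w) + (w - c))%C by ring.
    assert (T := Cmod_triangle (u - w) (w - c)); lra. }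
  assert (Hd : forall u, Cmod (u - w) < r / 8 -> C_derivative f u (C_derive f u)).
  { intros u Hu; apply C_derive_spec, (hol_bounded_center f u (r / 4) M); [lra | auto]. }
  split.
  - apply (uniform_limit_derivable _ w (r / 8) (2 * M / (r / 4))); [lra | |].
    + intros u Hu; apply (Cauchy_estimates f u _ (r / 4) M); [lra | auto | auto].
    + intros eps He.
      set (K := 8 * M / (r / 4) ^ 2).
      assert (HK : 0 <= K) by (unfold K; apply Rdiv_le_0_compat; nra).
      (* On discs of radius [r / 4] the Taylor bound of [Cauchy_estimates] holds up to distance
         [r / 16]; it makes the difference quotient with step [h] accurate up to [K * h], uniformly
         in [u]. *)
      choose_below h [r / 16; eps / (K + 1)].
      assert (Hh2 : K * h <= eps) by (apply small_mult; lra).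
      assert (Hh0 : RtoC h <> RtoC 0) by (intros E; apply RtoC_inj in E; lra).
      assert (Hmh : Cmod h = h) by (rewrite Cmod_R, Rabs_pos_eq; lra).
      exists (fun u => / h * (f (u + h) - f u))%C; intros u Hu; split.
      * destruct (Hloc u Hu (u + h)%C) as [[l1 H1] _].
        { replace (u + h - u)%C with (RtoC h) by ring; lra. }
        eexists; apply C_derivative_scal.
        apply (is_derive_minus (K := C_AbsRing) (V := C_NormedModule) (fun u => f (u + h)%C) f).
        -- apply (is_derive_ext (K := C_AbsRing) (V := C_NormedModule) (fun u => f (u * 1 + h))%C); [intros v; f_equal; ring |].
           apply C_derivative_comp_affine; rewrite Cmult_1_r; exact H1.
        -- apply Hd, Hu.
      * destruct (Cauchy_estimates f u _ (r / 4) M ltac:(lra) (Hloc u Hu) (Hd u Hu)) as [_ T].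
        specialize (T (u + h)%C); replace (u + h - u)%C with (RtoC h) in T by ring.
        rewrite Hmh in T; specialize (T ltac:(lra)).
        replace (/ h * (f (u + h) - f u) - C_derive f u)%C
          with (/ h * (f (u + h) - f u - C_derive f u * h))%C by (field; exact Hh0).
        rewrite Cmod_mult, Cmod_inv, Hmh by exact Hh0.
        apply (Rmult_le_reg_l h); [lra |].
        rewrite <- Rmult_assoc, Rinv_r, Rmult_1_l by lra.
        eapply Rle_trans; [exact T |]; fold K; simpl; nra.
  - assert (H2 : hol_bounded f w (r / 2) M) by (apply (hol_bounded_sub f c w r); [lra | exact Hf]).
    replace (4 * M / r) with (2 * M / (r / 2)) by (field; lra).
    apply (Cauchy_estimates f w _ (r / 2) M); [lra | exact H2 |].
    apply C_derive_spec, (hol_bounded_center f w (r / 2) M); [lra | exact H2].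
Qed.

(** [K] depends on [n] and [r] only; this makes the derivatives at a point bounded functionals,
    uniformly along segments. Each differentiation halves the radius. *)
Lemma hol_bounded_Dn (n : nat) (r : R) :
  0 < r -> exists K, 0 <= K /\ forall f c M, hol_bounded f c r M -> hol_bounded (Dn n f) c (r / 2 ^ n) (K * M).
Proof.
  intros Hr; induction n as [| n [K [HK IH]]].
  - exists 1; split; [lra |]; intros f c M H; simpl.
    replace (r / 1) with r by field; rewrite Rmult_1_l; exact H.
  - assert (P : 0 < 2 ^ n) by (apply pow_lt; lra).
    assert (Hrn : 0 < r / 2 ^ n) by (apply Rdiv_lt_0_compat; lra).
    exists (4 * K / (r / 2 ^ n)); split; [apply Rdiv_le_0_compat; nra |].
    intros f c M H; specialize (IH f c M H).
    apply hol_bounded_derive in IH; [| exact Hrn].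
    replace (r / 2 ^ S n) with (r / 2 ^ n / 2) by (simpl; field; lra).
    replace (4 * K / (r / 2 ^ n) * M) with (4 * (K * M) / (r / 2 ^ n)) by (field; lra).
    exact IH.
Qed.

Lemma slice_hol_bounded (W : C -> Prop) (f : real_slice W) (c : C) (r : R) :
  (forall w, Cmod (w - c) < r -> W w) -> hol_bounded f c r (slice_norm W f).
Proof.
  intros H w Hw; split; [apply (slice_holomorphic W f w (H w Hw)) | apply slice_norm_ge].
Qed.

Lemma Dn_derivative (W : C -> Prop) (f : real_slice W) (n : nat) (z : C) :
  open W -> W z -> C_derivative (Dn n f) z (Dn (S n) f z).
Proof.
  intros HW Hz; destruct (C_open_ball W z HW Hz) as [r [Hr Hb]].
  destruct (hol_bounded_Dn n r Hr) as [K [_ H]].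
  specialize (H f z _ (slice_hol_bounded W f z r Hb)).
  apply C_derive_spec, (hol_bounded_center _ z (r / 2 ^ n) (K * slice_norm W f)); [| exact H].
  apply Rdiv_lt_0_compat; [exact Hr | apply pow_lt; lra].
Qed.

Lemma C_derivative_ext (W : C -> Prop) (f g : C -> C) (z l : C) :
  open W -> W z -> (forall w, W w -> f w = g w) -> C_derivative f z l -> C_derivative g z l.
Proof.
  intros HW Hz E H; destruct (C_open_ball W z HW Hz) as [r [Hr Hb]].
  apply C_derivative_iff; intros eps He.
  destruct (proj1 (C_derivative_iff _ _ _) H eps He) as [d [Hd H1]].
  choose_below s [d; r]; exists s; split; [assumption |]; intros w Hw.
  rewrite <- !E; [apply H1; lra | exact Hz | apply Hb; lra].
Qed.

Lemma Dn_plus (W : C -> Prop) (f g : real_slice W) (n : nat) (z : C) :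
  open W -> W z -> Dn n (slice_plus W f g) z = (Dn n f z + Dn n g z)%C.
Proof.
  intros HW; revert z; induction n as [| n IH]; intros z Hz; [reflexivity |].
  apply is_C_derive_unique.
  apply (C_derivative_ext W (fun w => Dn n f w + Dn n g w)%C); auto.
  - intros w Hw; symmetry; apply IH, Hw.
  - apply (is_derive_plus (K := C_AbsRing) (V := C_NormedModule)); apply Dn_derivative with (W := W); assumption.
Qed.

Lemma Dn_scal (W : C -> Prop) (a : R) (f : real_slice W) (n : nat) (z : C) :
  open W -> W z -> Dn n (slice_scal W a f) z = (a * Dn n f z)%C.
Proof.
  intros HW; revert z; induction n as [| n IH]; intros z Hz; [reflexivity |].
  apply is_C_derive_unique.
  apply (C_derivative_ext W (fun w => a * Dn n f w)%C); auto.
  - intros w Hw; symmetry; apply IH, Hw.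
  - apply C_derivative_scal, Dn_derivative with (W := W); assumption.
Qed.

(** Derivatives of real-symmetric functions are real at real points ([jet_Im]), so the real part
    loses nothing. *)
Definition jet {W : C -> Prop} (n : nat) (x : R) (f : real_slice W) : R := Re (Dn n f (RtoC x)).

Lemma RtoC_derivative (f : C -> C) (x : R) (l : C) :
  C_derivative f (RtoC x) l -> CR_derive (fun y => f (RtoC y)) x l.
Proof.
  intros H.
  split; [apply is_linear_scal_l |].
  intros y Hy.
  apply (is_filter_lim_locally_unique (K := R_AbsRing) (V := R_NormedModule)) in Hy; subst y.
  intros eps; destruct (proj1 (C_derivative_iff _ _ _) H eps (cond_pos eps)) as [d [Hd H1]].
  exists (mkposreal d Hd); intros y Hy.
  specialize (H1 (RtoC y)); rewrite <- RtoC_minus, Cmod_R in H1; specialize (H1 Hy).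
  rewrite <- Cmod_norm_R.
  replace (f (RtoC y) - f (RtoC x) - l * RtoC (y - x))%C
    with (minus (G := C_R_NormedModule) (minus (G := C_R_NormedModule) (f (RtoC y)) (f (RtoC x))) (scal (V := C_R_NormedModule) (minus y x) l)) in H1; [exact H1 |].
  rewrite scal_R_Cmult; match goal with |- ?a = ?b => change (@eq C a b) end.
  change (f (RtoC y) - f (RtoC x) - RtoC (y - x) * l = f (RtoC y) - f (RtoC x) - l * RtoC (y - x))%C; ring.
Qed.

Lemma RtoC_open (W : C -> Prop) (x : R) :
  open W -> W (RtoC x) -> exists r, 0 < r /\ forall y, Rabs (y - x) < r -> W (RtoC y).
Proof.
  intros HW Hx; destruct (C_open_ball W _ HW Hx) as [r [Hr Hb]].
  exists r; split; [exact Hr |]; intros y Hy; apply Hb; rewrite <- RtoC_minus, Cmod_R; exact Hy.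
Qed.

Lemma locally_RtoC (W : C -> Prop) (x : R) :
  open W -> W (RtoC x) -> locally x (fun y => W (RtoC y)).
Proof.
  intros HW Hx; destruct (RtoC_open W x HW Hx) as [r [Hr Hb]].
  exists (mkposreal r Hr); exact Hb.
Qed.

Lemma jet_derivative {W : C -> Prop} (f : real_slice W) (n : nat) (x : R) :
  open W -> W (RtoC x) -> is_derive (fun y => jet n y f) x (jet (S n) x f).
Proof.
  intros HW Hx.
  apply (is_derive_C_parts (fun y => Dn n f (RtoC y)) x (Dn (S n) f (RtoC x))).
  apply RtoC_derivative, Dn_derivative with (W := W); assumption.
Qed.

(** The symmetry gives the case [n = 0]; then the vanishing imaginary part is differentiated along
    the real axis. *)
Lemma jet_Im {W : C -> Prop} (f : real_slice W) (n : nat) (x : R) :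
  open W -> W (RtoC x) -> Im (Dn n f (RtoC x)) = 0.
Proof.
  intros HW; revert x; induction n as [| n IH]; intros x Hx.
  - simpl; assert (H := slice_symmetric W f (RtoC x)).
    apply (f_equal Im) in H; rewrite im_conj in H.
    replace (Cconj (RtoC x)) with (RtoC x) in H by (apply C_ext; simpl; ring); lra.
  - assert (H : is_derive (fun y => Im (Dn n f (RtoC y))) x (Im (Dn (S n) f (RtoC x)))).
    { apply (is_derive_C_parts (fun y => Dn n f (RtoC y)) x (Dn (S n) f (RtoC x))).
      apply RtoC_derivative, Dn_derivative with (W := W); assumption. }
    rewrite <- (is_derive_unique _ _ _ H); apply is_derive_unique.
    apply (is_derive_ext_loc (fun _ => 0)).
    + generalize (locally_RtoC W x HW Hx); apply filter_imp; intros y Hy; symmetry; apply IH, Hy.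
    + apply (is_derive_const (K := R_AbsRing) (V := R_NormedModule)).
Qed.

Lemma Dn_jet {W : C -> Prop} (f : real_slice W) (n : nat) (x : R) :
  open W -> W (RtoC x) -> Dn n f (RtoC x) = RtoC (jet n x f).
Proof.
  intros HW Hx; apply C_ext; [reflexivity | exact (jet_Im f n x HW Hx)].
Qed.

Lemma jet_plus {W : C -> Prop} (n : nat) (x : R) (f g : real_slice W) :
  open W -> W (RtoC x) -> jet n x (plus f g) = jet n x f + jet n x g.
Proof.
  intros HW Hx; unfold jet.
  change (Re (Dn n (slice_plus W f g) (RtoC x)) = Re (Dn n f (RtoC x)) + Re (Dn n g (RtoC x))).
  rewrite Dn_plus by assumption; apply re_plus.
Qed.

Lemma jet_scal {W : C -> Prop} (n : nat) (x a : R) (f : real_slice W) :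
  open W -> W (RtoC x) -> jet n x (scal a f) = a * jet n x f.
Proof.
  intros HW Hx; unfold jet.
  change (Re (Dn n (slice_scal W a f) (RtoC x)) = a * Re (Dn n f (RtoC x))).
  rewrite Dn_scal by assumption; apply re_scal_l.
Qed.

Lemma jet_bound (n : nat) (r : R) : 0 < r -> exists K, 0 <= K /\
  forall (W : C -> Prop) (f : real_slice W) x,
    (forall w, Cmod (w - RtoC x) < r -> W w) -> Rabs (jet n x f) <= K * slice_norm W f.
Proof.
  intros Hr; destruct (hol_bounded_Dn n r Hr) as [K [HK H]].
  exists K; split; [exact HK |]; intros W f x Hb.
  eapply Rle_trans; [apply re_le_Cmod |].
  apply (hol_bounded_center (Dn n f) (RtoC x) (r / 2 ^ n)).
  - apply Rdiv_lt_0_compat; [exact Hr | apply pow_lt; lra].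
  - apply H, slice_hol_bounded, Hb.
Qed.

(** The constant is independent of [f], and the bound is proportional to its norm. Hence the
    estimate survives when [f] and the point vary together, as they do in [smooth_eval]. *)
Lemma jet_taylor (n : nat) (r : R) : 0 < r -> exists K rho, 0 <= K /\ 0 < rho /\
  forall (W : C -> Prop) (f : real_slice W) x s, open W ->
    (forall w, Cmod (w - RtoC x) < r -> W w) -> Rabs s <= rho ->
    Rabs (jet n (x + s) f - jet n x f - s * jet (S n) x f) <= K * slice_norm W f * s ^ 2.
Proof.
  intros Hr; destruct (hol_bounded_Dn n r Hr) as [K [HK H]].
  set (q := r / 2 ^ n).
  assert (Hq : 0 < q) by (apply Rdiv_lt_0_compat; [exact Hr | apply pow_lt; lra]).
  exists (8 * K / q ^ 2), (q / 4); split; [apply Rdiv_le_0_compat; nra |]; split; [lra |].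
  intros W f x s HW Hb Hs.
  specialize (H f (RtoC x) _ (slice_hol_bounded W f _ r Hb)).
  assert (Hx : W (RtoC x)).
  { apply Hb; replace (RtoC x - RtoC x)%C with (RtoC 0) by ring; rewrite Cmod_0; exact Hr. }
  destruct (Cauchy_estimates _ _ _ q _ Hq H (Dn_derivative W f n _ HW Hx)) as [_ T].
  specialize (T (RtoC (x + s))).
  replace (RtoC (x + s) - RtoC x)%C with (RtoC s) in T by (rewrite RtoC_plus; ring).
  rewrite Cmod_R in T; specialize (T Hs).
  assert (R1 := re_le_Cmod (Dn n f (RtoC (x + s)) - Dn n f (RtoC x) - Dn (S n) f (RtoC x) * RtoC s)%C).
  replace (Re _) with (jet n (x + s) f - jet n x f - s * jet (S n) x f) in R1
    by (unfold jet, Re; simpl; ring).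
  eapply Rle_trans; [exact R1 |]; eapply Rle_trans; [exact T |].
  rewrite pow2_abs; right; field; lra.
Qed.

(** * Banach subspaces of finite codimension *)

Definition cauchy_seq {V : NormedModule R_AbsRing} (u : nat -> V) : Prop :=
  forall eps, 0 < eps -> exists N, forall n m, (N <= n)%nat -> (N <= m)%nat -> norm (minus (u n) (u m)) < eps.

Definition seq_limit {V : NormedModule R_AbsRing} (u : nat -> V) (l : V) : Prop :=
  forall eps, 0 < eps -> exists N, forall n, (N <= n)%nat -> norm (minus (u n) l) < eps.

Lemma cauchy_filter_seq {V : NormedModule R_AbsRing} (u : nat -> V) :
  cauchy (filtermap u eventually) -> cauchy_seq u.
Proof.
  intros H eps He.
  assert (Hf := norm_factor_gt_0 (V := V)).
  assert (Hp : 0 < eps / (2 * @norm_factor _ V)) by (apply Rdiv_lt_0_compat; lra).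
  destruct (H (mkposreal _ Hp)) as [x [N HN]].
  exists N; intros n m Hn Hm.
  assert (h1 := norm_compat2 _ _ _ (HN n Hn)); assert (h2 := norm_compat2 _ _ _ (HN m Hm)).
  simpl in h1, h2.
  replace (norm_factor * (eps / (2 * @norm_factor _ V))) with (eps / 2) in h1, h2 by (field; lra).
  replace (minus (u n) (u m)) with (plus (minus (u n) x) (minus x (u m))).
  - eapply Rle_lt_trans; [apply norm_triangle |].
    rewrite <- (norm_opp (minus x (u m))), opp_minus; lra.
  - symmetry; apply minus_trans.
Qed.

Lemma seq_limit_filterlim {V : NormedModule R_AbsRing} (u : nat -> V) (l : V) :
  seq_limit u l -> filterlim u eventually (locally l).
Proof.
  intros H; apply filterlim_locally; intros eps.
  destruct (H eps (cond_pos eps)) as [N HN]; exists N; intros n Hn; apply norm_compat1, HN, Hn.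
Qed.

Lemma slice_complete (W : C -> Prop) (u : nat -> slice_NormedModule W) :
  open W -> cauchy_seq u -> exists l, seq_limit u l.
Proof.
  intros HW Hu.
  assert (Hpt : forall n m z, Cmod (u n z - u m z) <= norm (minus (u n) (u m))).
  { intros n m z; assert (h := slice_norm_ge W (minus (u n) (u m)) z).
    change (Cmod (u n z + RtoC (-1) * u m z) <= norm (minus (u n) (u m))) in h.
    replace (u n z + RtoC (-1) * u m z)%C with (u n z - u m z)%C in h by (apply C_ext; simpl; ring).
    exact h. }
  assert (Hlim : forall z, exists l, forall eps, 0 < eps -> exists N, forall n, (N <= n)%nat -> Cmod (u n z - l) < eps).
  { intros z; apply C_cauchy_sequence; intros eps He; destruct (Hu eps He) as [N HN].
    exists N; intros n m Hn Hm; eapply Rle_lt_trans; [apply Hpt | auto]. }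
  pose (F := fun z => proj1_sig (constructive_indefinite_description _ (Hlim z))).
  assert (HF : forall z eps, 0 < eps -> exists N, forall n, (N <= n)%nat -> Cmod (u n z - F z) < eps).
  { intros z; unfold F; apply (proj2_sig (constructive_indefinite_description _ (Hlim z))). }
  assert (HU : forall eps, 0 < eps -> exists N, forall n, (N <= n)%nat -> forall z, Cmod (u n z - F z) <= eps).
  { intros eps He; destruct (Hu (eps / 2)) as [N HN]; [lra |].
    exists N; intros n Hn z; destruct (HF z (eps / 2)) as [N' HN']; [lra |].
    specialize (HN' (N + N')%nat ltac:(lia)); specialize (HN n (N + N')%nat Hn ltac:(lia)).
    replace (u n z - F z)%C with ((u n z - u (N + N')%nat z) + (u (N + N')%nat z - F z))%C by ring.
    eapply Rle_trans; [apply Cmod_triangle |]; specialize (Hpt n (N + N')%nat z); lra. }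
  (* Uniqueness of pointwise limits transfers to [F] the symmetry and the vanishing outside [W]. *)
  assert (Huniq : forall z l, (forall eps, 0 < eps -> exists N, forall n, (N <= n)%nat -> Cmod (u n z - l) < eps) -> F z = l).
  { intros z l H; apply Ceq_minus, Cmod_eq_0, Rle_antisym; [| apply Cmod_ge_0].
    apply Rnot_lt_le; intros Hp.
    destruct (H (Cmod (F z - l) / 2)) as [N1 H1]; [lra |]; destruct (HF z (Cmod (F z - l) / 2)) as [N2 H2]; [lra |].
    specialize (H1 (N1 + N2)%nat ltac:(lia)); specialize (H2 (N1 + N2)%nat ltac:(lia)).
    assert (T := Cmod_triangle (u (N1 + N2)%nat z - l) (- (u (N1 + N2)%nat z - F z))).
    rewrite Cmod_opp in T.
    replace (u (N1 + N2)%nat z - l + - (u (N1 + N2)%nat z - F z))%C with (F z - l)%C in T by ring; lra. }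
  destruct (HU 1 Rlt_0_1) as [N0 HN0].
  assert (Hbd : forall z, Cmod (F z) <= norm (u N0) + 1).
  { intros z; specialize (HN0 N0 (Nat.le_refl _) z); assert (h := slice_norm_ge W (u N0) z).
    assert (T := Cmod_triangle (u N0 z) (- (u N0 z - F z))); rewrite Cmod_opp in T.
    replace (u N0 z + - (u N0 z - F z))%C with (F z) in T by ring.
    change (norm (u N0)) with (slice_norm W (u N0)); lra. }
  assert (H1 : holomorphic W F).
  { intros z Hz; destruct (C_open_ball W z HW Hz) as [r [Hr Hb]].
    apply (uniform_limit_derivable F z r (norm (u N0) + 1) Hr); [intros; apply Hbd |].
    intros eps He; destruct (HU eps He) as [N HN]; exists (u N); intros w Hw; split.
    - apply (slice_holomorphic W (u N)), Hb, Hw.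
    - apply HN; lia. }
  assert (H2 : bounded_on W F) by (eexists; intros z _; apply Hbd).
  assert (H3 : real_symmetric F).
  { intros z; apply Huniq; intros eps He; destruct (HF z eps He) as [N HN]; exists N; intros n Hn.
    rewrite (slice_symmetric W (u n)), <- Cminus_conj, Cmod_conj; apply HN, Hn. }
  assert (H4 : forall z, ~ W z -> F z = RtoC 0).
  { intros z Hz; apply Huniq; intros eps He; exists 0%nat; intros n _.
    rewrite (slice_support W (u n) z Hz); replace (0 - 0)%C with (RtoC 0) by ring; rewrite Cmod_0; exact He. }
  exists (RealSlice W F H1 H2 H3 H4); intros eps He.
  destruct (HU (eps / 2)) as [N HN]; [lra |]; exists N; intros n Hn.
  apply Rle_lt_trans with (eps / 2); [| lra].
  apply slice_norm_le; [lra |]; intros z.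
  change (Cmod (u n z + RtoC (-1) * F z) <= eps / 2).
  replace (u n z + RtoC (-1) * F z)%C with (u n z - F z)%C by (apply C_ext; simpl; ring).
  apply HN, Hn.
Qed.

Lemma norm_fst_le {U V : NormedModule R_AbsRing} (x : prod_NormedModule R_AbsRing U V) :
  norm (fst x) <= norm x.
Proof.
  assert (h := proj1 (sqrt_plus_sqr (norm (fst x)) (norm (snd x)))).
  rewrite (Rabs_pos_eq (norm (fst x))) in h by apply norm_ge_0.
  eapply Rle_trans; [apply Rmax_l | exact h].
Qed.

Lemma norm_snd_le {U V : NormedModule R_AbsRing} (x : prod_NormedModule R_AbsRing U V) :
  norm (snd x) <= norm x.
Proof.
  assert (h := proj1 (sqrt_plus_sqr (norm (fst x)) (norm (snd x)))).
  rewrite (Rabs_pos_eq (norm (snd x))) in h by apply norm_ge_0.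
  eapply Rle_trans; [apply Rmax_r | exact h].
Qed.

Lemma norm_pair_le {U V : NormedModule R_AbsRing} (x : prod_NormedModule R_AbsRing U V) :
  norm x <= norm (fst x) + norm (snd x).
Proof.
  assert (h1 := norm_ge_0 (fst x)); assert (h2 := norm_ge_0 (snd x)).
  change (sqrt (norm (fst x) ^ 2 + norm (snd x) ^ 2) <= norm (fst x) + norm (snd x)).
  rewrite <- (sqrt_pow2 (norm (fst x) + norm (snd x))) by lra.
  apply sqrt_le_1_alt; nra.
Qed.

Lemma pair_complete (D E : C -> Prop) (u : nat -> pair_space D E) :
  open D -> open E -> cauchy_seq u -> exists l, seq_limit u l.
Proof.
  intros HD HE Hu.
  destruct (slice_complete D (fun n => fst (u n)) HD) as [l1 H1].
  { intros eps He; destruct (Hu eps He) as [N HN]; exists N; intros n m Hn Hm.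
    eapply Rle_lt_trans; [| apply (HN n m Hn Hm)]; apply (norm_fst_le (minus (u n) (u m))). }
  destruct (slice_complete E (fun n => snd (u n)) HE) as [l2 H2].
  { intros eps He; destruct (Hu eps He) as [N HN]; exists N; intros n m Hn Hm.
    eapply Rle_lt_trans; [| apply (HN n m Hn Hm)]; apply (norm_snd_le (minus (u n) (u m))). }
  exists (l1, l2); intros eps He.
  destruct (H1 (eps / 2)) as [N1 h1]; [lra |]; destruct (H2 (eps / 2)) as [N2 h2]; [lra |].
  exists (N1 + N2)%nat; intros n Hn.
  specialize (h1 n ltac:(lia)); specialize (h2 n ltac:(lia)).
  eapply Rle_lt_trans; [apply norm_pair_le |].
  change (norm (minus (fst (u n)) l1) + norm (minus (snd (u n)) l2) < eps); lra.
Qed.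

Definition bounded_linear {X : NormedModule R_AbsRing} (L : X -> R) : Prop :=
  (forall x y, L (plus x y) = L x + L y) /\ (forall a x, L (scal a x) = a * L x) /\
  exists K, 0 <= K /\ forall x, Rabs (L x) <= K * norm x.

Definition common_kernel {X : NormedModule R_AbsRing} (Ls : list (X -> R)) (x : X) : Prop :=
  List.Forall (fun L : X -> R => L x = 0) Ls.

Lemma bounded_linear_minus {X : NormedModule R_AbsRing} (L : X -> R) (x y : X) :
  bounded_linear L -> L (minus x y) = L x - L y.
Proof.
  intros [H1 [H2 _]].
  assert (E : minus x y = plus x (scal (-1) y)).
  { unfold minus; f_equal; symmetry; apply (scal_opp_one (K := R_Ring) y). }
  rewrite E, H1, H2; ring.
Qed.

Lemma common_kernel_zero {X : NormedModule R_AbsRing} (Ls : list (X -> R)) :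
  List.Forall bounded_linear Ls -> common_kernel Ls zero.
Proof.
  unfold common_kernel; rewrite !List.Forall_forall; intros HL L Hin.
  destruct (HL L Hin) as [h1 _]; specialize (h1 zero zero); rewrite plus_zero_l in h1; lra.
Qed.

Lemma common_kernel_plus_scal {X : NormedModule R_AbsRing} (Ls : list (X -> R)) (a : R) (x y : X) :
  List.Forall bounded_linear Ls -> common_kernel Ls x -> common_kernel Ls y -> common_kernel Ls (plus x (scal a y)).
Proof.
  unfold common_kernel; rewrite !List.Forall_forall; intros HL Hx Hy L Hin.
  destruct (HL L Hin) as [h1 [h2 _]]; rewrite h1, h2, Hx, Hy by assumption; ring.
Qed.

Lemma common_kernel_banach {X : NormedModule R_AbsRing} (Ls : list (X -> R)) :
  (forall u : nat -> X, cauchy_seq u -> exists l, seq_limit u l) ->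
  List.Forall bounded_linear Ls -> banach_subspace (common_kernel Ls).
Proof.
  intros Hc HL; repeat split.
  - apply common_kernel_zero, HL.
  - intros x y Hx Hy; rewrite <- (scal_one y); apply (common_kernel_plus_scal Ls 1); assumption.
  - intros a x Hx; rewrite <- (plus_zero_l (scal a x)).
    apply common_kernel_plus_scal; [exact HL | apply common_kernel_zero, HL | exact Hx].
  - intros u Hu Hcau; destruct (Hc u (cauchy_filter_seq u Hcau)) as [l Hl].
    exists l; split; [| apply seq_limit_filterlim, Hl].
    unfold common_kernel in *; rewrite List.Forall_forall in *; intros L Hin; assert (HLL := HL L Hin).
    destruct HLL as [_ [_ [K [HK Hb]]]].
    apply NNPP; intros Hne; assert (Hp := Rabs_pos_lt _ Hne).
    destruct (Hl (Rabs (L l) / (K + 1))) as [N HN]; [apply Rdiv_lt_0_compat; lra |].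
    specialize (HN N (Nat.le_refl N)); specialize (Hb (minus (u N) l)).
    rewrite bounded_linear_minus in Hb by (apply HL, Hin).
    specialize (Hu N); rewrite List.Forall_forall in Hu; rewrite (Hu L Hin) in Hb.
    rewrite Rminus_0_l, Rabs_Ropp in Hb.
    apply (Rmult_lt_compat_r (K + 1)) in HN; [| lra].
    replace (Rabs (L l) / (K + 1) * (K + 1)) with (Rabs (L l)) in HN by (field; lra).
    assert (h := norm_ge_0 (minus (u N) l)); nra.
Qed.

(** Each functional costs at most one more vector: one on which it does not vanish, taken in the
    kernel of the others, or none if it vanishes on that kernel. *)
Lemma common_kernel_codimension {X : NormedModule R_AbsRing} (Ls : list (X -> R)) :
  List.Forall bounded_linear Ls -> finite_codimension (common_kernel Ls).
Proof.
  induction 1 as [| L Ls HL HLs IH].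
  (* [sum_n _ 0] has one term, so the empty list of functionals still calls for one vector, here
     [zero]. *)
  - exists 0%nat, (fun _ => zero); intros x; exists x, (fun _ => 0); split; [constructor |].
    rewrite sum_O; transitivity (plus x zero); [symmetry; apply plus_zero_r | f_equal].
    symmetry; apply (scal_zero_r (K := R_Ring) (V := NormedModule.ModuleSpace R_AbsRing X)).
  - destruct IH as [n [e He]].
    destruct (classic (exists f, common_kernel Ls f /\ L f <> 0)) as [[f [Hf HLf]] | Hn].
    (* The new vector is scaled so that [L] equals [1] on it; its coefficient is then [L y]. *)
    + exists (S n), (fun i => if Nat.leb i n then e i else scal (/ L f) f); intros x.
      destruct (He x) as [y [c [Hy Hx]]].
      destruct HL as [h1 [h2 h3]].
      exists (plus y (scal (- L y) (scal (/ L f) f))), (fun i => if Nat.leb i n then c i else L y); split.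
      * constructor.
        -- rewrite h1, !h2; field; exact HLf.
        -- apply common_kernel_plus_scal; [exact HLs | exact Hy |].
           rewrite <- (plus_zero_l (scal _ _)); apply common_kernel_plus_scal; [exact HLs | | exact Hf].
           apply common_kernel_zero, HLs.
      * rewrite sum_Sn.
        rewrite (sum_n_ext_loc _ (fun i => scal (c i) (e i))).
        2: { intros k Hk; apply Nat.leb_le in Hk; rewrite Hk; reflexivity. }
        replace (Nat.leb (S n) n) with false by (symmetry; apply Nat.leb_gt; lia).
        rewrite Hx at 1.
        match goal with |- plus ?y ?s = plus (plus ?y (scal ?a ?g)) (plus ?s ?t) =>
          transitivity (plus y (plus (plus (scal a g) t) s)) end.
        -- f_equal; rewrite <- (plus_zero_l (sum_n _ n)) at 1; f_equal; symmetry.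
           etransitivity; [symmetry; apply (scal_distr_r (K := R_Ring) (V := NormedModule.ModuleSpace R_AbsRing X)) |].
           etransitivity; [| apply (scal_zero_l (K := R_Ring) (V := NormedModule.ModuleSpace R_AbsRing X))]; f_equal.
           unfold plus, zero; simpl; ring.
        -- rewrite <- !plus_assoc; f_equal; f_equal; apply plus_comm.
    + exists n, e; intros x; destruct (He x) as [y [c [Hy Hx]]]; exists y, c; split; [| exact Hx].
      constructor; [| exact Hy].
      apply NNPP; intros h; apply Hn; exists y; split; assumption.
Qed.

(** * Products of bounded holomorphic functions, and uniform radii along segments *)

Definition slice_mult {W : C -> Prop} (f g : real_slice W) : real_slice W.
Proof.
  refine (RealSlice W (fun z => Cmult (f z) (g z)) _ _ _ _).
  - intros z Hz; destruct (slice_holomorphic W f z Hz) as [l1 H1].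
    destruct (slice_holomorphic W g z Hz) as [l2 H2].
    eexists; apply C_derivative_mult; eassumption.
  - exists (slice_norm W f * slice_norm W g); intros z _; rewrite Cmod_mult.
    apply Rmult_le_compat; try apply Cmod_ge_0; apply slice_norm_ge.
  - intros z; rewrite (slice_symmetric W f), (slice_symmetric W g), Cmult_conj; reflexivity.
  - intros z Hz; rewrite (slice_support W f z Hz); ring.
Defined.

Lemma jet_mult_0 {W : C -> Prop} (f g : real_slice W) (x : R) :
  open W -> W (RtoC x) -> jet 0 x (slice_mult f g) = jet 0 x f * jet 0 x g.
Proof.
  intros HW Hx; assert (h1 := jet_Im f 0 x HW Hx); assert (h2 := jet_Im g 0 x HW Hx).
  unfold jet; simpl in *; unfold Re, Im in *; simpl; rewrite h1; ring.
Qed.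

(** A formula for the derivatives of order [n] at all real points is differentiated along the real
    axis; Leibniz' rules for the orders [1] to [3] follow one from another. *)
Lemma jet_step {W : C -> Prop} (n : nat) (F : R -> R) (h : real_slice W) (x l : R) :
  open W ->
  (forall y, W (RtoC y) -> jet n y h = F y) -> W (RtoC x) -> is_derive F x l -> jet (S n) x h = l.
Proof.
  intros HW E Hx Hd.
  rewrite <- (is_derive_unique _ _ _ (jet_derivative h n x HW Hx)); apply is_derive_unique.
  apply (is_derive_ext_loc F); [| exact Hd].
  generalize (locally_RtoC W x HW Hx); apply filter_imp; intros y Hy; symmetry; apply E, Hy.
Qed.

Lemma is_derive_jet_mult {W : C -> Prop} (f g : real_slice W) (m n : nat) (x : R) :
  open W -> W (RtoC x) ->
  is_derive (fun y => jet m y f * jet n y g) x (jet (S m) x f * jet n x g + jet m x f * jet (S n) x g).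
Proof.
  intros HW Hx.
  exact (is_derive_mult _ _ _ _ _ (jet_derivative f m x HW Hx) (jet_derivative g n x HW Hx) Rmult_comm).
Qed.

Lemma jet_mult_1 {W : C -> Prop} (f g : real_slice W) (x : R) :
  open W -> W (RtoC x) ->
  jet 1 x (slice_mult f g) = jet 1 x f * jet 0 x g + jet 0 x f * jet 1 x g.
Proof.
  intros HW Hx; apply (jet_step 0 _ _ _ _ HW (fun y => jet_mult_0 f g y HW) Hx), is_derive_jet_mult; assumption.
Qed.

Lemma jet_mult_2 {W : C -> Prop} (f g : real_slice W) (x : R) :
  open W -> W (RtoC x) ->
  jet 2 x (slice_mult f g) = jet 2 x f * jet 0 x g + 2 * (jet 1 x f * jet 1 x g) + jet 0 x f * jet 2 x g.
Proof.
  intros HW Hx; apply (jet_step 1 _ _ _ _ HW (fun y => jet_mult_1 f g y HW) Hx).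
  refine (is_derive_val _ _ _ _ (is_derive_plus _ _ _ _ _ (is_derive_jet_mult f g 1 0 x HW Hx) (is_derive_jet_mult f g 0 1 x HW Hx)) _).
  unfold plus; simpl; ring.
Qed.

Lemma jet_mult_3 {W : C -> Prop} (f g : real_slice W) (x : R) :
  open W -> W (RtoC x) ->
  jet 3 x (slice_mult f g) = jet 3 x f * jet 0 x g + 3 * (jet 2 x f * jet 1 x g)
    + 3 * (jet 1 x f * jet 2 x g) + jet 0 x f * jet 3 x g.
Proof.
  intros HW Hx; apply (jet_step 2 _ _ _ _ HW (fun y => jet_mult_2 f g y HW) Hx).
  refine (is_derive_val _ _ _ _ (is_derive_plus _ _ _ _ _ (is_derive_plus _ _ _ _ _
    (is_derive_jet_mult f g 2 0 x HW Hx) (is_derive_scal _ _ 2 _ (is_derive_jet_mult f g 1 1 x HW Hx)))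
    (is_derive_jet_mult f g 0 2 x HW Hx)) _).
  unfold plus, scal, mult; simpl; unfold mult; simpl; ring.
Qed.

(** A Lebesgue number of the compact segment. It turns bounds on jets at single points into bounds
    uniform along an interval. *)
Lemma segment_radius (W : C -> Prop) (u v : R) :
  open W -> (forall x, u <= x <= v -> W (RtoC x)) ->
  exists r, 0 < r /\ forall x, u <= x <= v -> forall w, Cmod (w - RtoC x) < r -> W w.
Proof.
  intros HW H.
  (* Of the radius [2 * d], one half is spent on the distance from [x] to the centre [t] and the
     other on the disc about [x]. Outside the segment the value [1] is a dummy. *)
  assert (Hex : forall t, exists d : posreal, u <= t <= v -> forall w, Cmod (w - RtoC t) < 2 * d -> W w).
  { intros t; destruct (classic (u <= t <= v)) as [Ht | Ht].
    - destruct (C_open_ball W (RtoC t) HW (H t Ht)) as [r [Hr Hb]].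
      assert (Hr2 : 0 < r / 2) by lra; exists (mkposreal _ Hr2); intros _ w Hw; apply Hb; simpl in Hw; lra.
    - exists (mkposreal 1 Rlt_0_1); intros h; contradiction. }
  pose (delta := fun t => proj1_sig (constructive_indefinite_description _ (Hex t))).
  assert (Hdel : forall t, u <= t <= v -> forall w, Cmod (w - RtoC t) < 2 * delta t -> W w).
  { intros t; unfold delta; apply (proj2_sig (constructive_indefinite_description _ (Hex t))). }
  destruct (compactness_value_1d u v delta) as [d Hd].
  exists d; split; [apply cond_pos |]; intros x Hx w Hw.
  destruct (NNPP _ (Hd x Hx)) as [t [Ht [h1 h2]]].
  apply (Hdel t Ht).
  replace (w - RtoC t)%C with ((w - RtoC x) + RtoC (x - t))%C by (rewrite RtoC_minus; ring).
  eapply Rle_lt_trans; [apply Cmod_triangle |]; rewrite Cmod_R; lra.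
Qed.

(** * Smooth maps *)

(** Maps are differentiated in all directions of the ambient space; [smooth_on_sub] then restricts
    the directions to the model space. *)
Definition smooth {X Y : NormedModule R_AbsRing} (V : X -> Prop) (f : X -> Y) : Prop :=
  smooth_on (fun _ => True) V f.

Lemma Forall_True {A : Type} (v : list A) : List.Forall (fun _ => True) v.
Proof. induction v; constructor; auto. Qed.

Lemma norm_product_pos {X : NormedModule R_AbsRing} (v : list X) : 0 <= norm_product v.
Proof.
  induction v as [| h v IH]; simpl; [lra |]; apply Rmult_le_pos; [apply norm_ge_0 | exact IH].
Qed.

Lemma smooth_on_sub {X Y : NormedModule R_AbsRing} (S V V' : X -> Prop) (f g : X -> Y) :
  (forall x, V' x -> V x) -> (forall x, V' x -> f x = g x) -> smooth V f -> smooth_on S V' g.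
Proof.
  intros HV E [d [H1 [H2 [H3 H4]]]]; exists d; repeat split.
  - intros x Hx; rewrite <- E by exact Hx; apply H1, HV, Hx.
  - intros x v h k a Hx _ _ _; apply H2; auto using Forall_True.
  - intros x n Hx; destruct (H3 x n (HV x Hx)) as [M HM]; exists M; intros v Hv _; apply HM; auto using Forall_True.
  - intros x n eps Hx; destruct (H4 x n eps (HV x Hx)) as [del Hd]; exists del; intros h v _ Hxh Hh Hv _.
    apply Hd; auto using Forall_True.
Qed.

Lemma norm_minus_self {X : NormedModule R_AbsRing} (x y : X) : x = y -> norm (minus x y) = 0.
Proof. intros ->; rewrite minus_eq_zero; apply norm_zero. Qed.

Lemma minus_plus_plus {G : AbelianGroup} (a b c d : G) :
  minus (plus a b) (plus c d) = plus (minus a c) (minus b d).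
Proof.
  unfold minus; rewrite opp_plus, <- !plus_assoc; f_equal.
  rewrite !plus_assoc; f_equal; apply plus_comm.
Qed.

Lemma plus_minus_l {G : AbelianGroup} (a b c : G) : minus (plus (plus a b) c) (plus a c) = b.
Proof.
  rewrite minus_plus_plus, minus_eq_zero, plus_zero_r.
  rewrite (plus_comm a); unfold minus; rewrite <- plus_assoc.
  change (plus b (minus a a) = b); rewrite minus_eq_zero; apply plus_zero_r.
Qed.

Lemma smooth_affine {X Y : NormedModule R_AbsRing} (V : X -> Prop) (L : X -> Y) (b : Y) (K : R) :
  (forall x y, L (plus x y) = plus (L x) (L y)) -> (forall a x, L (scal a x) = scal a (L x)) ->
  0 <= K -> (forall x, norm (L x) <= K * norm x) -> smooth V (fun x => plus (L x) b).
Proof.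
  intros HP HS HK HB.
  exists (fun x v => match v with [] => plus (L x) b | [h] => L h | _ => zero end).
  assert (Z : forall a : R, plus (scal a (zero : Y)) zero = (zero : Y)).
  { intros a; rewrite plus_zero_r; apply (scal_zero_r (V := NormedModule.ModuleSpace R_AbsRing Y)). }
  split; [reflexivity |]; split; [| split].
  - intros x [| h' v] h k a _ _ _ _; [rewrite HP, HS; reflexivity | symmetry; apply Z].
  - intros x n _; exists (K + norm (plus (L x) b)); intros v _ _.
    assert (HN := norm_ge_0 (plus (L x) b)); assert (HV := norm_product_pos v).
    destruct v as [| h [| h' v]].
    + simpl; lra.
    + simpl; specialize (HB h); assert (h0 := norm_ge_0 h); nra.
    + rewrite norm_zero; nra.
  - intros x n eps _; exists (mkposreal 1 Rlt_0_1); intros h v _ _ _ _ _.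
    assert (Hp : 0 <= eps * norm h * norm_product v).
    { apply Rmult_le_pos; [| apply norm_product_pos]; apply Rmult_le_pos; [left; apply cond_pos | apply norm_ge_0]. }
    eapply Rle_trans; [| exact Hp]; right; apply norm_minus_self.
    destruct v as [| h1 [| h2 v]].
    + rewrite HP; apply (plus_minus_l (G := NormedModule.AbelianGroup R_AbsRing Y)).
    + apply (minus_eq_zero (G := NormedModule.AbelianGroup R_AbsRing Y)).
    + apply (minus_eq_zero (G := NormedModule.AbelianGroup R_AbsRing Y)).
Qed.

Lemma smooth_plus {X Y : NormedModule R_AbsRing} (V : X -> Prop) (f g : X -> Y) :
  smooth V f -> smooth V g -> smooth V (fun x => plus (f x) (g x)).
Proof.
  intros [d [H1 [H2 [H3 H4]]]] [d' [H1' [H2' [H3' H4']]]].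
  exists (fun x v => plus (d x v) (d' x v)); split; [| split; [| split]].
  - intros x Hx; rewrite H1, H1' by exact Hx; reflexivity.
  - intros x v h k a Hx Hv Hh Hk; rewrite H2, H2' by assumption.
    rewrite (scal_distr_l (K := R_Ring) (V := NormedModule.ModuleSpace R_AbsRing Y)).
    rewrite <- !plus_assoc; f_equal; rewrite !plus_assoc; f_equal; apply plus_comm.
  - intros x n Hx; destruct (H3 x n Hx) as [M HM], (H3' x n Hx) as [M' HM'].
    exists (M + M'); intros v Hn Hv; eapply Rle_trans; [apply norm_triangle |].
    specialize (HM v Hn Hv); specialize (HM' v Hn Hv); lra.
  - intros x n eps Hx.
    assert (He : 0 < eps / 2) by (destruct eps; simpl; lra).
    destruct (H4 x n (mkposreal _ He) Hx) as [del Hd], (H4' x n (mkposreal _ He) Hx) as [del' Hd'].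
    choose_below r [pos del; pos del']; exists (mkposreal r pos_below); intros h v Sh Hxh Hh Hn Hv; simpl in Hh.
    specialize (Hd h v Sh Hxh ltac:(lra) Hn Hv); specialize (Hd' h v Sh Hxh ltac:(lra) Hn Hv).
    simpl in Hd, Hd'.
    rewrite !(minus_plus_plus (G := NormedModule.AbelianGroup R_AbsRing Y)).
    eapply Rle_trans; [apply norm_triangle |]; lra.
Qed.

Lemma norm_R (x : R) : norm (V := R_NormedModule) x = Rabs x.
Proof. reflexivity. Qed.

Lemma smooth_scal {X Y : NormedModule R_AbsRing} (V : X -> Prop) (f : X -> R_NormedModule) (e : Y) :
  smooth V f -> smooth V (fun x => scal (f x : R) e).
Proof.
  intros [d [H1 [H2 [H3 H4]]]].
  exists (fun x v => scal (d x v : R) e); split; [| split; [| split]].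
  - intros x Hx; rewrite H1 by exact Hx; reflexivity.
  - intros x v h k a Hx Hv Hh Hk; rewrite H2 by assumption.
    etransitivity; [apply (scal_distr_r (K := R_Ring) (V := NormedModule.ModuleSpace R_AbsRing Y)) |].
    f_equal; symmetry; apply (scal_assoc (K := R_Ring) (V := NormedModule.ModuleSpace R_AbsRing Y)).
  - intros x n Hx; destruct (H3 x n Hx) as [M HM]; exists (M * norm e); intros v Hn Hv.
    eapply Rle_trans; [apply (norm_scal (K := R_AbsRing)) |].
    specialize (HM v Hn Hv); rewrite norm_R in HM.
    change (abs (K := R_AbsRing) (d x v)) with (Rabs (d x v)).
    assert (h := norm_ge_0 e); nra.
  - intros x n eps Hx.
    assert (Hne := norm_ge_0 e).
    assert (He : 0 < eps / (norm e + 1)) by (apply Rdiv_lt_0_compat; [apply cond_pos | lra]).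
    destruct (H4 x n (mkposreal _ He) Hx) as [del Hd]; exists del; intros h v Sh Hxh Hh Hn Hv.
    specialize (Hd h v Sh Hxh Hh Hn Hv); rewrite norm_R in Hd; simpl pos in Hd.
    set (q := norm h * norm_product v).
    assert (Hq : 0 <= q) by (apply Rmult_le_pos; [apply norm_ge_0 | apply norm_product_pos]).
    match type of Hd with Rabs ?r <= _ => set (t := r) in *;
      match goal with |- norm ?w <= _ => replace w with (scal (t : R) e) end end.
    + eapply Rle_trans; [apply (norm_scal (K := R_AbsRing)) |].
      change (Rabs t * norm e <= eps * norm h * norm_product v).
      assert (Eq : eps / (norm e + 1) * norm e <= eps).
      { apply (Rmult_le_reg_r (norm e + 1)); [lra |].
        replace (eps / (norm e + 1) * norm e * (norm e + 1)) with (eps * norm e) by (field; lra).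
        assert (0 < eps) by apply cond_pos; nra. }
      replace (eps / (norm e + 1) * norm h * norm_product v) with (eps / (norm e + 1) * q) in Hd by (unfold q; ring).
      replace (eps * norm h * norm_product v) with (eps * q) by (unfold q; ring).
      assert (Rabs t * norm e <= eps / (norm e + 1) * q * norm e) by (apply Rmult_le_compat_r; assumption).
      assert (eps / (norm e + 1) * norm e * q <= eps * q) by (apply Rmult_le_compat_r; assumption).
      lra.
    + unfold t.
      assert (HM : forall a b : R, scal (minus a b) e = minus (scal a e) (scal b e)).
      { intros a b; apply (scal_minus_distr_r (K := R_Ring) (V := NormedModule.ModuleSpace R_AbsRing Y)). }
      etransitivity; [apply (HM (minus (d (plus x h) v) (d x v)) (d x (h :: v))) |].
      f_equal; apply HM.
Qed.

(** The pairs [(u, w)] of complementary sublists of [v], which index Leibniz' formula. *)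
Fixpoint splits {A : Type} (v : list A) : list (list A * list A) :=
  match v with
  | [] => [([], [])]
  | h :: v => map (fun p => (h :: fst p, snd p)) (splits v) ++ map (fun p => (fst p, h :: snd p)) (splits v)
  end.

Definition Rsum {A : Type} (F : A -> R) (l : list A) : R := fold_right (fun p r => F p + r) 0 l.

Lemma Rsum_app {A : Type} (F : A -> R) (l l' : list A) : Rsum F (l ++ l') = Rsum F l + Rsum F l'.
Proof. induction l as [| p l IH]; simpl; [ring | rewrite IH; ring]. Qed.

Lemma Rsum_map {A B : Type} (F : B -> R) (g : A -> B) (l : list A) :
  Rsum F (map g l) = Rsum (fun p => F (g p)) l.
Proof. induction l as [| p l IH]; simpl; [ring | rewrite IH; ring]. Qed.

Lemma Rsum_plus {A : Type} (F G : A -> R) (l : list A) :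
  Rsum (fun p => F p + G p) l = Rsum F l + Rsum G l.
Proof. induction l as [| p l IH]; simpl; [ring | rewrite IH; ring]. Qed.

Lemma Rsum_scal {A : Type} (a : R) (F : A -> R) (l : list A) : Rsum (fun p => a * F p) l = a * Rsum F l.
Proof. induction l as [| p l IH]; simpl; [ring | rewrite IH; ring]. Qed.

Lemma Rsum_ext {A : Type} (F G : A -> R) (l : list A) :
  (forall p, In p l -> F p = G p) -> Rsum F l = Rsum G l.
Proof.
  induction l as [| p l IH]; simpl; intros H; [reflexivity |]; rewrite H, IH by auto; reflexivity.
Qed.

Lemma Rsum_bound {A : Type} (F : A -> R) (B : R) (l : list A) :
  (forall p, In p l -> Rabs (F p) <= B) -> Rabs (Rsum F l) <= INR (length l) * B.
Proof.
  induction l as [| p l IH]; intros H.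
  - simpl; rewrite Rabs_R0; lra.
  - change (Rabs (F p + Rsum F l) <= INR (S (length l)) * B); rewrite S_INR.
    eapply Rle_trans; [apply Rabs_triang |].
    specialize (IH (fun q Hq => H q (or_intror Hq))); specialize (H p (or_introl eq_refl)); lra.
Qed.

Lemma splits_length {A : Type} (v : list A) : INR (length (splits v)) = 2 ^ length v.
Proof.
  induction v as [| h v IH]; [reflexivity |].
  simpl splits; rewrite length_app, !length_map, plus_INR, IH; simpl; ring.
Qed.

Lemma splits_spec {X : NormedModule R_AbsRing} (v : list X) (p : list X * list X) :
  In p (splits v) -> (length (fst p) <= length v)%nat /\ (length (snd p) <= length v)%nat /\
    norm_product (fst p) * norm_product (snd p) = norm_product v.
Proof.
  revert p; induction v as [| h v IH]; simpl; intros p.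
  - intros [<- | []]; simpl; repeat split; auto; ring.
  - rewrite in_app_iff, !in_map_iff; intros [[q [<- Hq]] | [q [<- Hq]]]; destruct (IH q Hq) as [i1 [i2 i3]]; simpl;
      rewrite <- i3; repeat split; try lia; ring.
Qed.

(** Leibniz' formula for [v] involves derivatives of all orders up to [length v], while smoothness
    provides constants for each order separately. *)
Lemma uniform_in_length (P : nat -> R -> Prop) :
  (forall n a b, a <= b -> P n a -> P n b) -> (forall n, exists M, P n M) ->
  forall n, exists M, 0 <= M /\ forall k, (k <= n)%nat -> P k M.
Proof.
  intros Hmon Hex; induction n as [| n [M [HM IH]]].
  - destruct (Hex 0%nat) as [M HM]; exists (Rmax M 0); split; [apply Rmax_r |]; intros k Hk.
    replace k with 0%nat by lia; eapply Hmon; [apply Rmax_l | exact HM].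
  - destruct (Hex (S n)) as [M' HM']; exists (Rmax M M'); split; [eapply Rle_trans; [exact HM | apply Rmax_l] |].
    intros k Hk; destruct (Nat.eq_dec k (S n)) as [-> | Hne].
    + eapply Hmon; [apply Rmax_r | exact HM'].
    + eapply Hmon; [apply Rmax_l | apply IH; lia].
Qed.

Lemma uniform_in_length_pos (P : nat -> R -> Prop) :
  (forall n a b, 0 < a -> a <= b -> P n b -> P n a) -> (forall n, exists M, 0 < M /\ P n M) ->
  forall n, exists M, 0 < M /\ forall k, (k <= n)%nat -> P k M.
Proof.
  intros Hmon Hex; induction n as [| n [M [HM IH]]].
  - destruct (Hex 0%nat) as [M [HM0 HM]]; exists M; split; [exact HM0 |]; intros k Hk.
    replace k with 0%nat by lia; exact HM.
  - destruct (Hex (S n)) as [M' [HM0 HM']]; choose_below d [M; M']; exists d; split; [assumption |].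
    intros k Hk; destruct (Nat.eq_dec k (S n)) as [-> | Hne].
    + apply (Hmon _ d M'); assumption.
    + apply (Hmon _ d M); try assumption; apply IH; lia.
Qed.

(** Leibniz' rule: a new direction [h] differentiates either the first factor or the second, which
    are the two halves of [splits (h :: v)]. *)
Lemma smooth_mult {X : NormedModule R_AbsRing} (V : X -> Prop) (f g : X -> R_NormedModule) :
  smooth V f -> smooth V g -> smooth V (fun x => f x * g x : R_NormedModule).
Proof.
  intros [d [H1 [H2 [H3 H4]]]] [d' [H1' [H2' [H3' H4']]]].
  exists (fun x v => Rsum (fun p => d x (fst p) * d' x (snd p)) (splits v)).
  assert (HB : forall x n, V x -> exists M, 0 <= M /\ forall v, (length v <= n)%nat ->
    Rabs (d x v) <= M * norm_product v /\ Rabs (d' x v) <= M * norm_product v).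
  { intros x n Hx.
    destruct (uniform_in_length (fun k M => forall v, length v = k ->
      Rabs (d x v) <= M * norm_product v /\ Rabs (d' x v) <= M * norm_product v)) with (n := n) as [M [HM HMk]].
    - intros k a b Hab Hk v Hv; specialize (Hk v Hv); assert (h := norm_product_pos v).
      assert (a * norm_product v <= b * norm_product v) by (apply Rmult_le_compat_r; assumption); lra.
    - intros k; destruct (H3 x k Hx) as [M HM], (H3' x k Hx) as [M' HM'].
      exists (Rmax M M'); intros v Hv; assert (h := norm_product_pos v).
      specialize (HM v Hv (Forall_True v)); specialize (HM' v Hv (Forall_True v)).
      rewrite norm_R in HM, HM'; split.
      + eapply Rle_trans; [exact HM |]; apply Rmult_le_compat_r; [exact h | apply Rmax_l].
      + eapply Rle_trans; [exact HM' |]; apply Rmult_le_compat_r; [exact h | apply Rmax_r].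
    - exists M; split; [exact HM |]; intros v Hv; apply (HMk (length v) Hv v eq_refl). }
  split; [| split; [| split]].
  - intros x Hx; simpl; rewrite H1, H1' by exact Hx; ring.
  - intros x v h k a Hx _ _ _.
    change (Rsum (fun p => d x (fst p) * d' x (snd p)) (splits (plus (scal a h) k :: v))
      = a * Rsum (fun p => d x (fst p) * d' x (snd p)) (splits (h :: v))
        + Rsum (fun p => d x (fst p) * d' x (snd p)) (splits (k :: v))).
    simpl splits; rewrite !Rsum_app, !Rsum_map; simpl.
    assert (Ed : forall u, d x (plus (scal a h) k :: u) = a * d x (h :: u) + d x (k :: u)).
    { intros u; apply H2; auto using Forall_True. }
    assert (Ed' : forall u, d' x (plus (scal a h) k :: u) = a * d' x (h :: u) + d' x (k :: u)).
    { intros u; apply H2'; auto using Forall_True. }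
    rewrite Rmult_plus_distr_l, <- !Rsum_scal, <- !Rsum_plus.
    apply Rsum_ext; intros p _; rewrite Ed, Ed'; ring.
  - intros x n Hx; destruct (HB x n Hx) as [M [HM HMk]].
    exists (2 ^ n * (M * M)); intros v Hv _; rewrite norm_R.
    rewrite <- Hv at 1; rewrite <- splits_length, Rmult_assoc; apply Rsum_bound; intros p Hp.
    destruct (splits_spec v p Hp) as [l1 [l2 E]]; rewrite <- E, Rabs_mult.
    replace (M * M * (norm_product (fst p) * norm_product (snd p)))
      with ((M * norm_product (fst p)) * (M * norm_product (snd p))) by ring.
    apply Rmult_le_compat; try apply Rabs_pos; apply HMk; lia.
  - intros x n eps Hx; destruct (HB x (S n) Hx) as [M [HM HMk]].
    assert (P2 : 0 < 2 ^ n) by (apply pow_lt; lra).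
    (* The sum over [splits v] has [2 ^ n] terms, and each may contribute [e0]. *)
    set (e0 := eps / 2 ^ n); assert (He0 : 0 < e0) by (apply Rdiv_lt_0_compat; [apply cond_pos | exact P2]).
    (* Products with one of the remainders [ra], [rb] contribute [e1 * (2 * M + 1)] and
       [2 * M * e1]; the other half of [e0] is kept for the product of the two increments
       [A1 * B1]. *)
    choose_below e1 [1; e0 / 2 / (4 * M + 1)].
    assert (He1b : e1 * (4 * M + 1) <= e0 / 2).
    { apply (Rmult_le_reg_r (/ (4 * M + 1))); [apply Rinv_0_lt_compat; lra |].
      rewrite Rmult_assoc, Rinv_r, Rmult_1_r by lra; assumption. }
    destruct (uniform_in_length_pos (fun k del => forall h v, V (plus x h) -> norm h < del -> length v = k ->
      Rabs (d (plus x h) v - d x v - d x (h :: v)) <= e1 * norm h * norm_product v /\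
      Rabs (d' (plus x h) v - d' x v - d' x (h :: v)) <= e1 * norm h * norm_product v))
      with (n := n) as [del [Hdel HD]].
    { intros k a b Ha Hab Hk h v Hxh Hh Hv; apply Hk; auto; lra. }
    { intros k; destruct (H4 x k (mkposreal e1 pos_below) Hx) as [d1 Hd1], (H4' x k (mkposreal e1 pos_below) Hx) as [d2 Hd2].
      choose_below d0 [pos d1; pos d2]; exists d0; split; [assumption |]; intros h v Hxh Hh Hv; split.
      - apply (Hd1 h v I Hxh ltac:(lra) Hv (Forall_True v)).
      - apply (Hd2 h v I Hxh ltac:(lra) Hv (Forall_True v)). }
    choose_below d0 [del; 1; e0 / 2 / (M * M + 1)].
    exists (mkposreal d0 pos_below0); intros h v _ Hxh Hh Hv _; simpl in Hh.
    assert (Hh0 := norm_ge_0 h).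
    assert (Hh5 : M * M * norm h <= e0 / 2) by (apply small_mult; [nra | exact Hh0 | lra]).
    rewrite norm_R.
    change (Rabs (Rsum (fun p => d (plus x h) (fst p) * d' (plus x h) (snd p)) (splits v)
      - Rsum (fun p => d x (fst p) * d' x (snd p)) (splits v)
      - Rsum (fun p => d x (fst p) * d' x (snd p)) (splits (h :: v))) <= eps * norm h * norm_product v).
    simpl splits; rewrite Rsum_app, !Rsum_map; simpl.
    match goal with |- Rabs ?t <= _ => replace t with (Rsum (fun p =>
      d (plus x h) (fst p) * d' (plus x h) (snd p) + (-1) * (d x (fst p) * d' x (snd p)
        + (d x (h :: fst p) * d' x (snd p) + d x (fst p) * d' x (h :: snd p)))) (splits v))
      by (rewrite Rsum_plus, Rsum_scal, !Rsum_plus; ring) end.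
    replace (eps * norm h * norm_product v) with (2 ^ n * (e0 * norm h * norm_product v))
      by (unfold e0; field; lra).
    rewrite <- Hv at 1; rewrite <- splits_length; apply Rsum_bound; intros p Hp.
    destruct (splits_spec v p Hp) as [l1 [l2 E]]; rewrite <- E.
    destruct p as [u w]; simpl fst in *; simpl snd in *.
    destruct (HD (length u) ltac:(lia) h u Hxh ltac:(lra) eq_refl) as [r1 _].
    destruct (HD (length w) ltac:(lia) h w Hxh ltac:(lra) eq_refl) as [_ r2].
    destruct (HMk u ltac:(lia)) as [b1 _]; destruct (HMk w ltac:(lia)) as [_ b2].
    destruct (HMk (h :: u) ltac:(simpl; lia)) as [b3 _]; destruct (HMk (h :: w) ltac:(simpl; lia)) as [_ b4].
    simpl norm_product in b3, b4.
    set (A := d x u : R) in *; set (A1 := d x (h :: u) : R) in *; set (B := d' x w : R) in *; set (B1 := d' x (h :: w) : R) in *.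
    set (ra := d (plus x h) u - A - A1) in *; set (rb := d' (plus x h) w - B - B1) in *.
    replace (d (plus x h) u) with (A + A1 + ra) by (unfold ra; ring).
    replace (d' (plus x h) w) with (B + B1 + rb) by (unfold rb; ring).
    (* After the product and its first-order terms cancel, each remaining term contains both
       increments or a remainder. *)
    replace ((A + A1 + ra) * (B + B1 + rb) + -1 * (A * B + (A1 * B + A * B1)))
      with (A1 * B1 + ra * (B + B1 + rb) + (A + A1) * rb) by ring.
    assert (PU := norm_product_pos u); assert (PW := norm_product_pos w).
    set (U := norm_product u) in *; set (W := norm_product w) in *; set (t := norm h) in *.
    assert (b3' : Rabs A1 <= M * t * U) by lra; assert (b4' : Rabs B1 <= M * t * W) by lra.
    assert (b5 : Rabs A1 <= M * U).
    { eapply Rle_trans; [exact b3' |]; apply Rmult_le_compat_r; [exact PU | nra]. }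
    assert (b6 : Rabs B1 <= M * W).
    { eapply Rle_trans; [exact b4' |]; apply Rmult_le_compat_r; [exact PW | nra]. }
    assert (b7 : Rabs rb <= W).
    { eapply Rle_trans; [exact r2 |]; rewrite <- (Rmult_1_l W) at 2; apply Rmult_le_compat_r; [exact PW | nra]. }
    assert (c1 : Rabs (A1 * B1) <= (M * t * U) * (M * t * W)).
    { rewrite Rabs_mult; apply Rmult_le_compat; try apply Rabs_pos; assumption. }
    assert (c2 : Rabs (ra * (B + B1 + rb)) <= (e1 * t * U) * ((2 * M + 1) * W)).
    { rewrite Rabs_mult; apply Rmult_le_compat; try apply Rabs_pos; [assumption |].
      eapply Rle_trans; [apply Rabs_triang |]; assert (q := Rabs_triang B B1); lra. }
    assert (c3 : Rabs ((A + A1) * rb) <= (2 * M * U) * (e1 * t * W)).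
    { rewrite Rabs_mult; apply Rmult_le_compat; try apply Rabs_pos; [| assumption].
      assert (q := Rabs_triang A A1); lra. }
    assert (q1 := Rabs_triang (A1 * B1 + ra * (B + B1 + rb)) ((A + A1) * rb)).
    assert (q2 := Rabs_triang (A1 * B1) (ra * (B + B1 + rb))).
    assert (HUW : 0 <= t * (U * W)) by (apply Rmult_le_pos; [exact Hh0 | apply Rmult_le_pos; assumption]).
    assert (z1 : (M * M * t) * (t * (U * W)) <= e0 / 2 * (t * (U * W))) by (apply Rmult_le_compat_r; assumption).
    assert (z2 : e1 * (4 * M + 1) * (t * (U * W)) <= e0 / 2 * (t * (U * W))) by (apply Rmult_le_compat_r; assumption).
    lra.
Qed.

Definition prodL {X : Type} (L : X -> R) (v : list X) : R := fold_right (fun h r => L h * r) 1 v.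

Lemma prodL_bound {X : NormedModule R_AbsRing} (L : X -> R) (K : R) (v : list X) :
  0 <= K -> (forall x, Rabs (L x) <= K * norm x) -> Rabs (prodL L v) <= K ^ length v * norm_product v.
Proof.
  intros HK HL; induction v as [| h v IH]; simpl; [rewrite Rabs_R1; lra |].
  rewrite Rabs_mult.
  replace (K * K ^ length v * (norm h * norm_product v)) with ((K * norm h) * (K ^ length v * norm_product v)) by ring.
  apply Rmult_le_compat; try apply Rabs_pos; [apply HL | exact IH].
Qed.

(** [g] lists a function with its successive derivatives. The derivative of order [n] in [x] is
    [g n (L x + b)] times the product of the values of [L] on the directions. *)
Lemma smooth_comp_affine {X : NormedModule R_AbsRing} (V : X -> Prop) (L : X -> R) (b : R) (g : nat -> R -> R) :
  bounded_linear L ->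
  (forall x n, V x -> is_derive (g n) (L x + b) (g (S n) (L x + b))) ->
  smooth V (fun x => g 0%nat (L x + b) : R_NormedModule).
Proof.
  intros [HP [HS [K [HK HL]]]] Hg.
  exists (fun x v => g (length v) (L x + b) * prodL L v); split; [| split; [| split]].
  - intros x _; simpl; ring.
  - intros x v h k a _ _ _ _; simpl; rewrite HP, HS.
    change (g (S (length v)) (L x + b) * ((a * L h + L k) * prodL L v)
      = a * (g (S (length v)) (L x + b) * (L h * prodL L v)) + g (S (length v)) (L x + b) * (L k * prodL L v)); ring.
  - intros x n _; exists (Rabs (g n (L x + b)) * K ^ n); intros v Hv _.
    rewrite norm_R, Rabs_mult, Hv, Rmult_assoc; apply Rmult_le_compat_l; [apply Rabs_pos |].
    rewrite <- Hv; apply prodL_bound; assumption.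
  - intros x n eps Hx.
    assert (PK : 0 <= K ^ S n) by (apply pow_le; exact HK).
    assert (He : 0 < eps / (K ^ S n + 1)) by (apply Rdiv_lt_0_compat; [apply cond_pos | lra]).
    destruct (proj1 (is_derive_Reals _ _ _) (Hg x n Hx) _ He) as [d Hd].
    assert (Hm : 0 < d / (K + 1)) by (apply Rdiv_lt_0_compat; [apply cond_pos | lra]).
    exists (mkposreal _ Hm); intros h v _ _ Hh Hv _; simpl in Hh.
    assert (h0 := norm_ge_0 h).
    assert (Hs : Rabs (L h) < d).
    { eapply Rle_lt_trans; [apply HL |]; apply (Rmult_lt_compat_r (K + 1)) in Hh; [| lra].
      replace (d / (K + 1) * (K + 1)) with (pos d) in Hh by (field; lra); nra. }
    rewrite norm_R, HP, Hv; simpl length; rewrite Hv; simpl prodL.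
    change (Rabs (g n (L x + L h + b) * prodL L v - g n (L x + b) * prodL L v - g (S n) (L x + b) * (L h * prodL L v))
      <= eps * norm h * norm_product v).
    replace (L x + L h + b) with (L x + b + L h) by ring.
    replace (g n (L x + b + L h) * prodL L v - g n (L x + b) * prodL L v - g (S n) (L x + b) * (L h * prodL L v))
      with ((g n (L x + b + L h) - g n (L x + b) - L h * g (S n) (L x + b)) * prodL L v) by ring.
    assert (T : Rabs (g n (L x + b + L h) - g n (L x + b) - L h * g (S n) (L x + b))
      <= eps / (K ^ S n + 1) * Rabs (L h)).
    { destruct (Req_dec (L h) 0) as [E | E].
      - rewrite E, Rplus_0_r; replace (g n (L x + b) - g n (L x + b) - 0 * g (S n) (L x + b)) with 0 by ring.
        rewrite Rabs_R0; lra.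
      - specialize (Hd (L h) E Hs).
        replace (g n (L x + b + L h) - g n (L x + b) - L h * g (S n) (L x + b))
          with (((g n (L x + b + L h) - g n (L x + b)) / L h - g (S n) (L x + b)) * L h) by (field; exact E).
        rewrite Rabs_mult; apply Rmult_le_compat_r; [apply Rabs_pos | left; exact Hd]. }
    rewrite Rabs_mult.
    assert (PL := prodL_bound L K v HK HL); rewrite Hv in PL.
    assert (PV := norm_product_pos v).
    assert (Q : Rabs (g n (L x + b + L h) - g n (L x + b) - L h * g (S n) (L x + b))
      <= eps / (K ^ S n + 1) * (K * norm h)).
    { eapply Rle_trans; [exact T |]; apply Rmult_le_compat_l; [lra | apply HL]. }
    eapply Rle_trans; [apply Rmult_le_compat; [apply Rabs_pos | apply Rabs_pos | exact Q | exact PL] |].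
    replace (eps / (K ^ S n + 1) * (K * norm h) * (K ^ n * norm_product v))
      with (eps / (K ^ S n + 1) * K ^ S n * (norm h * norm_product v)) by (simpl; ring).
    replace (eps * norm h * norm_product v) with (eps * (norm h * norm_product v)) by ring.
    apply Rmult_le_compat_r; [nra |].
    apply (Rmult_le_reg_r (K ^ S n + 1)); [lra |].
    replace (eps / (K ^ S n + 1) * K ^ S n * (K ^ S n + 1)) with (eps * K ^ S n) by (field; lra).
    assert (0 < eps) by apply cond_pos; nra.
Qed.

Lemma smooth_inv_affine {X : NormedModule R_AbsRing} (V : X -> Prop) (L : X -> R) (b : R) :
  bounded_linear L -> (forall x, V x -> L x + b <> 0) -> smooth V (fun x => / (L x + b) : R_NormedModule).
Proof.
  intros HL Hne.
  set (g := fun (n : nat) (t : R) => (-1) ^ n * INR (Factorial.fact n) * / (t ^ S n)).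
  assert (H : smooth V (fun x => g 0%nat (L x + b) : R_NormedModule)).
  { apply smooth_comp_affine; [exact HL |]; intros x n Hx.
    assert (Ht := Hne x Hx); set (t := L x + b) in *.
    assert (Hp : forall k, t ^ k <> 0) by (intros k; apply pow_nonzero, Ht).
    assert (D := is_derive_scal (fun u => / (u ^ S n)) t ((-1) ^ n * INR (Factorial.fact n)) _
      (is_derive_inv (fun u => u ^ S n) t _ (is_derive_pow (fun u => u) (S n) t 1 (is_derive_id t)) (Hp (S n)))).
    refine (is_derive_val _ _ _ _ D _); unfold g.
    rewrite fact_simpl, mult_INR.
    replace (Init.Nat.pred (S n)) with n by reflexivity.
    replace (t ^ S (S n)) with (t * t * t ^ n) by (simpl; ring).
    replace (t ^ S n) with (t * t ^ n) by (simpl; ring).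
    replace ((-1) ^ S n) with (- (-1) ^ n) by (simpl; ring).
    specialize (Hp n); match goal with |- ?a = ?b => change (@eq R a b) end; field; split; assumption. }
  apply (smooth_on_sub _ V V _ _ (fun x h => h)) with (2 := H).
  intros x Hx; unfold g; simpl; rewrite !Rmult_1_l, Rmult_1_r; reflexivity.
Qed.

(** The [n]-th derivative of [y |-> (xi + snd y)^(j) (a + L y)] is
    [xi^(j+n) (a) * prod_i L h_i + sum_i k_i^(j+n-1) (a) * prod_(l <> i) L h_l];
    [eval_sum] is the second summand. *)
Fixpoint eval_sum {D E : C -> Prop} (L : pair_space D E -> R) (m : nat) (x : R) (v : list (pair_space D E)) : R :=
  match v with
  | [] => 0
  | h :: v => jet m x (snd h) * prodL L v + L h * eval_sum L m x v
  end.

(** The bound concerns any [F] with the recursion of [eval_sum]. It thereby covers also the Taylor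
    remainder of [eval_sum] in the point, where [phi] is the Taylor remainder of a jet. *)
Lemma eval_sum_bound {D E : C -> Prop} (L : pair_space D E -> R) (K : R) (n : nat) :
  0 <= K -> (forall x, Rabs (L x) <= K * norm x) ->
  exists M, 0 <= M /\ forall (phi : real_slice E -> R) (F : list (pair_space D E) -> R) (c : R),
    0 <= c -> (forall f : slice_NormedModule E, Rabs (phi f) <= c * norm f) ->
    F [] = 0 -> (forall h v, F (h :: v) = phi (snd h) * prodL L v + L h * F v) ->
    forall v, length v = n -> Rabs (F v) <= c * M * norm_product v.
Proof.
  intros HK HL; induction n as [| n [M [HM IH]]].
  - exists 0; split; [lra |]; intros phi F c Hc _ F0 _ [| h v] Hv; [| discriminate].
    rewrite F0, Rabs_R0; simpl; lra.
  - exists (K ^ n + K * M); split; [assert (h := pow_le K n HK); nra |].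
    intros phi F c Hc Hphi F0 FS [| h v] Hv; [discriminate |]; injection Hv; intros Hv'.
    specialize (IH phi F c Hc Hphi F0 FS v Hv').
    rewrite FS; simpl norm_product.
    assert (PL : Rabs (prodL L v) <= K ^ n * norm_product v) by (rewrite <- Hv'; apply prodL_bound; assumption).
    assert (PV := norm_product_pos v); assert (h0 := norm_ge_0 h).
    assert (n2 := norm_snd_le h : norm (snd h : slice_NormedModule E) <= norm h).
    eapply Rle_trans; [apply Rabs_triang |]; rewrite !Rabs_mult.
    assert (Q1 : Rabs (phi (snd h)) * Rabs (prodL L v) <= (c * norm h) * (K ^ n * norm_product v)).
    { apply Rmult_le_compat; try apply Rabs_pos; [| exact PL].
      eapply Rle_trans; [apply Hphi |]; apply Rmult_le_compat_l; assumption. }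
    assert (Q2 : Rabs (L h) * Rabs (F v) <= (K * norm h) * (c * M * norm_product v)).
    { apply Rmult_le_compat; try apply Rabs_pos; [apply HL | exact IH]. }
    lra.
Qed.

Lemma smooth_eval {D E : C -> Prop} (L : pair_space D E -> R) (a : R) (xi : real_slice E) (j : nat)
  (V : pair_space D E -> Prop) :
  open E -> bounded_linear L -> (forall y, V y -> E (RtoC (L y + a))) ->
  smooth V (fun y => jet j (L y + a) (plus (snd y : real_slice E) xi) : R_NormedModule).
Proof.
  intros HE [HP [HS [K [HK HL]]]] HV.
  (* For [v = []] the second summand is [0] whatever its order, so [pred 0 = 0] does no harm. *)
  exists (fun y v => jet (j + length v) (L y + a) (plus (snd y : real_slice E) xi) * prodL L v
    + eval_sum L (j + pred (length v)) (L y + a) v).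
  assert (Hball : forall y, V y -> exists r, 0 < r /\ forall w, Cmod (w - RtoC (L y + a)) < r -> E w).
  { intros y Hy; apply C_open_ball; auto. }
  split; [| split; [| split]].
  - intros y _; simpl; rewrite Nat.add_0_r, Rplus_0_r, Rmult_1_r; reflexivity.
  - intros y v h k b Hy _ _ _; simpl; rewrite HP, HS.
    set (x := L y + a); assert (Hx : E (RtoC x)) by (apply HV, Hy).
    assert (Ej : forall m, jet m x (snd (plus (scal b h) k) : real_slice E) = b * jet m x (snd h : real_slice E) + jet m x (snd k : real_slice E)).
    { intros m; rewrite <- jet_scal, <- jet_plus by assumption; reflexivity. }
    rewrite Ej.
    match goal with |- ?l = plus (scal b ?p) ?q => change (l = b * p + q) end.
    set (jh := jet (j + length v) x (snd h : real_slice E)); set (jk := jet (j + length v) x (snd k : real_slice E)).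
    change (jet (j + length v) x (snd h : real_slice E)) with jh; change (jet (j + length v) x (snd k : real_slice E)) with jk.
    set (b' := b : R); change b with b'. ring.
  - intros y n Hy; destruct (Hball y Hy) as [r [Hr Hb]].
    set (x := L y + a) in *.
    destruct (jet_bound (j + pred n) r Hr) as [c [Hc Hjet]].
    destruct (eval_sum_bound L K n HK HL) as [M [HM HMv]].
    specialize (HMv (jet (j + pred n) x) (eval_sum L (j + pred n) x) c Hc
      (fun f => Hjet E f x Hb) eq_refl (fun _ _ => eq_refl)).
    exists (Rabs (jet (j + n) x (plus (snd y : real_slice E) xi)) * K ^ n + c * M); intros v Hv _.
    rewrite norm_R, Hv; eapply Rle_trans; [apply Rabs_triang |].
    rewrite Rabs_mult, Rmult_plus_distr_r; apply Rplus_le_compat; [| apply HMv, Hv].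
    rewrite Rmult_assoc; apply Rmult_le_compat_l; [apply Rabs_pos |].
    rewrite <- Hv at 1; apply prodL_bound; assumption.
  - intros y n eps Hy; destruct (Hball y Hy) as [r [Hr Hb]].
    set (x := L y + a) in *; assert (Hx : E (RtoC x)) by (apply HV, Hy).
    destruct (jet_taylor (j + n) r Hr) as [c1 [rho1 [Hc1 [Hrho1 HT1]]]].
    destruct (jet_taylor (j + pred n) r Hr) as [c2 [rho2 [Hc2 [Hrho2 HT2]]]].
    destruct (jet_bound (S (j + n)) r Hr) as [c3 [Hc3 Hjet]].
    destruct (eval_sum_bound L K n HK HL) as [M [HM HMv]].
    set (xi' := plus (snd y : real_slice E) xi).
    set (N := slice_norm E xi'); assert (HN : 0 <= N) by apply slice_norm_pos.
    assert (PKn : 0 <= K ^ n) by (apply pow_le, HK).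
    (* [C1] collects the coefficients of [norm h ^ 2 * norm_product v] in the three terms into which
       the remainder is split below. *)
    set (C1 := (c1 * N * (K * K) + (c1 + c3) * K) * K ^ n + c2 * M * (K * K)).
    assert (HC1 : 0 <= C1).
    { unfold C1; assert (0 <= K * K) by nra.
      assert (0 <= c1 * N * (K * K)) by (repeat apply Rmult_le_pos; lra).
      assert (0 <= (c1 + c3) * K) by nra.
      apply Rplus_le_le_0_compat; repeat apply Rmult_le_pos; lra. }
    (* The entry [1] yields [s ^ 2 <= Rabs s], used for the increment of the jet of [eta]. *)
    choose_below rho [1; rho1; rho2].
    choose_below del [rho / (K + 1); eps / (C1 + 1)].
    exists (mkposreal del pos_below0); intros h v _ Hyh Hh Hv _; simpl in Hh.
    assert (h0 := norm_ge_0 h).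
    set (s := L h).
    assert (Hs : Rabs s <= K * norm h) by apply HL.
    assert (Hs1 : Rabs s <= rho) by (eapply Rle_trans; [exact Hs |]; apply small_mult; lra).
    assert (Hxs : E (RtoC (x + s))).
    { specialize (HV _ Hyh); rewrite HP in HV.
      replace (x + s) with (L y + L h + a) by (unfold x, s; ring); exact HV. }
    rewrite norm_R.
    set (m := (j + n)%nat); set (m' := (j + pred n)%nat).
    (* For nonempty [v] the two orders are equal, and for [v = []] both sums are [0]. *)
    assert (ET : eval_sum L m x v = eval_sum L (S m') x v).
    { destruct v as [| h' v]; [reflexivity |]; f_equal; unfold m, m'; simpl in Hv; lia. }
    set (eta := snd h : real_slice E).
    assert (E1 : jet m (x + s) (plus (snd (plus y h) : real_slice E) xi) = jet m (x + s) xi' + jet m (x + s) eta).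
    { rewrite <- jet_plus by assumption; f_equal.
      change (plus (plus (snd y : real_slice E) eta) xi = plus xi' eta); unfold xi'.
      rewrite <- !plus_assoc; f_equal; apply plus_comm. }
    (* Three contributions of second order in [h]: the Taylor remainder for the fixed function
       [xi'], the increment of the jet of the new direction [eta], already linear in [h], and the
       Taylor remainder of [eval_sum]. *)
    match goal with |- Rabs ?t <= _ => replace t with
      ((jet m (x + s) xi' - jet m x xi' - s * jet (S m) x xi') * prodL L v
       + (jet m (x + s) eta - jet m x eta) * prodL L v
       + (eval_sum L m' (x + s) v - eval_sum L m' x v - s * eval_sum L (S m') x v)) end.
    2: { assert (Hv' : @length (prod (real_slice D) (real_slice E)) v = n) by exact Hv.
      rewrite HP; simpl length; rewrite ?Hv, ?Hv'; simpl prodL; simpl eval_sum; simpl pred.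
      fold m m' x s xi' eta.
      replace (L y + s + a) with (x + s) by (unfold x; ring).
      rewrite E1, Nat.add_succ_r; fold m; rewrite ET.
      match goal with |- _ = minus (minus ?p ?q) ?r => change (minus (minus p q) r) with (p - q - r) end.
      change (jet m x (snd h : real_slice E)) with (jet m x eta); ring. }
    assert (A1 := HT1 E xi' x s HE Hb ltac:(lra)); fold m N in A1.
    assert (A2 := HT1 E eta x s HE Hb ltac:(lra)); fold m in A2.
    assert (A2' := Hjet E eta x Hb); fold m in A2'.
    assert (Heta : slice_norm E eta <= norm h) by apply (norm_snd_le h).
    assert (Heta0 := slice_norm_pos E eta).
    assert (PL : Rabs (prodL L v) <= K ^ n * norm_product v) by (rewrite <- Hv; apply prodL_bound; assumption).
    assert (PV := norm_product_pos v); set (P := norm_product v) in *; set (t := norm h) in *.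
    assert (Hs2 : s ^ 2 <= K * K * (t * t)).
    { rewrite <- pow2_abs; simpl; rewrite Rmult_1_r.
      replace (K * K * (t * t)) with ((K * t) * (K * t)) by ring.
      apply Rmult_le_compat; try apply Rabs_pos; exact Hs. }
    assert (Hs0 : 0 <= s ^ 2) by apply pow2_ge_0.
    assert (A3 : Rabs (eval_sum L m' (x + s) v - eval_sum L m' x v - s * eval_sum L (S m') x v)
      <= (c2 * s ^ 2) * M * P).
    { apply (HMv (fun f => jet m' (x + s) f - jet m' x f - s * jet (S m') x f)
        (fun v => eval_sum L m' (x + s) v - eval_sum L m' x v - s * eval_sum L (S m') x v)).
      - nra.
      - intros f; eapply Rle_trans; [apply (HT2 E f x s HE Hb); lra |].
        change (norm f) with (slice_norm E f); right; ring.
      - simpl; ring.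
      - intros h' v'; simpl; ring.
      - exact Hv. }
    assert (B1 : Rabs (jet m (x + s) xi' - jet m x xi' - s * jet (S m) x xi') <= c1 * N * (K * K) * (t * t)).
    { eapply Rle_trans; [exact A1 |]; rewrite (Rmult_assoc (c1 * N)).
      apply Rmult_le_compat_l; [nra | exact Hs2]. }
    assert (B2 : Rabs (jet m (x + s) eta - jet m x eta) <= (c1 + c3) * K * (t * t)).
    { replace (jet m (x + s) eta - jet m x eta)
        with ((jet m (x + s) eta - jet m x eta - s * jet (S m) x eta) + s * jet (S m) x eta) by ring.
      eapply Rle_trans; [apply Rabs_triang |]; rewrite Rabs_mult.
      assert (s ^ 2 <= Rabs s) by (rewrite <- pow2_abs; simpl; assert (q := Rabs_pos s); nra).
      assert (Z1 : c1 * slice_norm E eta * s ^ 2 <= c1 * t * (K * t)).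
      { apply Rmult_le_compat; [nra | exact Hs0 | apply Rmult_le_compat_l; lra | lra]. }
      assert (Z2 : Rabs s * Rabs (jet (S m) x eta) <= (K * t) * (c3 * t)).
      { apply Rmult_le_compat; try apply Rabs_pos; [exact Hs |].
        eapply Rle_trans; [exact A2' |]; apply Rmult_le_compat_l; assumption. }
      lra. }
    assert (B3 : Rabs (eval_sum L m' (x + s) v - eval_sum L m' x v - s * eval_sum L (S m') x v)
      <= c2 * M * (K * K) * (t * t) * P).
    { eapply Rle_trans; [exact A3 |]; apply Rmult_le_compat_r; [exact PV |].
      replace (c2 * s ^ 2 * M) with (c2 * M * s ^ 2) by ring.
      rewrite (Rmult_assoc (c2 * M)); apply Rmult_le_compat_l; [nra | exact Hs2]. }
    assert (T2 : 0 <= t * t) by nra.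
    assert (D1 : Rabs ((jet m (x + s) xi' - jet m x xi' - s * jet (S m) x xi') * prodL L v)
      <= (c1 * N * (K * K) * (t * t)) * (K ^ n * P)).
    { rewrite Rabs_mult; apply Rmult_le_compat; try apply Rabs_pos; assumption. }
    assert (D2 : Rabs ((jet m (x + s) eta - jet m x eta) * prodL L v) <= ((c1 + c3) * K * (t * t)) * (K ^ n * P)).
    { rewrite Rabs_mult; apply Rmult_le_compat; try apply Rabs_pos; assumption. }
    eapply Rle_trans; [apply Rabs_triang |].
    eapply Rle_trans; [apply Rplus_le_compat_r, Rabs_triang |].
    assert (TC : C1 * t <= eps) by (apply small_mult; lra).
    assert (TF : C1 * t * (t * P) <= eps * (t * P)) by (apply Rmult_le_compat_r; [nra | exact TC]).
    unfold C1 in TF; lra.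
Qed.

(** * Commuting extensions of class C^3 *)

(** A [C^3] function is carried along with its derivatives as a family [f 0], ..., [f 3]: gluing,
    composition and inversion are then explicit at each order, and [Derive_n] enters only at the
    end. *)
Definition tower_at (f : nat -> R -> R) (x : R) : Prop :=
  (forall k, (k < 3)%nat -> is_derive (f k) x (f (S k) x)) /\ continuous (f 3%nat) x.

Lemma tower_at_continuous (f : nat -> R -> R) (x : R) (k : nat) :
  tower_at f x -> (k <= 3)%nat -> continuous (f k) x.
Proof.
  intros [H1 H2] Hk; destruct (Nat.eq_dec k 3) as [-> | Hne]; [exact H2 |].
  apply (ex_derive_continuous (K := R_AbsRing) (V := R_NormedModule)); eexists; apply H1; lia.
Qed.

Lemma continuous_eps (f : R -> R) (x : R) :
  continuous f x -> forall eps, 0 < eps -> exists d, 0 < d /\ forall y, Rabs (y - x) < d -> Rabs (f y - f x) < eps.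
Proof.
  intros H eps He; destruct (proj1 (filterlim_locally _ _) H (mkposreal eps He)) as [d Hd].
  exists d; split; [apply cond_pos | intros y Hy; apply (Hd y Hy)].
Qed.

Lemma strictly_increasing (f f' : R -> R) (a b : R) :
  (forall x, a <= x <= b -> is_derive f x (f' x)) -> (forall x, a < x < b -> 0 < f' x) -> a < b -> f a < f b.
Proof.
  intros Hd Hp Hab.
  destruct (MVT_cor2 f f' a b Hab) as [c [E Hc]].
  - intros x Hx; apply is_derive_Reals, Hd, Hx.
  - specialize (Hp c Hc); nra.
Qed.

Lemma strictly_increasing_critical (f f' : R -> R) (u v : R) :
  (forall x, u < x < v -> is_derive f x (f' x)) -> (forall x, u < x < v -> x <> 0 -> 0 < f' x) ->
  forall x y, u < x -> y < v -> x < y -> f x < f y.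
Proof.
  intros Hd Hp x y Hx Hy Hxy.
  assert (Hside : forall s t, u < s -> t < v -> s < t -> (t <= 0 \/ 0 <= s) -> f s < f t).
  { intros s t Hs Ht Hst Hor; apply (strictly_increasing f f'); [| | exact Hst].
    - intros z Hz; apply Hd; lra.
    - intros z Hz; apply Hp; lra. }
  destruct (Rle_dec y 0) as [h1 | h1]; [apply Hside; auto; lra |].
  destruct (Rle_dec 0 x) as [h2 | h2]; [apply Hside; auto; lra |].
  apply Rlt_trans with (f 0); apply Hside; lra.
Qed.

Lemma open_interval_locally (J : R -> Prop) (x : R) : Defs.open_interval J -> J x -> locally x J.
Proof.
  intros [a [b HJ]] Hx; apply HJ in Hx.
  choose_below d [x - a; b - x]; exists (mkposreal d pos_below); intros y Hy; apply HJ.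
  change (Rabs (y - x) < d) in Hy; apply Rabs_lt_between in Hy; lra.
Qed.

Lemma tower_Derive_n (J : R -> Prop) (f : nat -> R -> R) (k : nat) :
  Defs.open_interval J -> (forall x, J x -> tower_at f x) -> (k <= 3)%nat ->
  forall x, J x -> Derive_n (f 0%nat) k x = f k x.
Proof.
  intros HJ Hf; induction k as [| k IH]; intros Hk x Hx; [reflexivity |].
  simpl; rewrite (Derive_ext_loc _ (f k)).
  - apply is_derive_unique, Hf; [exact Hx | lia].
  - generalize (open_interval_locally J x HJ Hx); apply filter_imp; intros y Hy; apply IH; [lia | exact Hy].
Qed.

Lemma tower_C_r (J : R -> Prop) (f : nat -> R -> R) :
  Defs.open_interval J -> (forall x, J x -> tower_at f x) -> C_r 3 J (f 0%nat).
Proof.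
  intros HJ Hf x Hx; split.
  - intros [| k] Hk; [exact I |]; simpl.
    apply (ex_derive_ext_loc (f k)).
    + generalize (open_interval_locally J x HJ Hx); apply filter_imp; intros y Hy.
      symmetry; apply (tower_Derive_n J); auto; lia.
    + eexists; apply Hf; [exact Hx | lia].
  - apply (continuous_ext_loc _ (f 3%nat)); [| apply Hf, Hx].
    generalize (open_interval_locally J x HJ Hx); apply filter_imp; intros y Hy.
    symmetry; apply (tower_Derive_n J); auto.
Qed.

Definition glue (f g : nat -> R -> R) (k : nat) : R -> R := extension_cont (f k) (g k) 0.

Lemma glue_le (f g : nat -> R -> R) (k : nat) (x : R) : x <= 0 -> glue f g k x = f k x.
Proof. intros H; unfold glue, extension_cont; destruct (Rle_dec x 0); [reflexivity | contradiction]. Qed.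

Lemma glue_ge (f g : nat -> R -> R) (k : nat) (x : R) : f k 0 = g k 0 -> 0 <= x -> glue f g k x = g k x.
Proof.
  intros E H; unfold glue, extension_cont; destruct (Rle_dec x 0) as [h | h]; [| reflexivity].
  replace x with 0 by lra; exact E.
Qed.

Lemma glue_tower (f g : nat -> R -> R) (x : R) :
  (forall k, (k <= 3)%nat -> f k 0 = g k 0) ->
  (x <= 0 -> tower_at f x) -> (0 <= x -> tower_at g x) -> tower_at (glue f g) x.
Proof.
  intros E Hf Hg.
  destruct (Rtotal_order x 0) as [Hx | [-> | Hx]].
  - assert (HL : forall k, locally x (fun y => f k y = glue f g k y)).
    { intros k; assert (h : 0 < - x) by lra; exists (mkposreal _ h); intros y Hy.
      assert (hy : Rabs (y - x) < - x) by exact Hy; apply Rabs_lt_between in hy.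
      symmetry; apply glue_le; lra. }
    destruct (Hf ltac:(lra)) as [H1 H2]; split.
    + intros k Hk; rewrite glue_le by lra; apply (is_derive_ext_loc (f k)); auto.
    + apply (continuous_ext_loc _ (f 3%nat)); [| exact H2].
      exact (HL 3%nat).
  - destruct (Hf ltac:(lra)) as [H1 H2], (Hg ltac:(lra)) as [H3 H4]; split.
    + intros k Hk; rewrite glue_le by lra.
      apply (extension_cont_is_derive (V := R_NormedModule)); [apply H1, Hk | rewrite E by lia; apply H3, Hk | apply E; lia].
    + apply (extension_cont_continuous (U := R_UniformSpace)); auto.
  - assert (HL : forall k, (k <= 3)%nat -> locally x (fun y => g k y = glue f g k y)).
    { intros k Hk; exists (mkposreal _ Hx); intros y Hy.
      assert (hy : Rabs (y - x) < x) by exact Hy; apply Rabs_lt_between in hy.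
      symmetry; apply glue_ge; [apply E, Hk | lra]. }
    destruct (Hg ltac:(lra)) as [H1 H2]; split.
    + intros k Hk; rewrite glue_ge by (try apply E; try lia; lra); apply (is_derive_ext_loc (g k)); auto; apply HL; lia.
    + apply (continuous_ext_loc _ (g 3%nat)); [| exact H2].
      apply HL; lia.
Qed.

Lemma is_derive_Rval (f : R -> R) (x l l' : R) : is_derive f x l -> l = l' -> is_derive f x l'.
Proof. intros H <-; exact H. Qed.

Lemma is_derive_Rmult (f g : R -> R) (x a b : R) :
  is_derive f x a -> is_derive g x b -> is_derive (fun y => f y * g y) x (a * g x + f x * b).
Proof. intros Hf Hg; exact (is_derive_mult f g x a b Hf Hg Rmult_comm). Qed.

Lemma is_derive_Rplus (f g : R -> R) (x a b : R) :
  is_derive f x a -> is_derive g x b -> is_derive (fun y => f y + g y) x (a + b).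
Proof. intros Hf Hg; exact (is_derive_plus f g x a b Hf Hg). Qed.

Lemma is_derive_Rcomp (f g : R -> R) (x a b : R) :
  is_derive f (g x) a -> is_derive g x b -> is_derive (fun y => f (g y)) x (a * b).
Proof.
  intros Hf Hg; refine (is_derive_Rval _ _ _ _ (is_derive_comp f g x a b Hf Hg) _).
  unfold scal; simpl; unfold mult; simpl; ring.
Qed.

Lemma continuous_Rmult (f g : R -> R) (x : R) : continuous f x -> continuous g x -> continuous (fun y => f y * g y) x.
Proof. exact (continuous_mult (K := R_AbsRing) f g x). Qed.

Lemma continuous_Rplus (f g : R -> R) (x : R) : continuous f x -> continuous g x -> continuous (fun y => f y + g y) x.
Proof. exact (continuous_plus (K := R_AbsRing) (V := R_NormedModule) f g x). Qed.

(** The chain rule up to order three (Faa di Bruno). *)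
Definition tower_comp (A B : nat -> R -> R) (k : nat) (x : R) : R :=
  let y := B 0%nat x in
  match k with
  | 0%nat => A 0%nat y
  | 1%nat => A 1%nat y * B 1%nat x
  | 2%nat => A 2%nat y * (B 1%nat x * B 1%nat x) + A 1%nat y * B 2%nat x
  | _ => A 3%nat y * (B 1%nat x * (B 1%nat x * B 1%nat x)) + 3 * (A 2%nat y * (B 1%nat x * B 2%nat x)) + A 1%nat y * B 3%nat x
  end.

Lemma tower_comp_at (A B : nat -> R -> R) (x : R) :
  tower_at B x -> tower_at A (B 0%nat x) -> tower_at (tower_comp A B) x.
Proof.
  intros HB HA.
  assert (CB : forall k, (k <= 3)%nat -> continuous (B k) x) by (intros; now apply tower_at_continuous).
  assert (CA : forall k, (k <= 3)%nat -> continuous (fun x => A k (B 0%nat x)) x).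
  { intros k Hk; apply (continuous_comp (B 0%nat) (A k)); [apply CB; lia | now apply tower_at_continuous]. }
  destruct HB as [HB _], HA as [HA _].
  assert (DA : forall k, (k < 3)%nat -> is_derive (fun x => A k (B 0%nat x)) x (A (S k) (B 0%nat x) * B 1%nat x)).
  { intros k Hk; apply is_derive_Rcomp; [apply HA, Hk | apply HB; lia]. }
  split.
  - intros [| [| [| k]]] Hk; [| | | lia]; unfold tower_comp.
    + apply (DA 0%nat); lia.
    + refine (is_derive_Rval _ _ _ _ (is_derive_Rmult _ _ _ _ _ (DA 1%nat ltac:(lia)) (HB 1%nat ltac:(lia))) _); ring.
    + refine (is_derive_Rval _ _ _ _ (is_derive_Rplus _ _ _ _ _
        (is_derive_Rmult _ _ _ _ _ (DA 2%nat ltac:(lia)) (is_derive_Rmult _ _ _ _ _ (HB 1%nat ltac:(lia)) (HB 1%nat ltac:(lia))))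
        (is_derive_Rmult _ _ _ _ _ (DA 1%nat ltac:(lia)) (HB 2%nat ltac:(lia)))) _); ring.
  - unfold tower_comp; repeat first [apply CB; lia | apply (CA 1%nat); lia | apply (CA 2%nat); lia | apply (CA 3%nat); lia
      | apply (continuous_const (V := R_UniformSpace)) | apply continuous_Rplus | apply continuous_Rmult].
Qed.

(** The derivatives of an inverse function [g], obtained by differentiating [H (g y) = y] three
    times. *)
Definition tower_inv (H : nat -> R -> R) (g : R -> R) (k : nat) (y : R) : R :=
  let z := g y in let p := / H 1%nat z in
  match k with
  | 0%nat => z
  | 1%nat => p
  | 2%nat => - H 2%nat z * p ^ 3
  | _ => (3 * H 2%nat z * H 2%nat z - H 1%nat z * H 3%nat z) * p ^ 5
  end.

(** The positive derivative makes [H 0] strictly increasing on the closed interval about [c]; the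
    inverse is chosen there by the intermediate value theorem. *)
Lemma inverse_tower (H : nat -> R -> R) (c r : R) :
  0 < r -> (forall z, Rabs (z - c) <= r -> tower_at H z /\ 0 < H 1%nat z) ->
  exists g, g (H 0%nat c) = c /\ exists d, 0 < d /\ forall y, Rabs (y - H 0%nat c) < d ->
    Rabs (g y - c) <= r /\ H 0%nat (g y) = y /\ tower_at (tower_inv H g) y.
Proof.
  intros Hr HH.
  set (lb := c - r); set (ub := c + r); set (h := H 0%nat).
  assert (Hin : forall z, lb <= z <= ub -> Rabs (z - c) <= r).
  { intros z Hz; apply Rabs_le_between; unfold lb, ub in Hz; lra. }
  assert (Hinc : forall x y, lb <= x -> x < y -> y <= ub -> h x < h y).
  { intros x y h1 h2 h3; apply (strictly_increasing h (H 1%nat)); [| | exact h2].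
    - intros z Hz; apply (HH z); [apply Hin; lra | lia].
    - intros z Hz; apply HH, Hin; lra. }
  assert (Hinj : forall x y, lb <= x <= ub -> lb <= y <= ub -> h x = h y -> x = y).
  { intros x y h1 h2 E; destruct (Rtotal_order x y) as [k | [k | k]]; [| exact k |].
    - specialize (Hinc x y); lra.
    - specialize (Hinc y x); lra. }
  assert (Hcont : forall a, lb <= a <= ub -> continuity_pt h a).
  { intros a Ha; apply continuity_pt_filterlim, tower_at_continuous; [apply HH, Hin, Ha | lia]. }
  assert (Hex : forall y, exists z, h lb <= y <= h ub -> lb <= z <= ub /\ h z = y).
  { intros y; destruct (classic (h lb <= y <= h ub)) as [Hy | Hy]; [| exists 0; intros k; contradiction].
    destruct (Ranalysis5.f_interv_is_interv h lb ub y) as [z Hz]; auto; [unfold lb, ub; lra |].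
    exists z; intros _; exact Hz. }
  pose (g := fun y => proj1_sig (constructive_indefinite_description _ (Hex y))).
  assert (Hg : forall y, h lb <= y <= h ub -> lb <= g y <= ub /\ h (g y) = y).
  { intros y; unfold g; apply (proj2_sig (constructive_indefinite_description _ (Hex y))). }
  assert (Hc1 : h lb < h c) by (apply Hinc; unfold lb, ub; lra).
  assert (Hc2 : h c < h ub) by (apply Hinc; unfold lb, ub; lra).
  assert (Hgc : forall y, h lb < y < h ub -> continuous g y).
  { intros y Hy; apply continuity_pt_filterlim.
    apply (Ranalysis5.continuity_pt_recip_interv h g lb ub); auto; try (unfold lb, ub; lra).
    - intros x k1 k2; apply Hg; split; assumption.
    - intros x k1 k2; apply Hg; split; assumption. }
  assert (Hgd : forall y, h lb < y < h ub -> is_derive g y (/ H 1%nat (g y))).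
  { intros y Hy.
    choose_below e [(y - h lb) / 2; (h ub - y) / 2].
    assert (Hginc : forall u v, h lb <= u -> u < v -> v <= h ub -> g u < g v).
    { intros u v k1 k2 k3; destruct (Hg u) as [a1 a2]; [lra |]; destruct (Hg v) as [b1 b2]; [lra |].
      apply Rnot_le_lt; intros Hle; destruct (Rle_lt_or_eq_dec _ _ Hle) as [q | q].
      - specialize (Hinc (g v) (g u)); lra.
      - rewrite q in b2; lra. }
    assert (Prf : forall a, g (y - e) <= a <= g (y + e) -> derivable_pt h a).
    { intros a Ha; exists (H 1%nat a); apply is_derive_Reals.
      destruct (Hg (y - e)) as [a1 _]; [lra |]; destruct (Hg (y + e)) as [b1 _]; [lra |].
      apply (HH a); [apply Hin; lra | lia]. }
    assert (Pi : g (y - e) <= g y <= g (y + e)) by (split; left; apply Hginc; lra).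
    assert (HD : derive_pt h (g y) (Prf (g y) Pi) = H 1%nat (g y)).
    { apply derive_pt_eq, is_derive_Reals, (HH (g y)); [apply Hin, Hg; lra | lia]. }
    assert (Hpos : 0 < H 1%nat (g y)) by (apply HH, Hin, Hg; lra).
    apply is_derive_Reals.
    replace (/ H 1%nat (g y)) with (1 / derive_pt h (g y) (Prf (g y) Pi)) by (rewrite HD; field; lra).
    apply (Ranalysis5.derivable_pt_lim_recip_interv h g (y - e) (y + e) y); try lra.
    - apply continuity_pt_filterlim, Hgc, Hy.
    - intros x Hx; apply (Hg x); lra. }
  exists g; split.
  - destruct (Hg (h c)) as [k1 k2]; [lra |]; apply Hinj; auto; unfold lb, ub; lra.
  - choose_below d [h c - h lb; h ub - h c]; exists d; split; [assumption |].
    intros y Hy; fold h in Hy; apply Rabs_lt_between in Hy; destruct (Hg y) as [a1 a2]; [lra |].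
    split; [apply Hin, a1 |]; split; [exact a2 |].
    destruct (HH (g y) (Hin _ a1)) as [HT Hpos].
    assert (Dg := Hgd y ltac:(lra)); assert (Cg := Hgc y ltac:(lra)).
    assert (DH : forall k, (k < 3)%nat -> is_derive (fun y => H k (g y)) y (H (S k) (g y) * / H 1%nat (g y))).
    { intros k Hk; apply is_derive_Rcomp; [apply HT, Hk | exact Dg]. }
    assert (CH : forall k, (k <= 3)%nat -> continuous (fun y => H k (g y)) y).
    { intros k Hk; apply (continuous_comp g (H k)); [exact Cg | now apply tower_at_continuous]. }
    assert (Dp : is_derive (fun y => / H 1%nat (g y)) y (- H 2%nat (g y) * (/ H 1%nat (g y)) ^ 3)).
    { refine (is_derive_Rval _ _ _ _ (is_derive_inv _ _ _ (DH 1%nat ltac:(lia)) _) _); [lra | field; lra]. }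
    assert (Cp : continuous (fun y => / H 1%nat (g y)) y).
    { apply (ex_derive_continuous (K := R_AbsRing) (V := R_NormedModule)); eexists; exact Dp. }
    split.
    + intros [| [| [| k]]] Hk; [| | | lia]; unfold tower_inv.
      * exact Dg.
      * exact Dp.
      * refine (is_derive_Rval _ _ _ _ (is_derive_Rmult _ _ _ _ _
          (is_derive_opp _ _ _ (DH 2%nat ltac:(lia))) (is_derive_pow _ 3 _ _ Dp)) _).
        unfold opp; simpl; field; lra.
    + unfold tower_inv.
      apply continuous_Rmult.
      * apply (continuous_minus (K := R_AbsRing) (V := R_NormedModule)).
        -- apply continuous_Rmult; [apply continuous_Rmult; [apply (continuous_const (V := R_UniformSpace)) |] |]; apply CH; lia.
        -- apply continuous_Rmult; apply CH; lia.
      * simpl; repeat apply continuous_Rmult; try exact Cp; apply (continuous_const (V := R_UniformSpace)).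
Qed.

Definition increasing_tower_at (f : nat -> R -> R) (x : R) : Prop := tower_at f x /\ (x <> 0 -> 0 < f 1%nat x).

(** [Z] is [H^-1 o G o F] near [0]. Since the first two derivatives of [F] vanish at [0], only the
    first derivatives of [G] and [H^-1] enter the third derivative of [Z]. *)
Lemma lift_tower (F G H : nat -> R -> R) (c r : R) :
  0 < r -> (forall x, Rabs x < r -> increasing_tower_at F x) ->
  (forall y, Rabs (y - F 0%nat 0) < r -> tower_at G y /\ 0 < G 1%nat y) ->
  (forall z, Rabs (z - c) < r -> tower_at H z /\ 0 < H 1%nat z) ->
  H 0%nat c = G 0%nat (F 0%nat 0) -> F 1%nat 0 = 0 -> F 2%nat 0 = 0 ->
  exists d Z, 0 < d /\
    (forall x, Rabs x < d -> increasing_tower_at Z x /\ H 0%nat (Z 0%nat x) = G 0%nat (F 0%nat x) /\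
      Rabs (Z 0%nat x - c) < r /\ Rabs (F 0%nat x - F 0%nat 0) < r) /\
    Z 0%nat 0 = c /\ Z 1%nat 0 = 0 /\ Z 2%nat 0 = 0 /\
    Z 3%nat 0 = G 1%nat (F 0%nat 0) * F 3%nat 0 / H 1%nat c.
Proof.
  intros Hr HF HG HH Ec F1 F2.
  destruct (inverse_tower H c (r / 2)) as [g [Hgc [d1 [Hd1 Hg]]]].
  { lra. } { intros z Hz; apply HH; lra. }
  assert (HF0 : tower_at F 0) by (apply HF; rewrite Rabs_R0; exact Hr).
  assert (HG0 : tower_at G (F 0%nat 0)) by (apply HG; rewrite Rminus_diag, Rabs_R0; exact Hr).
  set (K := tower_comp G F).
  destruct (continuous_eps (F 0%nat) 0 (tower_at_continuous F 0 0 HF0 ltac:(lia)) r Hr) as [d2 [Hd2 H2]].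
  destruct (continuous_eps (K 0%nat) 0 (tower_at_continuous K 0 0 (tower_comp_at _ _ _ HF0 HG0) ltac:(lia)) d1 Hd1)
    as [d3 [Hd3 H3]].
  choose_below d [r; d2; d3]; exists d, (tower_comp (tower_inv H g) K).
  split; [assumption |]; split; [| split].
  - intros x Hx; specialize (H2 x); specialize (H3 x); rewrite Rminus_0_r in H2, H3.
    specialize (H2 ltac:(lra)); specialize (H3 ltac:(lra)).
    change (K 0%nat 0) with (G 0%nat (F 0%nat 0)) in H3; rewrite <- Ec in H3.
    destruct (Hg _ H3) as [g1 [g2 g3]], (HF x ltac:(lra)) as [TF PF], (HG _ H2) as [TG PG].
    split; [split | split; [exact g2 | split; [change (Rabs (g (K 0%nat x) - c) < r); lra | exact H2]]].
    + apply tower_comp_at; [apply tower_comp_at; assumption | exact g3].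
    + intros Hx0; change (0 < / H 1%nat (g (K 0%nat x)) * (G 1%nat (F 0%nat x) * F 1%nat x)).
      apply Rmult_lt_0_compat; [apply Rinv_0_lt_compat, HH; lra | apply Rmult_lt_0_compat; auto].
  - change (g (K 0%nat 0) = c); change (K 0%nat 0) with (G 0%nat (F 0%nat 0)); rewrite <- Ec; exact Hgc.
  - assert (K0 : K 0%nat 0 = H 0%nat c) by (symmetry; exact Ec).
    assert (K1 : K 1%nat 0 = 0) by (unfold K, tower_comp; rewrite F1; ring).
    assert (K2 : K 2%nat 0 = 0) by (unfold K, tower_comp; rewrite F1, F2; ring).
    assert (K3 : K 3%nat 0 = G 1%nat (F 0%nat 0) * F 3%nat 0) by (unfold K, tower_comp; rewrite F1, F2; ring).
    unfold tower_comp at 1 2 3; rewrite K0, K1, K2, K3; unfold tower_inv; rewrite Hgc.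
    split; [ring | split; [ring |]]; unfold Rdiv; ring.
Qed.

Lemma positive_near (f : R -> R) (x : R) :
  continuous f x -> 0 < f x -> exists d, 0 < d /\ forall y, Rabs (y - x) < d -> 0 < f y.
Proof.
  intros Hc Hp; destruct (continuous_eps f x Hc (f x) Hp) as [d [Hd H]]; exists d; split; [exact Hd |].
  intros y Hy; specialize (H y Hy); apply Rabs_lt_between in H; lra.
Qed.

Lemma MVT_from_0 (f f' : R -> R) (x r : R) :
  (forall y, Rabs y < r -> is_derive f y (f' y)) -> Rabs x < r -> x <> 0 ->
  exists c, f x - f 0 = f' c * x /\ 0 < c * x /\ Rabs c < Rabs x.
Proof.
  intros Hd Hx Hx0; apply Rabs_lt_between in Hx.
  destruct (Rlt_dec 0 x) as [h | h].
  - destruct (MVT_cor2 f f' 0 x h) as [c [E Hc]].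
    + intros y Hy; apply is_derive_Reals, Hd, Rabs_lt_between; lra.
    + exists c; split; [lra |]; split; [nra |]; rewrite !Rabs_pos_eq; lra.
  - destruct (MVT_cor2 f f' x 0) as [c [E Hc]]; [lra | |].
    + intros y Hy; apply is_derive_Reals, Hd, Rabs_lt_between; lra.
    + exists c; split; [lra |]; split; [nra |]; rewrite !Rabs_left; lra.
Qed.

(** [f 1 x = x * c * f 3 c'] with [c], [c'] between [0] and [x]. *)
Lemma tower_critical_positive (f : nat -> R -> R) (r : R) :
  (forall x, Rabs x < r -> tower_at f x) -> f 1%nat 0 = 0 -> f 2%nat 0 = 0 ->
  (forall x, Rabs x < r -> 0 < f 3%nat x) -> forall x, Rabs x < r -> x <> 0 -> 0 < f 1%nat x.
Proof.
  intros Hf F1 F2 F3 x Hx Hx0.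
  destruct (MVT_from_0 (f 1%nat) (f 2%nat) x r) as [c [E1 [c1 c2]]]; auto.
  { intros y Hy; apply Hf; [exact Hy | lia]. }
  destruct (MVT_from_0 (f 2%nat) (f 3%nat) c r) as [c' [E2 [c3 c4]]]; auto; try lra.
  { intros y Hy; apply Hf; [exact Hy | lia]. } { intros E; rewrite E in c1; lra. }
  rewrite F1 in E1; rewrite F2 in E2.
  replace (f 1%nat x) with (f 3%nat c' * (c * x)) by nra.
  apply Rmult_lt_0_compat; [apply F3; lra | exact c1].
Qed.

(** At an endpoint other than [0] continuity extends the positivity of the derivative; at an
    endpoint [0] the positive third derivative does. *)
Lemma tower_positive_margin (f : nat -> R -> R) (u v r : R) :
  0 < r -> u <= 0 <= v -> (forall x, u - r < x < v + r -> tower_at f x) ->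
  f 1%nat 0 = 0 -> f 2%nat 0 = 0 -> 0 < f 3%nat 0 ->
  (forall x, u <= x <= v -> x <> 0 -> 0 < f 1%nat x) ->
  exists d, 0 < d /\ forall x, u - d < x < v + d -> increasing_tower_at f x.
Proof.
  intros Hr Huv Hf F1 F2 F3 Hp.
  assert (Hc : forall k x, u <= x <= v -> (k <= 3)%nat -> continuous (f k) x).
  { intros k x Hx Hk; apply tower_at_continuous; [apply Hf; lra | exact Hk]. }
  assert (Hend : forall w, u <= w <= v -> exists d, 0 < d /\ forall x, Rabs (x - w) < d -> x <> 0 -> 0 < f 1%nat x).
  { intros w Hw; destruct (Req_dec w 0) as [-> | Hne].
    - destruct (positive_near (f 3%nat) 0) as [d0 [Hd0 H0]]; [apply Hc; [lra | lia] | exact F3 |].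
      choose_below d [d0; r]; exists d; split; [assumption |]; intros x Hx; rewrite Rminus_0_r in Hx.
      apply (tower_critical_positive f d); auto; intros y Hy.
      + apply Rabs_lt_between in Hy; apply Hf; lra.
      + apply H0; rewrite Rminus_0_r; lra.
    - destruct (positive_near (f 1%nat) w) as [d [Hd H]]; [apply Hc; [lra | lia] | apply Hp; auto |].
      exists d; split; auto. }
  destruct (Hend u) as [d1 [Hd1 H1]]; [lra |]; destruct (Hend v) as [d2 [Hd2 H2]]; [lra |].
  choose_below d [r; d1; d2]; exists d; split; [assumption |].
  intros x Hx; split; [apply Hf; lra |]; intros Hx0.
  destruct (Rlt_dec x u) as [h | h]; [apply H1; auto; rewrite Rabs_left; lra |].
  destruct (Rlt_dec v x) as [h' | h']; [apply H2; auto; rewrite Rabs_pos_eq; lra |].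
  apply Hp; auto; lra.
Qed.

Lemma increasing_homeo_of_tower (I : R -> Prop) (f : nat -> R -> R) (u v : R) :
  (forall x, I x -> u < x < v) -> (forall x, u < x < v -> increasing_tower_at f x) -> increasing_homeo I (f 0%nat).
Proof.
  intros HI Hf; split.
  - intros x Hx; eapply filterlim_filter_le_1; [apply filter_le_within |].
    apply tower_at_continuous; [apply Hf, HI, Hx | lia].
  - intros x y Hx Hy; apply (strictly_increasing_critical _ (f 1%nat) u v); try apply HI; auto.
    + intros z Hz; apply Hf; [exact Hz | lia].
    + intros z Hz; apply Hf, Hz.
Qed.

(** Collects the clauses that [critical_commuting_pair] imposes on one of the two extensions
    alone. *)
Lemma critical_extension_of_tower (I : R -> Prop) (h : R -> R) (f : nat -> R -> R) (u v : R) :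
  let J := fun x => u < x < v in
  u < 0 < v -> (forall x, I x -> J x /\ f 0%nat x = h x) -> (forall x, J x -> increasing_tower_at f x) ->
  f 1%nat 0 = 0 -> f 2%nat 0 = 0 -> 0 < f 3%nat 0 ->
  (Defs.open_interval J /\ (forall x, I x -> J x /\ f 0%nat x = h x) /\ increasing_homeo J (f 0%nat) /\ C_r 3 J (f 0%nat)) /\
  (forall x, I x -> x <> 0 -> Derive (f 0%nat) x <> 0) /\
  (Derive (f 0%nat) 0 = 0 /\ Derive_n (f 0%nat) 2 0 = 0 /\ Derive_n (f 0%nat) 3 0 <> 0).
Proof.
  intros J H0 HI Hf F1 F2 F3.
  assert (OJ : Defs.open_interval J) by (exists u, v; intros x; reflexivity).
  assert (Tf : forall x, J x -> tower_at f x) by (intros x Hx; apply Hf, Hx).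
  assert (HD := fun k => tower_Derive_n J f k OJ Tf).
  split; [| split].
  - split; [exact OJ |]; split; [exact HI |]; split; [apply (increasing_homeo_of_tower J f u v); auto | apply tower_C_r; assumption].
  - intros x Hx Hx0; change (Derive_n (f 0%nat) 1 x <> 0); rewrite HD by (lia || apply HI, Hx).
    apply Rgt_not_eq, Hf; [apply HI, Hx | exact Hx0].
  - change (Derive (f 0%nat) 0) with (Derive_n (f 0%nat) 1 0); rewrite !HD by (lia || exact H0); lra.
Qed.

(** One of the two commuting extensions is free on each side of [0]: for [x > 0] the pair keeps [eta]
    and takes [xi x = eta^-1 (xi (eta x))]; for [x < 0] it keeps [xi] and takes [eta x = xi^-1 (eta (xi x))].
    The hypotheses on the values and third derivatives make the 3-jets match at [0]. *)
Lemma commuting_extension (f g : nat -> R -> R) (a r : R) :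
  0 < r -> a < 0 ->
  (forall x, - r < x < 1 + r -> tower_at f x) -> (forall x, a - r < x < r -> tower_at g x) ->
  f 0%nat 0 = a -> g 0%nat 0 = 1 ->
  f 1%nat 0 = 0 -> f 2%nat 0 = 0 -> g 1%nat 0 = 0 -> g 2%nat 0 = 0 ->
  (forall x, 0 < x <= 1 -> 0 < f 1%nat x) -> (forall x, a <= x < 0 -> 0 < g 1%nat x) ->
  0 < f 3%nat 0 -> 0 < g 3%nat 0 ->
  f 0%nat 1 = g 0%nat a -> f 1%nat 1 * g 3%nat 0 = g 1%nat a * f 3%nat 0 -> 0 < g 0%nat a ->
  critical_commuting_pair 3 (f 0%nat) (g 0%nat).
Proof.
  intros Hr Ha Hf Hg f00 g00 f10 f20 g10 g20 Pf Pg f30 g30 E0 E3 Hga.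
  destruct (tower_positive_margin f 0 1 r) as [d1 [Hd1 Hf1]]; auto; try lra.
  { intros x Hx; apply Hf; lra. } { intros x Hx Hx0; apply Pf; lra. }
  destruct (tower_positive_margin g a 0 r) as [d2 [Hd2 Hg1]]; auto; try lra.
  { intros x Hx; apply Hg; lra. } { intros x Hx Hx0; apply Pg; lra. }
  (* The entries [1] and [- a] keep the points near [1] positive and those near [a] negative, where
     the glued maps are the given [f] and [g]. *)
  choose_below rr [d1; d2; 1; - a].
  assert (f11 : 0 < f 1%nat 1) by (apply Pf; lra).
  assert (g1a : 0 < g 1%nat a) by (apply Pg; lra).
  assert (Hf2 : forall x, Rabs (x - 1) < rr -> tower_at f x /\ 0 < f 1%nat x).
  { intros x Hx; apply Rabs_lt_between in Hx; destruct (Hf1 x) as [h1 h2]; [lra |]; split; [exact h1 | apply h2; lra]. }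
  assert (Hg2 : forall x, Rabs (x - a) < rr -> tower_at g x /\ 0 < g 1%nat x).
  { intros x Hx; apply Rabs_lt_between in Hx; destruct (Hg1 x) as [h1 h2]; [lra |]; split; [exact h1 | apply h2; lra]. }
  destruct (lift_tower f g f 1 rr) as [dA [Z [HdA [HZ [Z0 [Z1 [Z2 Z3]]]]]]]; rewrite ?f00 in *; auto.
  { intros x Hx; apply Rabs_lt_between in Hx; apply Hf1; lra. }
  destruct (lift_tower g f g a rr) as [dB [Y [HdB [HY [Y0 [Y1 [Y2 Y3]]]]]]]; rewrite ?g00 in *; auto.
  { intros x Hx; apply Rabs_lt_between in Hx; apply Hg1; lra. }
  choose_below e [rr; dA; dB].
  set (f1 := glue Y f); set (g1 := glue g Z).
  (* Orders [0] to [2] agree by the normalisation at [0]; order [3] is the equation [E3]. *)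
  assert (Ef : forall k, (k <= 3)%nat -> Y k 0 = f k 0).
  { intros [| [| [| [| k]]]] Hk; try lia; try congruence; rewrite Y3, E3; field; lra. }
  assert (Eg : forall k, (k <= 3)%nat -> g k 0 = Z k 0).
  { intros [| [| [| [| k]]]] Hk; try lia; try congruence; rewrite Z3, <- E3; field; lra. }
  assert (f1_neg : forall k x, x <= 0 -> f1 k x = Y k x) by (intros; now apply glue_le).
  assert (f1_pos : forall k x, (k <= 3)%nat -> 0 <= x -> f1 k x = f k x) by (intros; apply glue_ge; auto).
  assert (g1_neg : forall k x, x <= 0 -> g1 k x = g k x) by (intros; now apply glue_le).
  assert (g1_pos : forall k x, (k <= 3)%nat -> 0 <= x -> g1 k x = Z k x) by (intros; apply glue_ge; auto).
  assert (HY' : forall x, - e < x <= 0 -> increasing_tower_at Y x) by (intros x Hx; apply HY, Rabs_lt_between; lra).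
  assert (HZ' : forall x, 0 <= x < e -> increasing_tower_at Z x) by (intros x Hx; apply HZ, Rabs_lt_between; lra).
  assert (S1 : forall x, segment 0 (g 0%nat 0) x <-> 0 <= x <= 1).
  { intros x; unfold segment; rewrite g00, Rmin_left, Rmax_right by lra; reflexivity. }
  assert (S2 : forall x, segment (f 0%nat 0) 0 x <-> a <= x <= 0).
  { intros x; unfold segment; rewrite f00, Rmin_left, Rmax_right by lra; reflexivity. }
  destruct (critical_extension_of_tower (segment 0 (g 0%nat 0)) (f 0%nat) f1 (- e) (1 + e)) as [A1 [A2 A3]];
    try (rewrite f1_pos by (lia || lra); assumption); try lra.
  { intros x Hx; apply S1 in Hx; split; [lra | apply f1_pos; [lia | lra]]. }
  { intros x Hx; split.
    - apply glue_tower; [exact Ef | intros h; apply HY'; lra | intros h; apply Hf1; lra].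
    - intros Hx0; destruct (Rle_dec x 0) as [h | h]; [rewrite f1_neg by exact h; apply HY' | rewrite f1_pos by (lia || lra); apply Hf1]; lra. }
  destruct (critical_extension_of_tower (segment (f 0%nat 0) 0) (g 0%nat) g1 (a - e) e) as [B1 [B2 B3]];
    try (rewrite g1_neg by lra; assumption); try lra.
  { intros x Hx; apply S2 in Hx; split; [lra | apply g1_neg; lra]. }
  { intros x Hx; split.
    - apply glue_tower; [exact Eg | intros h; apply Hg1; lra | intros h; apply HZ'; lra].
    - intros Hx0; destruct (Rle_dec x 0) as [h | h]; [rewrite g1_neg by exact h; apply Hg1 | rewrite g1_pos by (lia || lra); apply HZ']; lra. }
  assert (Hgi : increasing_homeo (segment (f 0%nat 0) 0) (g 0%nat)).
  { apply (increasing_homeo_of_tower _ g (a - rr) rr).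
    - intros x Hx; apply S2 in Hx; lra.
    - intros x Hx; apply Hg1; lra. }
  split; [| split; [exact Hgi | split]].
  - apply (increasing_homeo_of_tower _ f (- rr) (1 + rr)).
    + intros x Hx; apply S1 in Hx; lra.
    + intros x Hx; apply Hf1; lra.
  - apply S1; rewrite f00; split; [lra |]; rewrite <- g00; left; apply Hgi; try apply S2; lra.
  - exists (fun x => - e < x < 1 + e), (fun x => a - e < x < e), (f1 0%nat), (g1 0%nat).
    split; [exact A1 |]; split; [exact B1 |]; split; [| auto].
    intros x Hx1 Hx2 Hx3 Hx4.
    assert (Hx : Rabs x < e) by (apply Rabs_lt_between; lra).
    destruct (HZ x ltac:(lra)) as [_ [z1 [z2 z3]]], (HY x ltac:(lra)) as [_ [y1 [y2 y3]]].
    apply Rabs_lt_between in z2, z3, y2, y3.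
    (* For [x >= 0] the claim reads [f (Z x) = g (f x)], as [Z x] is near [1] and [f x] near [a];
       for [x < 0] it reads [f (g x) = g (Y x)]. *)
    destruct (Rle_dec 0 x) as [h | h].
    + rewrite (g1_pos 0%nat x), (f1_pos 0%nat x) by (lia || lra).
      rewrite f1_pos, g1_neg by (lia || lra); exact z1.
    + rewrite (g1_neg 0%nat x), (f1_neg 0%nat x) by lra.
      rewrite f1_pos, g1_neg by (lia || lra); symmetry; exact y1.
Qed.

(** * The equations and inequalities that define the pairs *)

Lemma jet_tower {W : C -> Prop} (f : real_slice W) (x : R) :
  open W -> W (RtoC x) -> tower_at (fun k y => jet k y f) x.
Proof.
  intros HW Hx; split.
  - intros k _; apply jet_derivative; assumption.
  - apply (ex_derive_continuous (K := R_AbsRing) (V := R_NormedModule) (fun y => jet 3 y f)).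
    eexists; apply jet_derivative; assumption.
Qed.

(** If [f' w = 0] with [w <> 0] small, then by Rolle's theorem [Re (f'' (t w) / (f''' (0) w)) = 0] for
    some [t > 0], whereas this quotient is close to [t]. *)
Lemma critical_point_isolated {W : C -> Prop} (f : real_slice W) :
  open W -> W (RtoC 0) -> jet 1 0 f = 0 -> jet 2 0 f = 0 -> jet 3 0 f <> 0 ->
  exists r, 0 < r /\ forall w, Cmod (w - RtoC 0) < r -> W w /\ (Dn 1 f w = RtoC 0 -> w = RtoC 0).
Proof.
  intros HW H0 J1 J2 J3.
  destruct (C_open_ball W _ HW H0) as [r1 [Hr1 Hb]].
  set (m := Dn 3 f (RtoC 0)).
  assert (Em : m = RtoC (jet 3 0 f)) by (apply Dn_jet; assumption).
  assert (Hm : m <> RtoC 0) by (rewrite Em; intros E; apply RtoC_inj in E; contradiction).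
  assert (Hm' : 0 < Cmod m) by (apply Cmod_gt_0, Hm).
  assert (E2 : Dn 2 f (RtoC 0) = RtoC 0) by (rewrite (Dn_jet f 2 0 HW H0), J2; reflexivity).
  assert (E1 : Dn 1 f (RtoC 0) = RtoC 0) by (rewrite (Dn_jet f 1 0 HW H0), J1; reflexivity).
  destruct (proj1 (C_derivative_iff _ _ _) (Dn_derivative W f 2 (RtoC 0) HW H0) (Cmod m / 2)) as [d [Hd H]]; [lra |].
  fold m in H; rewrite E2 in H.
  choose_below r0 [r1; d]; exists r0; split; [assumption |]; intros w Hw.
  assert (w1 : Cmod (w - RtoC 0) < r1) by lra; assert (w2 : Cmod (w - RtoC 0) < d) by lra.
  split; [apply Hb, w1 |]; intros Hz.
  apply NNPP; intros Hw0.
  replace (w - RtoC 0)%C with w in w1, w2 by ring.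
  set (k := (/ (m * (w * w)))%C).
  assert (Hin : forall t, 0 <= t <= 1 -> Cmod (RtoC t * w) <= Cmod w).
  { intros t Ht; rewrite Cmod_mult, Cmod_R, Rabs_pos_eq by lra; assert (h := Cmod_ge_0 w); nra. }
  destruct (MVT_cor2 (fun t => Re (k * Dn 1 f (RtoC t * w))%C) (fun t => Re (k * (Dn 2 f (RtoC t * w) * w))%C) 0 1) as [t [Et Ht]].
  - lra.
  - intros t Ht; apply is_derive_Reals.
    apply (is_derive_C_parts (fun t => k * Dn 1 f (RtoC t * w))%C t (k * (Dn 2 f (RtoC t * w) * w))%C).
    apply (RtoC_derivative (fun u => k * Dn 1 f (u * w))%C).
    apply (C_derivative_scal (fun u => Dn 1 f (u * w))%C).
    apply (is_derive_ext (K := C_AbsRing) (V := C_NormedModule) (fun u => Dn 1 f (u * w + 0))%C); [intros u; f_equal; ring |].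
    apply C_derivative_comp_affine; rewrite Cplus_0_r; apply (Dn_derivative W); [exact HW |]; apply Hb.
    replace (RtoC t * w - RtoC 0)%C with (RtoC t * w)%C by ring; specialize (Hin t Ht); lra.
  - replace (RtoC 1 * w)%C with w in Et by ring; replace (RtoC 0 * w)%C with (RtoC 0) in Et by ring.
    rewrite Hz, E1, Cmult_0_r in Et.
    specialize (H (RtoC t * w)%C); replace (RtoC t * w - RtoC 0)%C with (RtoC t * w)%C in H by ring.
    assert (Ht' := Hin t ltac:(lra)); specialize (H ltac:(lra)).
    set (err := (Dn 2 f (RtoC t * w) - RtoC 0 - m * (RtoC t * w))%C) in *.
    assert (Ek : (k * (Dn 2 f (RtoC t * w) * w))%C = (RtoC t + err / (m * w))%C).
    { unfold k, err; field; split; assumption. }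
    assert (Hmw : (m * w)%C <> RtoC 0) by now apply Cmult_neq_0.
    assert (Hwp : 0 < Cmod w) by now apply Cmod_gt_0.
    assert (Hq : Cmod (err / (m * w)) <= t / 2).
    { rewrite Cmod_div, Cmod_mult by exact Hmw.
      rewrite Cmod_mult, Cmod_R, Rabs_pos_eq in H by lra.
      apply (Rmult_le_reg_r (Cmod m * Cmod w)); [nra |].
      unfold Rdiv at 1; rewrite Rmult_assoc, Rinv_l by nra; lra. }
    rewrite Ek, re_plus, !re_RtoC in Et.
    assert (Hre := re_le_Cmod (err / (m * w))%C).
    assert (Hre' := Rle_trans _ _ _ Hre Hq); apply Rabs_le_between in Hre'.
    lra.
Qed.

(** The neighbourhood is a union of discs about the points of [I]: the one at [0] comes from
    [critical_point_isolated], the others from continuity of the nonzero derivative. *)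
Lemma only_critical_point_intro {W : C -> Prop} (I : R -> Prop) (f : real_slice W) :
  open W -> (forall x, I x -> W (RtoC x)) -> I 0 -> jet 1 0 f = 0 -> jet 2 0 f = 0 -> jet 3 0 f <> 0 ->
  (forall x, I x -> x <> 0 -> jet 1 x f <> 0) -> only_critical_point_0 W I f.
Proof.
  intros HW HI I0 J1 J2 J3 Hne.
  exists (fun z => exists x r, I x /\ Cmod (z - RtoC x) < r /\
    forall w, Cmod (w - RtoC x) < r -> W w /\ (Dn 1 f w = RtoC 0 -> w = RtoC 0)).
  split; [| split; [| split]].
  - apply C_open_intro; intros z [x [r [Hx [Hz H]]]].
    exists (r - Cmod (z - RtoC x)); split; [lra |]; intros w Hw; exists x, r; split; [exact Hx |]; split; [| exact H].
    replace (w - RtoC x)%C with ((w - z) + (z - RtoC x))%C by ring.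
    eapply Rle_lt_trans; [apply Cmod_triangle |]; lra.
  - intros x Hx.
    assert (Hball : exists r, 0 < r /\ forall w, Cmod (w - RtoC x) < r -> W w /\ (Dn 1 f w = RtoC 0 -> w = RtoC 0)).
    { destruct (Req_dec x 0) as [-> | Hx0]; [apply critical_point_isolated; auto |].
      destruct (C_open_ball W _ HW (HI x Hx)) as [r1 [Hr1 Hb]].
      assert (Hp : Dn 1 f (RtoC x) <> RtoC 0).
      { rewrite (Dn_jet f 1 x HW (HI x Hx)); intros E; apply RtoC_inj in E; apply (Hne x Hx Hx0 E). }
      destruct (C_derivative_continuous _ _ _ (Dn_derivative W f 1 _ HW (HI x Hx)) (Cmod (Dn 1 f (RtoC x)))) as [d [Hd H]].
      { apply Cmod_gt_0, Hp. }
      choose_below r0 [r1; d]; exists r0; split; [assumption |]; intros w Hw; split; [apply Hb; lra |].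
      intros E; exfalso; specialize (H w ltac:(lra)).
        rewrite E in H; replace (0 - Dn 1 f (RtoC x))%C with (- Dn 1 f (RtoC x))%C in H by ring.
        rewrite Cmod_opp in H; lra. }
    destruct Hball as [r [Hr H]]; exists x, r; split; [exact Hx |]; split; [| exact H].
    replace (RtoC x - RtoC x)%C with (RtoC 0) by ring; rewrite Cmod_0; exact Hr.
  - intros z [x [r [Hx [Hz H]]]]; apply (H z Hz).
  - intros z [x [r [Hx [Hz H]]]]; destruct (H z Hz) as [Wz Hc]; split.
    + intros Hd; apply Hc, is_C_derive_unique, Hd.
    + intros ->; apply (is_derive_val (K := C_AbsRing) (V := C_NormedModule) f _ (Dn 1 f (RtoC 0))).
      * apply (Dn_derivative W f 0); assumption.
      * rewrite (Dn_jet f 1 0 HW Wz), J1; reflexivity.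
Qed.

(** At an endpoint the difference quotients are taken from inside. So the derivatives of any
    extension are determined by the values on the closed interval, and a [C^3] extension shares its
    jets there with the analytic one. *)
Lemma derive_within (F : R -> R) (u v x l : R) :
  u < v -> u <= x <= v -> is_derive F x l ->
  forall eps, 0 < eps -> exists y, u <= y <= v /\ y <> x /\ Rabs ((F y - F x) / (y - x) - l) < eps.
Proof.
  intros Huv Hx Hd eps He; apply is_derive_Reals in Hd.
  destruct (Hd eps He) as [d H]; assert (Hd0 := cond_pos d).
  assert (Hh : exists h, h <> 0 /\ Rabs h < d /\ u <= x + h <= v).
  { destruct (Rlt_dec x v) as [k | k].
    - choose_below h [d / 2; v - x]; exists h; rewrite Rabs_pos_eq by lra; lra.
    - choose_below h [d / 2; x - u]; exists (- h); rewrite Rabs_Ropp, Rabs_pos_eq by lra; lra. }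
  destruct Hh as [h [h0 [h1 h2]]]; exists (x + h); split; [exact h2 |]; split; [lra |].
  replace (x + h - x) with h by ring; apply H; assumption.
Qed.

Lemma derive_within_unique (F G : R -> R) (u v x l l' : R) :
  u < v -> u <= x <= v -> (forall y, u <= y <= v -> F y = G y) ->
  is_derive F x l -> is_derive G x l' -> l = l'.
Proof.
  intros Huv Hx E HF HG; apply NNPP; intros Hne.
  assert (HD : is_derive (fun y => F y - G y) x (l - l')) by exact (is_derive_minus F G x l l' HF HG).
  assert (Hp : 0 < Rabs (l - l')) by (apply Rabs_pos_lt; lra).
  destruct (derive_within _ u v x _ Huv Hx HD _ Hp) as [y [Hy [Hyx H]]].
  rewrite !E, !Rminus_diag in H by assumption.
  replace (0 / (y - x) - (l - l')) with (- (l - l')) in H by (field; lra).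
  rewrite Rabs_Ropp in H; lra.
Qed.

Lemma derive_within_increasing (F : R -> R) (u v x l : R) :
  u < v -> u <= x <= v -> (forall y z, u <= y <= v -> u <= z <= v -> y < z -> F y < F z) ->
  is_derive F x l -> 0 <= l.
Proof.
  intros Huv Hx Hi Hd; apply Rnot_lt_le; intros Hl.
  destruct (derive_within F u v x l Huv Hx Hd (- l)) as [y [Hy [Hyx H]]]; [lra |].
  apply Rabs_lt_between in H.
  assert (Hq : 0 < (F y - F x) / (y - x)).
  { destruct (Rtotal_order y x) as [k | [k | k]]; [| contradiction |].
    - specialize (Hi y x Hy Hx k).
      replace ((F y - F x) / (y - x)) with ((F x - F y) / (x - y)) by (field; lra).
      apply Rdiv_lt_0_compat; lra.
    - specialize (Hi x y Hx Hy k); apply Rdiv_lt_0_compat; lra. }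
  lra.
Qed.

Lemma C_r_tower (J : R -> Prop) (h : R -> R) (x : R) :
  C_r 3 J h -> J x -> tower_at (fun k => Derive_n h k) x.
Proof.
  intros H Hx; destruct (H x Hx) as [H1 H2]; split; [| exact H2].
  intros k Hk; apply Derive_correct; apply (H1 (S k)); lia.
Qed.

Lemma extension_derivatives (J : R -> Prop) (h : R -> R) (f : nat -> R -> R) (u v : R) :
  u < v -> C_r 3 J h -> (forall x, u <= x <= v -> J x /\ h x = f 0%nat x /\ tower_at f x) ->
  forall k x, (k <= 3)%nat -> u <= x <= v -> Derive_n h k x = f k x.
Proof.
  intros Huv Hh Hf; induction k as [| k IH]; intros x Hk Hx; [apply Hf, Hx |].
  apply (derive_within_unique (Derive_n h k) (f k) u v x); auto.
  - intros y Hy; apply IH; [lia | exact Hy].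
  - apply (C_r_tower J h x Hh); [apply Hf, Hx | lia].
  - apply (Hf x Hx); lia.
Qed.

(** Were the third derivative negative, [- f] would have positive derivative near [0] off [0], by
    [tower_critical_positive]. The sign of [s] selects the side of [0] on which the map is known to
    increase: right for [eta], left for [xi]. *)
Lemma increasing_third_derivative (f : nat -> R -> R) (r s : R) :
  0 < r -> s <> 0 -> (forall x, Rabs x < r -> tower_at f x) -> f 1%nat 0 = 0 -> f 2%nat 0 = 0 -> f 3%nat 0 <> 0 ->
  (forall t, 0 <= t <= 1 -> 0 <= f 1%nat (t * s)) -> 0 < f 3%nat 0.
Proof.
  intros Hr Hs Hf F1 F2 F3 Hpos; apply Rnot_le_lt; intros Hle.
  set (g := fun k x => - f k x).
  assert (Hg : forall x, Rabs x < r -> tower_at g x).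
  { intros x Hx; destruct (Hf x Hx) as [h1 h2]; split.
    - intros k Hk; exact (is_derive_opp _ _ _ (h1 k Hk)).
    - exact (continuous_opp (K := R_AbsRing) (V := R_NormedModule) _ _ h2). }
  destruct (positive_near (g 3%nat) 0) as [d [Hd H]].
  { apply Hg; rewrite Rabs_R0; exact Hr. } { unfold g; lra. }
  assert (Hs' := Rabs_pos_lt s Hs).
  choose_below e [r; d].
  choose_below t [1; e / 2 / (Rabs s + 1)].
  assert (Hts : Rabs s * t <= e / 2) by (apply small_mult; lra).
  assert (0 < g 1%nat (t * s)).
  { apply (tower_critical_positive g e); try (unfold g; lra).
    - intros x Hx; apply Hg; lra.
    - intros x Hx; apply H; rewrite Rminus_0_r; lra.
    - rewrite Rabs_mult, (Rabs_pos_eq t); lra.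
    - nra. }
  specialize (Hpos t ltac:(lra)); unfold g in *; lra.
Qed.

Definition jet_fst {D E : C -> Prop} (n : nat) (x : R) (p : pair_space D E) : R := jet n x (fst p : real_slice D).
Definition jet_snd {D E : C -> Prop} (n : nat) (x : R) (p : pair_space D E) : R := jet n x (snd p : real_slice E).

Definition pair_equations {D E : C -> Prop} (p : pair_space D E) : Prop :=
  let a := jet_fst 0 0 p in
  jet_fst 1 0 p = 0 /\ jet_fst 2 0 p = 0 /\ jet_snd 0 0 p = 1 /\ jet_snd 1 0 p = 0 /\ jet_snd 2 0 p = 0 /\
  jet_fst 0 1 p = jet_snd 0 a p /\ jet_fst 1 1 p * jet_snd 3 0 p = jet_snd 1 a p * jet_fst 3 0 p.

(** Since both maps increase, non-vanishing derivatives become positive ones. The conditions are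
    open only among solutions of the equations: the sign of a derivative near its zero [0] is
    governed by the third derivative because the first two vanish there. *)
Definition pair_open (C0 : R) {D E : C -> Prop} (p : pair_space D E) : Prop :=
  let a := jet_fst 0 0 p in
  - (2 * C0) < a < - / (2 * C0) /\ (forall x, a <= x <= 0 -> E (RtoC x)) /\ 0 < jet_snd 0 a p /\
  (forall x, 0 < x <= 1 -> 0 < jet_fst 1 x p) /\ 0 < jet_fst 3 0 p /\
  (forall x, a <= x < 0 -> 0 < jet_snd 1 x p) /\ 0 < jet_snd 3 0 p.

Lemma segment_interior (W : C -> Prop) (u v : R) :
  open W -> u <= v -> (forall x, u <= x <= v -> W (RtoC x)) -> exists r, 0 < r /\ forall x, u - r < x < v + r -> W (RtoC x).
Proof.
  intros HW Huv H; destruct (segment_radius W u v HW H) as [r [Hr Hb]]; exists r; split; [exact Hr |].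
  intros x Hx.
  destruct (Rlt_dec x u) as [h | h]; [| destruct (Rlt_dec v x) as [h' | h']].
  - apply (Hb u); [lra |]; rewrite <- RtoC_minus, Cmod_R, Rabs_left; lra.
  - apply (Hb v); [lra |]; rewrite <- RtoC_minus, Cmod_R, Rabs_pos_eq; lra.
  - apply H; lra.
Qed.

Lemma B_DE_intro (C0 : R) (D E : C -> Prop) (p : pair_space D E) :
  1 < C0 -> open D -> open E -> (forall x, 0 <= x <= 1 -> D (RtoC x)) ->
  pair_equations p -> pair_open C0 p -> B_DE C0 D E p.
Proof.
  intros HC HD HE D01 [e1 [e2 [x0 [x1 [x2 [E0 E3]]]]]] [Ha [HEa [Hxa [Pe [e3 [Px x3]]]]]].
  unfold jet_fst, jet_snd in *.
  set (eta := fst p : real_slice D) in *; set (xi := snd p : real_slice E) in *; set (a := jet 0 0 eta) in *.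
  assert (HCi : 0 < / (2 * C0)) by (apply Rinv_0_lt_compat; lra).
  assert (S1 : forall x, segment 0 (jet 0 0 xi) x <-> 0 <= x <= 1).
  { intros x; unfold segment; rewrite x0, Rmin_left, Rmax_right by lra; reflexivity. }
  assert (S2 : forall x, segment a 0 x <-> a <= x <= 0).
  { intros x; unfold segment; rewrite Rmin_left, Rmax_right by lra; reflexivity. }
  unfold B_DE; change (real_trace (fst p)) with (fun x => jet 0 x eta); change (real_trace (snd p)) with (fun x => jet 0 x xi).
  cbv beta zeta.
  destruct (segment_interior D 0 1 HD ltac:(lra) D01) as [r1 [Hr1 H1]].
  destruct (segment_interior E a 0 HE ltac:(lra) HEa) as [r2 [Hr2 H2]].
  choose_below r [r1; r2].
  split; [split; [| split] | split; [| split; [| split; [| split; [| split]]]]].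
  - apply (commuting_extension (fun k x => jet k x eta) (fun k x => jet k x xi) a r); auto; try lra.
    + intros x Hx; apply jet_tower; [exact HD | apply H1; lra].
    + intros x Hx; apply jet_tower; [exact HE | apply H2; lra].
  - exists D, eta; split; [exact HD | split; [apply slice_holomorphic |]].
    intros x Hx; apply S1 in Hx; split; [apply D01, Hx | apply (Dn_jet eta 0 x HD (D01 x Hx))].
  - exists E, xi; split; [exact HE | split; [apply slice_holomorphic |]].
    intros x Hx; apply S2 in Hx; split; [apply HEa, Hx | apply (Dn_jet xi 0 x HE (HEa x Hx))].
  - intros x Hx; apply HEa, S2, Hx.
  - change (only_critical_point_0 D (segment 0 (jet 0 0 xi)) eta); apply only_critical_point_intro; auto.
    + intros x Hx; apply D01, S1, Hx.
    + apply S1; lra.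
    + lra.
    + intros x Hx Hx0; apply S1 in Hx; assert (0 < jet 1 x eta) by (apply Pe; lra); lra.
  - change (only_critical_point_0 E (segment a 0) xi); apply only_critical_point_intro; auto.
    + intros x Hx; apply HEa, S2, Hx.
    + apply S2; lra.
    + lra.
    + intros x Hx Hx0; apply S2 in Hx; assert (0 < jet 1 x xi) by (apply Px; lra); lra.
  - exact x0.
  - fold a; rewrite Rabs_left by lra; lra.
  - fold a; lra.
Qed.

Lemma B_DE_elim (C0 : R) (D E : C -> Prop) (p : pair_space D E) :
  1 < C0 -> open D -> open E -> (forall x, 0 <= x <= 1 -> D (RtoC x)) ->
  B_DE C0 D E p -> pair_equations p /\ pair_open C0 p.
Proof.
  intros HC HD HE D01.
  set (eta := fst p : real_slice D); set (xi := snd p : real_slice E).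
  unfold B_DE; change (real_trace (fst p)) with (fun x => jet 0 x eta); change (real_trace (snd p)) with (fun x => jet 0 x xi).
  cbv beta zeta; intros [[HP _] [HEa [_ [_ [x0 [Ha Hxa]]]]]].
  destruct HP as [[_ Ieta] [[_ Ixi] [Hxia [Je [Jx [eta1 [xi1 HX]]]]]]].
  destruct HX as [[OJe [Se [_ Ce]]] [[OJx [Sx [_ Cx]]] [Hcom [Ne [Nx [[d1 [d2 d3]] [d1' [d2' d3']]]]]]]].
  set (a := jet 0 0 eta) in *.
  assert (HCi : 0 < / (2 * C0)) by (apply Rinv_0_lt_compat; lra).
  (* If [a] were positive, monotonicity would give [xi a > xi 0 = 1], although [xi a] lies in
     [[0, 1]]. *)
  assert (Ha0 : a < 0).
  { apply Rnot_le_lt; intros h; rewrite Rabs_pos_eq in Ha by exact h.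
    assert (k : jet 0 0 xi < jet 0 a xi).
    { apply Ixi; [| | lra]; unfold segment; rewrite Rmin_right, Rmax_left by lra; lra. }
    unfold segment in Hxia; rewrite x0 in *; rewrite Rmax_right in Hxia by lra; lra. }
  assert (S1 : forall x, segment 0 (jet 0 0 xi) x <-> 0 <= x <= 1).
  { intros x; unfold segment; rewrite x0, Rmin_left, Rmax_right by lra; reflexivity. }
  assert (S2 : forall x, segment a 0 x <-> a <= x <= 0).
  { intros x; unfold segment; rewrite Rmin_left, Rmax_right by lra; reflexivity. }
  assert (HE' : forall x, a <= x <= 0 -> E (RtoC x)) by (intros x Hx; apply HEa, S2, Hx).
  rewrite Rabs_left in Ha by exact Ha0.
  assert (Te : forall k x, (k <= 3)%nat -> 0 <= x <= 1 -> Derive_n eta1 k x = jet k x eta).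
  { apply (extension_derivatives Je eta1 (fun k x => jet k x eta) 0 1); [lra | exact Ce |].
    intros x Hx; destruct (Se x (proj2 (S1 x) Hx)) as [h1 h2]; split; [exact h1 |]; split; [exact h2 |].
    apply jet_tower; auto. }
  assert (Tx : forall k x, (k <= 3)%nat -> a <= x <= 0 -> Derive_n xi1 k x = jet k x xi).
  { apply (extension_derivatives Jx xi1 (fun k x => jet k x xi) a 0); [lra | exact Cx |].
    intros x Hx; destruct (Sx x (proj2 (S2 x) Hx)) as [h1 h2]; split; [exact h1 |]; split; [exact h2 |].
    apply jet_tower; auto. }
  change (Derive_n eta1 1 0 = 0) in d1; change (Derive_n xi1 1 0 = 0) in d1'.
  rewrite Te in d1, d2, d3 by (lia || lra); rewrite Tx in d1', d2', d3' by (lia || lra).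
  (* Monotonicity gives derivatives that are at least [0]; strictness comes at the end from the
     non-vanishing clauses [Ne] and [Nx]. *)
  assert (Pe0 : forall x, 0 <= x <= 1 -> 0 <= jet 1 x eta).
  { intros x Hx; apply (derive_within_increasing (fun x => jet 0 x eta) 0 1 x); [lra | exact Hx | |].
    - intros y z Hy Hz; apply Ieta; apply S1; assumption.
    - apply jet_derivative; auto. }
  assert (Px0 : forall x, a <= x <= 0 -> 0 <= jet 1 x xi).
  { intros x Hx; apply (derive_within_increasing (fun x => jet 0 x xi) a 0 x); [lra | exact Hx | |].
    - intros y z Hy Hz; apply Ixi; apply S2; assumption.
    - apply jet_derivative; auto. }
  assert (Je0 : Je 0) by (apply Se, S1; lra); assert (Jx0 : Jx 0) by (apply Sx, S2; lra).
  assert (Je1 : Je 1) by (apply Se, S1; lra); assert (Jxa : Jx a) by (apply Sx, S2; lra).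
  assert (E00 : eta1 0 = a) by (apply Se, S1; lra); assert (X00 : xi1 0 = 1) by (rewrite <- x0; apply Sx, S2; lra).
  assert (E01 : eta1 1 = jet 0 1 eta) by (apply Se, S1; lra); assert (X0a : xi1 a = jet 0 a xi) by (apply Sx, S2; lra).
  assert (TTe : forall x, Je x -> tower_at (fun k => Derive_n eta1 k) x) by (intros x Hx; now apply (C_r_tower Je)).
  assert (TTx : forall x, Jx x -> tower_at (fun k => Derive_n xi1 k) x) by (intros x Hx; now apply (C_r_tower Jx)).
  assert (Hnear : locally 0 (fun x => (Je x /\ Jx x) /\ (Je (xi1 x) /\ Jx (eta1 x)))).
  { apply filter_and; [apply filter_and; apply open_interval_locally; assumption |]; apply filter_and.
    - assert (Hc : continuous xi1 0) by (apply (tower_at_continuous _ 0 0 (TTx 0 Jx0)); lia).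
      apply (Hc Je); rewrite X00; apply open_interval_locally; assumption.
    - assert (Hc : continuous eta1 0) by (apply (tower_at_continuous _ 0 0 (TTe 0 Je0)); lia).
      apply (Hc Jx); rewrite E00; apply open_interval_locally; assumption. }
  destruct Hnear as [d Hd].
  assert (Hd' : forall x, - d < x < d -> (Je x /\ Jx x) /\ (Je (xi1 x) /\ Jx (eta1 x))).
  { intros x Hx; apply Hd; change (Rabs (x - 0) < d); apply Rabs_lt_between; lra. }
  assert (Hd0 := cond_pos d).
  set (J := fun x => - d < x < d).
  assert (OJ : Defs.open_interval J) by (exists (- d), d; intros x; reflexivity).
  set (A := tower_comp (fun k => Derive_n eta1 k) (fun k => Derive_n xi1 k)).
  set (B := tower_comp (fun k => Derive_n xi1 k) (fun k => Derive_n eta1 k)).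
  assert (TA : forall x, J x -> tower_at A x).
  { intros x Hx; apply tower_comp_at; [apply TTx, (Hd' x Hx) | apply TTe, (Hd' x Hx)]. }
  assert (TB : forall x, J x -> tower_at B x).
  { intros x Hx; apply tower_comp_at; [apply TTe, (Hd' x Hx) | apply TTx, (Hd' x Hx)]. }
  assert (EAB : forall x, J x -> A 0%nat x = B 0%nat x).
  { intros x Hx; destruct (Hd' x Hx) as [[h1 h2] [h3 h4]]; apply (Hcom x); assumption. }
  assert (J0 : J 0) by (unfold J; lra).
  (* The extensions commute on a whole neighbourhood of [0], so the third derivatives of the
     composites agree; once the first and second derivatives are set to zero, only the last term of
     the chain rule survives. *)
  assert (E3 : A 3%nat 0 = B 3%nat 0).
  { rewrite <- (tower_Derive_n J A 3 OJ TA), <- (tower_Derive_n J B 3 OJ TB) by (lia || exact J0).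
    apply Derive_n_ext_loc; generalize (open_interval_locally J 0 OJ J0); apply filter_imp, EAB. }
  unfold A, B, tower_comp in E3.
  change (Derive_n xi1 0 0) with (xi1 0) in E3; change (Derive_n eta1 0 0) with (eta1 0) in E3.
  rewrite X00, E00, !Te, !Tx, d1, d2, d1', d2' in E3 by (lia || lra).
  assert (E0 := EAB 0 J0); change (eta1 (xi1 0) = xi1 (eta1 0)) in E0; rewrite X00, E00, E01, X0a in E0.
  split.
  - unfold pair_equations, jet_fst, jet_snd; cbv zeta; fold eta xi; fold a; repeat split; try assumption; lra.
  - assert (Hx' := proj1 (S1 _) Hxia).
    unfold pair_open, jet_fst, jet_snd; cbv zeta; fold eta xi; fold a.
    split; [lra |]; split; [exact HE' |]; split; [lra |]; split; [| split; [| split]].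
    + intros x Hx; assert (h := Ne x (proj2 (S1 x) ltac:(lra)) ltac:(lra)).
      change (Derive_n eta1 1 x <> 0) in h; rewrite Te in h by (lia || lra).
      specialize (Pe0 x ltac:(lra)); lra.
    + destruct (RtoC_open D 0 HD) as [r [Hr Hb]]; [apply D01; lra |].
      apply (increasing_third_derivative (fun k x => jet k x eta) r 1); auto; try lra.
      * intros x Hx; apply jet_tower; [exact HD | apply Hb; rewrite Rminus_0_r; exact Hx].
      * intros t Ht; apply Pe0; lra.
    + intros x Hx; assert (h := Nx x (proj2 (S2 x) ltac:(lra)) ltac:(lra)).
      change (Derive_n xi1 1 x <> 0) in h; rewrite Tx in h by (lia || lra).
      specialize (Px0 x ltac:(lra)); lra.
    + destruct (RtoC_open E 0 HE) as [r [Hr Hb]]; [apply HE'; lra |].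
      apply (increasing_third_derivative (fun k x => jet k x xi) r a); auto; try lra.
      * intros x Hx; apply jet_tower; [exact HE | apply Hb; rewrite Rminus_0_r; exact Hx].
      * intros t Ht; apply Px0; nra.
Qed.

(** * Stability of the inequalities *)

Lemma jet_minus {W : C -> Prop} (n : nat) (x : R) (f g : real_slice W) :
  open W -> W (RtoC x) -> jet n x (minus f g) = jet n x f - jet n x g.
Proof.
  intros HW Hx; change (jet n x (plus f (scal (-1) g)) = jet n x f - jet n x g).
  rewrite jet_plus, jet_scal by assumption; ring.
Qed.

Lemma jet_bound_segment (W : C -> Prop) (n : nat) (u v : R) :
  open W -> (forall x, u <= x <= v -> W (RtoC x)) ->
  exists K, 0 <= K /\ forall (f : slice_NormedModule W) x, u <= x <= v -> Rabs (jet n x f) <= K * norm f.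
Proof.
  intros HW H; destruct (segment_radius W u v HW H) as [r [Hr Hb]].
  destruct (jet_bound n r Hr) as [K [HK Hjet]]; exists K; split; [exact HK |].
  intros f x Hx; apply Hjet, Hb, Hx.
Qed.

Lemma jet_close {W : C -> Prop} (n : nat) (u v : R) (f : slice_NormedModule W) (e : R) :
  open W -> (forall x, u <= x <= v -> W (RtoC x)) -> 0 < e ->
  exists eps, 0 < eps /\ forall g : slice_NormedModule W, norm (minus g f) < eps ->
    forall x, u <= x <= v -> Rabs (jet n x g - jet n x f) < e.
Proof.
  intros HW H He; destruct (jet_bound_segment W n u v HW H) as [K [HK Hjet]].
  choose_below d [e / 2 / (K + 1)]; exists d; split; [assumption |]; intros g Hg x Hx.
  rewrite <- jet_minus by auto.
  eapply Rle_lt_trans; [apply (Hjet (minus g f) x Hx) |].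
  assert (h := small_mult K _ (e / 2) HK (norm_ge_0 (minus g f)) ltac:(lra)); lra.
Qed.

Lemma jet_positive_stable {W : C -> Prop} (n : nat) (u v : R) (f : slice_NormedModule W) :
  open W -> u <= v -> (forall x, u <= x <= v -> W (RtoC x)) -> (forall x, u <= x <= v -> 0 < jet n x f) ->
  exists eps, 0 < eps /\ forall g : slice_NormedModule W, norm (minus g f) < eps ->
    forall x, u <= x <= v -> 0 < jet n x g.
Proof.
  intros HW Huv H Hp.
  destruct (continuity_ab_min (fun x => jet n x f) u v Huv) as [x0 [Hmin Hx0]].
  { intros x Hx; apply continuity_pt_filterlim.
    apply (ex_derive_continuous (K := R_AbsRing) (V := R_NormedModule) (fun y => jet n y f)).
    eexists; apply jet_derivative; auto. }
  destruct (jet_close n u v f (jet n x0 f) HW H (Hp x0 Hx0)) as [eps [He Hc]].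
  exists eps; split; [exact He |]; intros g Hg x Hx; specialize (Hc g Hg x Hx); specialize (Hmin x Hx).
  apply Rabs_lt_between in Hc; cbv beta in Hmin; lra.
Qed.

(** Near [0] the third derivative stays positive, and away from [0] compactness applies to the
    first. The margin [d] is there because the interval [[eta 0, 0]] changes with the pair. *)
Lemma critical_positive_stable {W : C -> Prop} (u v : R) (f : slice_NormedModule W) :
  open W -> u <= 0 <= v -> (forall x, u <= x <= v -> W (RtoC x)) ->
  jet 1 0 f = 0 -> jet 2 0 f = 0 -> 0 < jet 3 0 f -> (forall x, u <= x <= v -> x <> 0 -> 0 < jet 1 x f) ->
  exists eps d, 0 < eps /\ 0 < d /\ forall g : slice_NormedModule W, norm (minus g f) < eps ->
    jet 1 0 g = 0 -> jet 2 0 g = 0 ->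
    0 < jet 3 0 g /\ forall x, u - d <= x <= v + d -> x <> 0 -> 0 < jet 1 x g.
Proof.
  intros HW Huv H J1 J2 J3 Hp.
  destruct (segment_interior W u v HW ltac:(lra) H) as [r [Hr Hb]].
  destruct (tower_positive_margin (fun k x => jet k x f) u v r) as [d1 [Hd1 Hd]]; auto.
  { intros x Hx; apply jet_tower; auto. }
  destruct (positive_near (fun x => jet 3 x f) 0) as [r3 [Hr3 H3]]; [| exact J3 |].
  { apply (jet_tower f 0 HW); apply H; lra. }
  choose_below d0 [d1 / 2; r / 2].
  choose_below rho [r3 / 2; d0].
  destruct (jet_positive_stable 3 (- rho) rho f) as [s1 [Hs1 K1]]; auto; try lra.
  { intros x Hx; apply Hb; lra. }
  { intros x Hx; apply H3; rewrite Rminus_0_r; apply Rabs_lt_between; lra. }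
  destruct (jet_positive_stable 1 (u - d0) (- rho) f) as [s2 [Hs2 K2]]; auto; try lra.
  { intros x Hx; apply Hb; lra. } { intros x Hx; apply (Hd x); lra. }
  destruct (jet_positive_stable 1 rho (v + d0) f) as [s3 [Hs3 K3]]; auto; try lra.
  { intros x Hx; apply Hb; lra. } { intros x Hx; apply (Hd x); lra. }
  choose_below s [s1; s2; s3]; exists s, d0; split; [assumption |]; split; [assumption |].
  intros g Hg G1 G2.
  assert (g1 : norm (minus g f) < s1) by lra; assert (g2 : norm (minus g f) < s2) by lra; assert (g3 : norm (minus g f) < s3) by lra.
  split; [apply (K1 g g1); lra |]; intros x Hx Hx0.
  destruct (Rle_dec x (- rho)) as [h1 | h1]; [apply (K2 g g2); lra |].
  destruct (Rle_dec rho x) as [h2 | h2]; [apply (K3 g g3); lra |].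
  apply (tower_critical_positive (fun k x => jet k x g) rho); auto.
  - intros y Hy; apply Rabs_lt_between in Hy; apply jet_tower; [exact HW | apply Hb; lra].
  - intros y Hy; apply Rabs_lt_between in Hy; apply (K1 g g1); lra.
  - apply Rabs_lt_between; lra.
Qed.

Lemma pair_open_stable (C0 : R) (D E : C -> Prop) (p : pair_space D E) :
  1 < C0 -> open D -> open E -> (forall x, 0 <= x <= 1 -> D (RtoC x)) ->
  pair_equations p -> pair_open C0 p ->
  exists eps, 0 < eps /\ forall q : pair_space D E, pair_equations q -> norm (minus q p) < eps -> pair_open C0 q.
Proof.
  intros HC HD HE D01 [e1 [e2 [x0 [x1 [x2 [_ _]]]]]] [Ha [HEa [Hxa [Pe [e3 [Px x3]]]]]].
  unfold jet_fst, jet_snd in *; set (eta := fst p : slice_NormedModule D) in *; set (xi := snd p : slice_NormedModule E) in *.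
  set (a := jet 0 0 eta) in *.
  assert (HCi : 0 < / (2 * C0)) by (apply Rinv_0_lt_compat; lra).
  destruct (critical_positive_stable 0 1 eta) as [s1 [dd1 [Hs1 [Hdd1 K1]]]]; auto; try lra.
  { intros x Hx Hx0; apply Pe; lra. }
  destruct (critical_positive_stable a 0 xi) as [s2 [dd2 [Hs2 [Hdd2 K2]]]]; auto; try lra.
  { intros x Hx Hx0; apply Px; lra. }
  destruct (segment_interior E a 0 HE ltac:(lra) HEa) as [r [Hr Hb]].
  destruct (positive_near (fun x => jet 0 x xi) a) as [r0 [Hr0 H0]]; [| exact Hxa |].
  { apply (tower_at_continuous _ a 0 (jet_tower xi a HE ltac:(apply HEa; lra))); lia. }
  choose_below rho [r0 / 2; r / 2].
  assert (Hseg : forall x, a - rho <= x <= a + rho -> E (RtoC x)) by (intros x Hx; apply Hb; lra).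
  destruct (jet_positive_stable 0 (a - rho) (a + rho) xi) as [s3 [Hs3 K3]]; auto; try lra.
  { intros x Hx; apply H0, Rabs_lt_between; lra. }
  (* [w] bounds the displacement of [a]: within [rho] the value of [xi] stays positive and the
     segment stays in [E], [dd2] is the margin for the derivative of [xi], and the other entries are
     the distances of [a] to its two bounds. *)
  choose_below w [rho; dd2; a + 2 * C0; - / (2 * C0) - a].
  destruct (jet_close 0 0 0 eta w) as [s4 [Hs4 K4]]; auto.
  { intros x Hx; apply D01; lra. }
  choose_below s [s1; s2; s3; s4]; exists s; split; [assumption |].
  intros q [qe1 [qe2 [qx0 [qx1 [qx2 _]]]]] Hq.
  assert (N1 : norm (minus (fst q : slice_NormedModule D) eta) <= norm (minus q p)) by apply (norm_fst_le (minus q p)).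
  assert (N2 : norm (minus (snd q : slice_NormedModule E) xi) <= norm (minus q p)) by apply (norm_snd_le (minus q p)).
  destruct (K1 (fst q)) as [k1 k1']; auto; [lra |].
  destruct (K2 (snd q)) as [k2 k2']; auto; [lra |].
  assert (k4 := K4 (fst q) ltac:(lra) 0 ltac:(lra)).
  fold a in k4; apply Rabs_lt_between in k4.
  unfold pair_open, jet_fst, jet_snd; cbv zeta; set (b := jet 0 0 (fst q : real_slice D)) in *.
  change (jet 0 0 (fst q)) with b in k4.
  split; [lra |]; split; [intros x Hx; apply Hb; lra |]; split; [apply K3; lra |].
  split; [intros x Hx; apply k1'; lra |]; split; [exact k1 |]; split; [intros x Hx; apply k2'; lra | exact k2].
Qed.

(** * Jets as bounded functionals, and interpolation *)

Lemma jet_fst_bounded_linear {D E : C -> Prop} (n : nat) (x : R) :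
  open D -> D (RtoC x) -> bounded_linear (jet_fst n x : pair_space D E -> R).
Proof.
  intros HD Hx; split; [| split].
  - intros p q; apply (jet_plus n x (fst p) (fst q)); assumption.
  - intros a p; apply (jet_scal n x a (fst p)); assumption.
  - destruct (jet_bound_segment D n x x HD) as [K [HK H]].
    { intros y Hy; replace y with x by lra; exact Hx. }
    exists K; split; [exact HK |]; intros p; eapply Rle_trans; [apply H; lra |].
    apply Rmult_le_compat_l; [exact HK | apply (norm_fst_le p)].
Qed.

Lemma jet_snd_bounded_linear {D E : C -> Prop} (n : nat) (x : R) :
  open E -> E (RtoC x) -> bounded_linear (jet_snd n x : pair_space D E -> R).
Proof.
  intros HE Hx; split; [| split].
  - intros p q; apply (jet_plus n x (snd p) (snd q)); assumption.
  - intros a p; apply (jet_scal n x a (snd p)); assumption.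
  - destruct (jet_bound_segment E n x x HE) as [K [HK H]].
    { intros y Hy; replace y with x by lra; exact Hx. }
    exists K; split; [exact HK |]; intros p; eapply Rle_trans; [apply H; lra |].
    apply Rmult_le_compat_l; [exact HK | apply (norm_snd_le p)].
Qed.

(** The coordinate [z] may be unbounded on [D], and constants are real-symmetric on [D] only if [D] is
    symmetric: [e1] and [e2] are taken in the span of [g = f (f - f 0)^2] and [g f], without these. *)
Lemma interpolating_functions {D : C -> Prop} (f : real_slice D) :
  open D -> D (RtoC 0) -> D (RtoC 1) -> jet 1 0 f = 0 -> jet 2 0 f = 0 ->
  jet 0 1 f <> 0 -> jet 0 1 f <> jet 0 0 f -> jet 1 1 f <> 0 ->
  exists e1 e2 : real_slice D,
    (forall k, (k <= 3)%nat -> jet k 0 e1 = 0 /\ jet k 0 e2 = 0) /\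
    jet 0 1 e1 = 1 /\ jet 1 1 e1 = 0 /\ jet 0 1 e2 = 0 /\ jet 1 1 e2 = 1.
Proof.
  intros HD D0 D1 F1 F2 Hb Hba Hf1.
  set (a := jet 0 0 f) in *; set (b := jet 0 1 f) in *.
  (* [h] is [f (f - a)] and [g] is [h (f - a)], with scalar multiples in place of the constant [a].
     As [f - a] vanishes to order three at [0], [g] vanishes to order six there. *)
  set (h := plus (slice_mult f f) (scal (- a) f)).
  set (g := plus (slice_mult h f) (scal (- a) h)).
  set (u := slice_mult g f).
  assert (Hh0 : jet 0 0 h = 0 /\ jet 1 0 h = 0 /\ jet 2 0 h = 0).
  { unfold h; rewrite !jet_plus, !jet_scal, jet_mult_0, jet_mult_1, jet_mult_2, F1, F2 by assumption.
    fold a; repeat split; ring. }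
  assert (Hh3 : jet 3 0 h = a * jet 3 0 f).
  { unfold h; rewrite jet_plus, jet_scal, jet_mult_3, F1, F2 by assumption; fold a; ring. }
  destruct Hh0 as [h0 [h1 h2]].
  assert (Hg : forall k, (k <= 3)%nat -> jet k 0 g = 0).
  { intros k Hk; unfold g; rewrite jet_plus, jet_scal by assumption.
    destruct k as [| [| [| [| k]]]]; try lia.
    - rewrite jet_mult_0, h0 by assumption; ring.
    - rewrite jet_mult_1, h0, h1 by assumption; ring.
    - rewrite jet_mult_2, h0, h1, h2 by assumption; ring.
    - rewrite jet_mult_3, h0, h1, h2, Hh3 by assumption; fold a; ring. }
  assert (Hu : forall k, (k <= 3)%nat -> jet k 0 u = 0).
  { intros k Hk; unfold u; destruct k as [| [| [| [| k]]]]; try lia.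
    - rewrite jet_mult_0, (Hg 0%nat) by (assumption || lia); ring.
    - rewrite jet_mult_1, (Hg 0%nat), (Hg 1%nat) by (assumption || lia); ring.
    - rewrite jet_mult_2, (Hg 0%nat), (Hg 1%nat), (Hg 2%nat) by (assumption || lia); ring.
    - rewrite jet_mult_3, (Hg 0%nat), (Hg 1%nat), (Hg 2%nat), (Hg 3%nat) by (assumption || lia); ring. }
  set (c := jet 0 1 g); set (c' := jet 1 1 g).
  assert (Hc : c = b * ((b - a) * (b - a))).
  { unfold c, g, h; rewrite !jet_plus, !jet_scal, !jet_mult_0, !jet_plus, !jet_scal, !jet_mult_0 by assumption; fold b; ring. }
  assert (Hc0 : c <> 0) by (rewrite Hc; repeat apply Rmult_integral_contrapositive_currified; lra).
  assert (U0 : jet 0 1 u = c * b) by (unfold u; rewrite jet_mult_0 by assumption; reflexivity).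
  assert (U1 : jet 1 1 u = c' * b + c * jet 1 1 f) by (unfold u; rewrite jet_mult_1 by assumption; reflexivity).
  (* [w] is [g (f - b)]: its value at [1] is [0] and its derivative there is [c * f' 1]. Subtracting
     a multiple of [e2] then corrects the derivative of [g / c] at [1]. *)
  set (w := plus u (scal (- b) g)).
  set (e2 := scal (/ (c * jet 1 1 f)) w).
  set (v := scal (/ c) g : real_slice D).
  set (e1 := plus v (scal (- (c' / c)) e2)).
  assert (E20 : jet 0 1 e2 = 0).
  { unfold e2; rewrite jet_scal by assumption; unfold w; rewrite jet_plus, jet_scal, U0 by assumption; fold c; ring. }
  assert (E21 : jet 1 1 e2 = 1).
  { unfold e2; rewrite jet_scal by assumption; unfold w; rewrite jet_plus, jet_scal, U1 by assumption; fold c'; field; split; assumption. }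
  exists e1, e2; split; [| split; [| split; [| split]]]; auto.
  - intros k Hk.
    assert (E2k : jet k 0 e2 = 0) by (unfold e2; rewrite jet_scal by assumption; unfold w; rewrite jet_plus, jet_scal, Hu, Hg by assumption; ring).
    split; [| exact E2k]; unfold e1; rewrite jet_plus by assumption; unfold v; rewrite !jet_scal, E2k, Hg by assumption; ring.
  - unfold e1; rewrite jet_plus by assumption; unfold v; rewrite !jet_scal, E20 by assumption; fold c; field; assumption.
  - unfold e1; rewrite jet_plus by assumption; unfold v; rewrite !jet_scal, E21 by assumption; fold c'; field; assumption.
Qed.

(** * Graphs over a linear subspace *)

Lemma open_norm_intro {X : NormedModule R_AbsRing} (O : X -> Prop) :
  (forall y, O y -> exists r, 0 < r /\ forall z, norm (minus z y) < r -> O z) -> open O.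
Proof.
  intros H y Hy; destruct (H y Hy) as [r [Hr Hz]].
  assert (Hf := norm_factor_gt_0 (V := X)).
  assert (Hp : 0 < r / @norm_factor _ X) by (apply Rdiv_lt_0_compat; lra).
  exists (mkposreal _ Hp); intros z Hb; apply Hz.
  eapply Rlt_le_trans; [apply (norm_compat2 _ _ _ Hb) |]; simpl; right; field; lra.
Qed.

Lemma plus_minus_r {X : NormedModule R_AbsRing} (x z : X) : plus x (minus z x) = z.
Proof.
  unfold minus; rewrite (plus_comm z), plus_assoc.
  etransitivity; [| apply plus_zero_l]; f_equal; apply (plus_opp_r (G := NormedModule.AbelianGroup R_AbsRing X)).
Qed.

Lemma smooth_continuous {X Y : NormedModule R_AbsRing} (V : X -> Prop) (f : X -> Y) (x : X) (eps : R) :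
  smooth V f -> V x -> 0 < eps ->
  exists del, 0 < del /\ forall z, V z -> norm (minus z x) < del -> norm (minus (f z) (f x)) < eps.
Proof.
  intros [d [H1 [_ [H3 H4]]]] Hx He.
  destruct (H3 x 1%nat Hx) as [M HM].
  destruct (H4 x 0%nat (mkposreal 1 Rlt_0_1) Hx) as [d0 Hd0].
  assert (HM0 := Rabs_pos M); assert (HM1 := Rle_abs M).
  choose_below r [pos d0; eps / 2 / (Rabs M + 1 + 1)]; exists r; split; [assumption |].
  intros z Hz Hn.
  assert (Hh' : exists h : X, h = minus z x) by (eexists; reflexivity).
  destruct Hh' as [h Eh]; rewrite <- Eh in Hn.
  assert (Ez : plus x h = z) by (rewrite Eh; apply plus_minus_r).
  assert (K := Hd0 h [] I); rewrite Ez in K; specialize (K Hz ltac:(lra) eq_refl (Forall_True [])).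
  rewrite !H1 in K by assumption; simpl in K.
  assert (B := HM [h] eq_refl (Forall_True [h])); simpl in B.
  assert (Hh := norm_ge_0 h).
  assert (T : norm (minus (f z) (f x)) <= norm (minus (minus (f z) (f x)) (d x [h])) + norm (d x [h])).
  { rewrite <- (plus_minus_r (d x [h]) (minus (f z) (f x))) at 1; rewrite plus_comm; apply norm_triangle. }
  assert (n2 := small_mult (Rabs M + 1) (norm h) (eps / 2) ltac:(lra) Hh ltac:(lra)).
  assert (Q : M * norm h <= Rabs M * norm h) by (apply Rmult_le_compat_r; assumption).
  lra.
Qed.

Lemma smooth_continuous_on {X Y : NormedModule R_AbsRing} (V : X -> Prop) (f : X -> Y) :
  smooth V f -> continuous_on V f.
Proof.
  intros Hf x Hx; apply filterlim_locally; intros eps.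
  destruct (smooth_continuous V f x eps Hf Hx (cond_pos eps)) as [del [Hdel H]].
  assert (Hn := norm_factor_gt_0 (V := X)).
  assert (Hp : 0 < del / @norm_factor _ X) by (apply Rdiv_lt_0_compat; lra).
  exists (mkposreal _ Hp); intros z Hb Vz; apply norm_compat1, H; [exact Vz |].
  eapply Rlt_le_trans; [apply (norm_compat2 _ _ _ Hb) |]; simpl; right; field; lra.
Qed.

Lemma smooth_linear {X : NormedModule R_AbsRing} (V : X -> Prop) (L : X -> R) (c b : R) :
  bounded_linear L -> smooth V (fun x => c * L x + b : R_NormedModule).
Proof.
  intros [HP [HS [K [HK HL]]]].
  apply (smooth_affine (Y := R_NormedModule) V (fun x => c * L x) b (Rabs c * K)).
  - intros x y; rewrite HP; exact (Rmult_plus_distr_l c (L x) (L y)).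
  - intros a x; rewrite HS; change (c * (a * L x) = a * (c * L x)); ring.
  - assert (h := Rabs_pos c); nra.
  - intros x; rewrite norm_R, Rabs_mult, Rmult_assoc; apply Rmult_le_compat_l; [apply Rabs_pos | apply HL].
Qed.

Lemma smooth_id {X : NormedModule R_AbsRing} (V : X -> Prop) (b : X) : smooth V (fun x : X => plus x b).
Proof.
  apply (smooth_affine V (fun x => x) b 1); auto; [lra |]; intros x; lra.
Qed.

Lemma plus_cancel_r {X : NormedModule R_AbsRing} (a b b' : X) : plus b b' = zero -> plus (plus a b) b' = a.
Proof. intros H; rewrite <- plus_assoc, H; apply plus_zero_r. Qed.

Lemma scal_cancel {X : NormedModule R_AbsRing} (s s' : R) (x : X) : s + s' = 0 -> plus (scal s x) (scal s' x) = zero.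
Proof.
  intros H; etransitivity; [symmetry; apply (scal_distr_r (K := R_Ring) (V := NormedModule.ModuleSpace R_AbsRing X)) |].
  change (plus s s') with (s + s'); rewrite H.
  apply (scal_zero_l (K := R_Ring) (V := NormedModule.ModuleSpace R_AbsRing X)).
Qed.

Lemma scal_pair_cancel {X : NormedModule R_AbsRing} (s s' t t' : R) (x y : X) : s + s' = 0 -> t + t' = 0 ->
  plus (plus (scal s x) (scal t y)) (plus (scal s' x) (scal t' y)) = zero.
Proof.
  intros Hs Ht; rewrite (plus_comm (scal s' x)), plus_assoc, <- (plus_assoc (scal s x)), (scal_cancel t t' y Ht).
  rewrite plus_zero_r; apply scal_cancel, Hs.
Qed.

(** [M] is a graph over the linear subspace [F]: the functionals [l1], [l2] vanish on [F], [e1], [e2] is a dual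
    system, and a point of [M] is determined by its projection to [F] along [e1], [e2], translated by that of [p0]. *)
Lemma graph_atlas {X : NormedModule R_AbsRing} (M F : X -> Prop) (l1 l2 : X -> R) (p0 e1 e2 : X)
  (phi1 phi2 : X -> R_NormedModule) (V : X -> Prop) :
  let T := fun x => plus x (plus (scal (- l1 x) e1) (scal (- l2 x) e2)) in
  let chart := fun x => plus (T x) (scal (-1) (T p0)) in
  let param := fun y => plus (plus y (T p0)) (plus (scal (phi1 y : R) e1) (scal (phi2 y : R) e2)) in
  bounded_linear l1 -> bounded_linear l2 ->
  l1 e1 = 1 -> l1 e2 = 0 -> l2 e1 = 0 -> l2 e2 = 1 ->
  (forall y, F y -> l1 y = 0 /\ l2 y = 0) ->
  (forall x, M x -> F (chart x) /\ phi1 (chart x) = l1 x /\ phi2 (chart x) = l2 x) ->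
  smooth V phi1 -> smooth V phi2 ->
  (forall y, F y -> M (param y) -> V y /\ exists del, 0 < del /\ forall z, norm (minus z y) < del -> V z) ->
  (forall y, F y -> M (param y) -> exists eps, 0 < eps /\
     forall z, F z -> V z -> norm (minus (param z) (param y)) < eps -> M (param z)) ->
  exists A, smooth_atlas M F A /\ induced_structure F A.
Proof.
  intros T chart param HL1 HL2 h11 h12 h21 h22 HF HM S1 S2 HV HO.
  set (N := fun y => F y /\ M (param y)).
  assert (Sparam : smooth V param).
  { apply (smooth_plus V (fun y => plus y (T p0))); [apply smooth_id |].
    apply (smooth_plus V (fun y => scal (phi1 y : R) e1)); apply smooth_scal; assumption. }
  assert (SparamN : forall S, smooth_on S N param).
  { intros S; apply (smooth_on_sub S V N _ _) with (3 := Sparam); [| reflexivity].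
    intros y [h1 h2]; apply (HV y h1 h2). }
  assert (Schart : forall S W, smooth_on S W chart).
  { intros S W; apply (smooth_on_sub S W W (fun x => plus (plus x (plus (scal (-1 * l1 x + 0) e1) (scal (-1 * l2 x + 0) e2))) (scal (-1) (T p0)))).
    - auto.
    - intros x _; unfold chart, T; do 3 f_equal; f_equal; ring.
    - apply (smooth_plus W (fun x => plus x _) (fun _ => scal (-1) (T p0))).
      + apply (smooth_plus W (fun x => x)).
        * apply (smooth_on_sub _ W W (fun x => plus x zero)); [auto | intros x _; apply plus_zero_r | apply smooth_id].
        * apply (smooth_plus W (fun x => scal (-1 * l1 x + 0) e1)); apply (smooth_scal W); apply smooth_linear; assumption.
      + apply (smooth_on_sub _ W W (fun x : X => plus zero (scal (-1) (T p0)))); [auto | intros x _; apply plus_zero_l |].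
        apply (smooth_affine W (fun _ => zero) (scal (-1) (T p0)) 0); try lra.
        * intros x y; symmetry; apply plus_zero_l.
        * intros a x; symmetry; apply (scal_zero_r (K := R_Ring) (V := NormedModule.ModuleSpace R_AbsRing X)).
        * intros x; rewrite norm_zero; lra. }
  assert (HT0 : forall x, l1 (T x) = 0 /\ l2 (T x) = 0).
  { intros x; unfold T; destruct HL1 as [a1 [b1 _]], HL2 as [a2 [b2 _]].
    rewrite !a1, !a2, !b1, !b2, h11, h12, h21, h22; split; ring. }
  assert (Hparam_l : forall y, F y -> l1 (param y) = phi1 y /\ l2 (param y) = phi2 y).
  { intros y Hy; destruct (HF y Hy) as [y1 y2], (HT0 p0) as [t1 t2]; unfold param.
    destruct HL1 as [a1 [b1 _]], HL2 as [a2 [b2 _]].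
    rewrite !a1, !a2, !b1, !b2, h11, h12, h21, h22, y1, y2, t1, t2; split; ring. }
  assert (Hpc : forall x, M x -> param (chart x) = x).
  { intros x Hx; destruct (HM x Hx) as [_ [E1 E2]]; unfold param; rewrite E1, E2.
    unfold chart; rewrite (plus_cancel_r (T x)).
    - unfold T; apply plus_cancel_r, scal_pair_cancel; ring.
    - etransitivity; [| apply (scal_cancel (-1) 1 (T p0)); ring].
      f_equal; symmetry; apply (scal_one (V := NormedModule.ModuleSpace R_AbsRing X)). }
  assert (Hcp : forall y, F y -> chart (param y) = y).
  { intros y Hy; destruct (Hparam_l y Hy) as [E1 E2]; unfold chart, T at 1; rewrite E1, E2.
    unfold param; rewrite (plus_cancel_r (plus y (T p0))) by (apply scal_pair_cancel; ring).
    apply plus_cancel_r; etransitivity; [| apply (scal_cancel 1 (-1) (T p0)); ring].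
    f_equal; symmetry; apply (scal_one (V := NormedModule.ModuleSpace R_AbsRing X)). }
  assert (HMN : forall x, M x -> N (chart x)).
  { intros x Hx; split; [apply HM, Hx | rewrite Hpc by exact Hx; exact Hx]. }
  assert (HN_open : forall y, N y -> exists r, 0 < r /\ forall z, F z -> norm (minus z y) < r -> M (param z)).
  { intros y [Fy My]; destruct (HV y Fy My) as [Vy [d1 [Hd1 H1]]].
    destruct (HO y Fy My) as [eps [He H2]].
    destruct (smooth_continuous V param y eps Sparam Vy He) as [d2 [Hd2 H3]].
    choose_below r [d1; d2]; exists r; split; [assumption |]; intros z Fz Hz.
    assert (z1 : norm (minus z y) < d1) by lra; assert (z2 : norm (minus z y) < d2) by lra.
    apply H2; auto. }
  set (c := Chart M N chart param).
  exists (fun c' => c' = c); split.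
  - split; [| split].
    + intros c' ->; split; [| split; [| split; [| split; [| split]]]]; simpl.
      * exists (fun _ => True); split; [intros x _; apply filter_true | tauto].
      (* An open subset of the ambient space that meets [F] in [N]; shrinking the radius by half
         shows that it is open. *)
      * exists (fun y => exists r, 0 < r /\ forall z, F z -> norm (minus z y) < r -> M (param z)); split.
        -- apply open_norm_intro; intros y [r [Hr Hz]]; exists (r / 2); split; [lra |].
           intros w Hw; exists (r / 2); split; [lra |]; intros z Fz Hzw; apply Hz; [exact Fz |].
           rewrite (minus_trans w); eapply Rle_lt_trans; [apply norm_triangle |]; lra.
        -- intros y; split.
           ++ intros Hy; split; [apply Hy | apply HN_open, Hy].
           ++ intros [Fy [r [Hr Hz]]]; split; [exact Fy |]; apply Hz; [exact Fy |].
              rewrite norm_minus_self by reflexivity; exact Hr.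
      * intros x Hx; split; [apply HMN, Hx | apply Hpc, Hx].
      * intros y [Fy My]; split; [exact My | apply Hcp, Fy].
      * apply smooth_continuous_on, Schart.
      * apply smooth_continuous_on, SparamN.
    + intros x Hx; exists c; split; [reflexivity | exact Hx].
    (* There is a single chart, so the only transition map is the identity. *)
    + intros c1 c2 -> ->; simpl.
      apply (smooth_on_sub F (fun _ => True) _ (fun y => plus y zero)); [auto | | apply smooth_id].
      intros y [[Fy _] _]; rewrite plus_zero_r; symmetry; apply Hcp, Fy.
  - intros c' ->; split; [apply SparamN |]; intros x _.
    exists (fun _ => True), chart; split; [intros z _; apply filter_true |]; split; [exact I |].
    split; [apply Schart | reflexivity].
Qed.

(** * The global chart of the space of pairs *)

Lemma bounded_linear_close {X : NormedModule R_AbsRing} (L : X -> R) (y : X) (e : R) :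
  bounded_linear L -> 0 < e -> exists del, 0 < del /\ forall z, norm (minus z y) < del -> Rabs (L z - L y) < e.
Proof.
  intros HL He; destruct HL as [HP [HS [K [HK Hb]]]].
  choose_below d [e / 2 / (K + 1)]; exists d; split; [assumption |]; intros z Hz.
  rewrite <- bounded_linear_minus by (split; [exact HP | split; [exact HS | exists K; auto]]).
  eapply Rle_lt_trans; [apply Hb |].
  assert (h := small_mult K _ (e / 2) HK (norm_ge_0 (minus z y)) ltac:(lra)); lra.
Qed.

(** Among the equations that define the pairs, those for [eta 1] and [eta' 1] are solved for
    these two values; the others are linear. *)
Definition model_functionals {D E : C -> Prop} : list (pair_space D E -> R) :=
  [jet_fst 1 0; jet_fst 2 0; jet_fst 0 1; jet_fst 1 1; jet_snd 0 0; jet_snd 1 0; jet_snd 2 0].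

(** The point [p0] supplies the translation that makes the affine equations linear, and its first
    component supplies the interpolating functions. The graph is global: the inequalities only cut
    out an open part of it. *)
Lemma B_DE_atlas (C0 : R) (D E : C -> Prop) (p0 : pair_space D E) :
  1 < C0 -> open D -> open E -> (forall x, 0 <= x <= 1 -> D (RtoC x)) -> E (RtoC 0) ->
  B_DE C0 D E p0 ->
  exists A, smooth_atlas (B_DE C0 D E) (common_kernel model_functionals) A /\
    induced_structure (common_kernel model_functionals) A.
Proof.
  intros HC HD HE D01 E0 Hp0.
  assert (D0 : D (RtoC 0)) by (apply D01; lra); assert (D1 : D (RtoC 1)) by (apply D01; lra).
  assert (HLf : forall n x, D (RtoC x) -> bounded_linear (jet_fst n x : pair_space D E -> R))
    by (intros; apply jet_fst_bounded_linear; assumption).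
  assert (HLs : forall n x, E (RtoC x) -> bounded_linear (jet_snd n x : pair_space D E -> R))
    by (intros; apply jet_snd_bounded_linear; assumption).
  destruct (B_DE_elim C0 D E p0 HC HD HE D01 Hp0) as [Peq Pop].
  destruct Peq as [e1 [e2 [x0 [x1 [x2 [E01 E13]]]]]].
  destruct Pop as [Ha [HEa [Hxa [Pe [e3 [Px x3]]]]]].
  set (xi0 := snd p0 : real_slice E); set (a0 := jet_fst 0 0 p0) in *.
  (* The hypotheses on values hold because [eta 1 = xi a > 0 > a], the one on the derivative because
     [eta' 1 > 0]. *)
  destruct (interpolating_functions (fst p0 : real_slice D)) as [b1 [b2 [Hb [b101 [b111 [b201 b211]]]]]]; auto.
  { change (jet_fst 0 1 p0 <> 0); lra. }
  { change (jet_fst 0 1 p0 <> a0); assert (HCi : 0 < / (2 * C0)) by (apply Rinv_0_lt_compat; lra); lra. }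
  { apply Rgt_not_eq, Pe; lra. }
  (* Moving along [w1] and [w2] changes neither [xi] nor the 3-jet of [eta] at [0]. So the
     right-hand sides for [eta 1] and [eta' 1] do not depend on the values being solved for. *)
  pose (w1 := (b1, slice_zero E) : pair_space D E); pose (w2 := (b2, slice_zero E) : pair_space D E).
  assert (W1 : forall k, (k <= 3)%nat -> jet_fst k 0 w1 = 0) by (intros k Hk; apply (Hb k Hk)).
  assert (W2 : forall k, (k <= 3)%nat -> jet_fst k 0 w2 = 0) by (intros k Hk; apply (Hb k Hk)).
  pose (al := fun y : pair_space D E => jet_fst 0 0 y + a0).
  pose (phi1 := fun y : pair_space D E => jet 0 (al y) (plus (snd y : real_slice E) xi0) : R_NormedModule).
  (* This is [xi' a * eta''' 0 / xi''' 0], the solution of the last equation for [eta' 1]; the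
     factor [1] gives the shape expected by [smooth_linear]. *)
  pose (phi2 := fun y : pair_space D E => jet 1 (al y) (plus (snd y : real_slice E) xi0)
    * (1 * jet_fst 3 0 y + jet_fst 3 0 p0) * / (jet_snd 3 0 y + jet_snd 3 0 p0) : R_NormedModule).
  (* The region where [phi1] and [phi2] are smooth; it contains every parameter of a pair together
     with a ball. *)
  pose (V := fun y : pair_space D E => E (RtoC (al y)) /\ jet_snd 3 0 y + jet_snd 3 0 p0 <> 0).
  change (jet_fst 0 1 w1 = 1) in b101; change (jet_fst 1 1 w1 = 0) in b111.
  change (jet_fst 0 1 w2 = 0) in b201; change (jet_fst 1 1 w2 = 1) in b211.
  set (l1 := jet_fst 0 1 : pair_space D E -> R); set (l2 := jet_fst 1 1 : pair_space D E -> R).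
  set (T := fun x : pair_space D E => plus x (plus (scal (- l1 x) w1) (scal (- l2 x) w2))).
  set (param := fun y : pair_space D E => plus (plus y (T p0)) (plus (scal (phi1 y : R) w1) (scal (phi2 y : R) w2))).
  set (chart := fun x : pair_space D E => plus (T x) (scal (-1) (T p0))).
  assert (snd_comb : forall (s t : R) (u : pair_space D E),
    (snd (plus u (plus (scal s w1) (scal t w2))) : real_slice E) = snd u).
  { intros s t u; apply slice_ext; intros z; apply C_ext; simpl; ring. }
  assert (snd_param : forall y, (snd (param y) : real_slice E) = plus (snd y : real_slice E) xi0).
  { intros y; etransitivity; [apply snd_comb |].
    change (plus (snd y : real_slice E) (snd (T p0) : real_slice E) = plus (snd y : real_slice E) xi0).
    f_equal; apply snd_comb. }
  assert (snd_chart : forall x, plus (snd (chart x) : real_slice E) xi0 = (snd x : real_slice E)).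
  { intros x; change (plus (plus (snd (T x) : real_slice E) (scal (-1) (snd (T p0) : real_slice E))) xi0 = (snd x : real_slice E)).
    rewrite (snd_comb _ _ x : snd (T x) = _), (snd_comb _ _ p0 : snd (T p0) = _); fold xi0.
    apply slice_ext; intros z; apply C_ext; simpl; ring. }
  assert (T0 : forall k x, (k <= 3)%nat -> jet_fst k 0 (T x) = jet_fst k 0 x).
  { intros k x Hk; unfold T; destruct (HLf k 0 D0) as [hp [hs _]].
    rewrite !hp, !hs, W1, W2 by exact Hk; ring. }
  assert (T1 : forall x, jet_fst 0 1 (T x) = 0).
  { intros x; unfold T; destruct (HLf 0%nat 1 D1) as [hp [hs _]]; rewrite !hp, !hs, b101, b201; unfold l1; ring. }
  assert (T1' : forall x, jet_fst 1 1 (T x) = 0).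
  { intros x; unfold T; destruct (HLf 1%nat 1 D1) as [hp [hs _]]; rewrite !hp, !hs, b111, b211; unfold l2; ring. }
  assert (chart0 : forall k x, (k <= 3)%nat -> jet_fst k 0 (chart x) = jet_fst k 0 x - jet_fst k 0 p0).
  { intros k x Hk; unfold chart; destruct (HLf k 0 D0) as [hp [hs _]]; rewrite hp, hs, !T0 by exact Hk; ring. }
  assert (param0 : forall k y, (k <= 3)%nat -> jet_fst k 0 (param y) = jet_fst k 0 y + jet_fst k 0 p0).
  { intros k y Hk; unfold param; destruct (HLf k 0 D0) as [hp [hs _]]; rewrite !hp, !hs, T0, W1, W2 by exact Hk; ring. }
  assert (chart_snd : forall k x, jet_snd k 0 (chart x) = jet_snd k 0 x - jet_snd k 0 p0).
  { intros k x; assert (h := jet_plus k 0 (snd (chart x)) xi0 HE E0); rewrite snd_chart in h.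
    unfold jet_snd; fold xi0; lra. }
  assert (param_snd : forall k x y, E (RtoC x) -> jet_snd k x (param y) = jet_snd k x y + jet_snd k x p0).
  { intros k x y Hx; unfold jet_snd; rewrite snd_param; apply (jet_plus k x (snd y) xi0); assumption. }
  assert (Hker : forall y, common_kernel (model_functionals : list (pair_space D E -> R)) y <->
    jet_fst 1 0 y = 0 /\ jet_fst 2 0 y = 0 /\ jet_fst 0 1 y = 0 /\ jet_fst 1 1 y = 0 /\
    jet_snd 0 0 y = 0 /\ jet_snd 1 0 y = 0 /\ jet_snd 2 0 y = 0).
  { intros y; unfold common_kernel, model_functionals; rewrite !List.Forall_cons_iff.
    split; [tauto | intros h; repeat split; try apply h; constructor]. }
  assert (Heq : forall y, common_kernel (model_functionals : list (pair_space D E -> R)) y -> V y -> pair_equations (param y)).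
  { intros y Fy [Vy1 Vy2]; apply Hker in Fy; destruct Fy as [y1 [y2 [y3 [y4 [y5 [y6 y7]]]]]].
    assert (A : jet_fst 0 0 (param y) = al y) by (rewrite param0 by lia; reflexivity).
    assert (B1 : jet_fst 0 1 (param y) = phi1 y).
    { unfold param; destruct (HLf 0%nat 1 D1) as [hp [hs _]]; rewrite !hp, !hs, T1, y3, b101, b201; ring. }
    assert (B2 : jet_fst 1 1 (param y) = phi2 y).
    { unfold param; destruct (HLf 1%nat 1 D1) as [hp [hs _]]; rewrite !hp, !hs, T1', y4, b111, b211; ring. }
    unfold pair_equations; cbv zeta; rewrite B1, B2, A, !(param_snd _ 0), !param0, y1, y2, y5, y6, y7 by (assumption || lia).
    rewrite e1, e2, x0, x1, x2.
    assert (Ps : forall k, jet_snd k (al y) (param y) = jet k (al y) (plus (snd y : real_slice E) xi0)).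
    { intros k; unfold jet_snd; rewrite snd_param; reflexivity. }
    rewrite !Ps; unfold phi1, phi2.
    do 5 (split; [ring |]); split; [reflexivity |].
    match goal with |- ?l = ?r => change (@eq R l r) end; field; exact Vy2. }
  apply (graph_atlas (B_DE C0 D E) (common_kernel model_functionals) l1 l2 p0 w1 w2 phi1 phi2 V);
    fold T; fold param; fold chart; auto.
  - apply HLf, D1.
  - apply HLf, D1.
  - intros y Fy; apply Hker in Fy; tauto.
  - intros x Mx; destruct (B_DE_elim C0 D E x HC HD HE D01 Mx) as [[q1 [q2 [q3 [q4 [q5 [q6 q7]]]]]] [_ [_ [_ [_ [_ [_ q8]]]]]]].
    assert (Al : al (chart x) = jet_fst 0 0 x).
    { unfold al; rewrite chart0 by lia; fold a0; ring. }
    split; [| split].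
    + change (common_kernel model_functionals (chart x)); apply Hker; rewrite !chart0, !chart_snd by lia.
      rewrite q1, q2, q3, q4, q5, e1, e2, x0, x1, x2.
      unfold chart; destruct (HLf 0%nat 1 D1) as [hp [hs _]], (HLf 1%nat 1 D1) as [hp' [hs' _]].
      rewrite hp, hs, hp', hs', !T1, !T1'; repeat split; ring.
    + change (phi1 (chart x) = l1 x); unfold phi1; rewrite snd_chart, Al; symmetry; exact q6.
    + change (phi2 (chart x) = l2 x); unfold phi2; rewrite snd_chart, Al, chart0, chart_snd by lia.
      replace (1 * (jet_fst 3 0 x - jet_fst 3 0 p0) + jet_fst 3 0 p0) with (jet_fst 3 0 x) by ring.
      replace (jet_snd 3 0 x - jet_snd 3 0 p0 + jet_snd 3 0 p0) with (jet_snd 3 0 x) by ring.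
      change (jet_snd 1 (jet_fst 0 0 x) x * jet_fst 3 0 x * / jet_snd 3 0 x = jet_fst 1 1 x); rewrite <- q7; field; lra.
  - apply smooth_eval; [exact HE | apply HLf, D0 | intros y [h _]; exact h].
  - apply (smooth_mult V (fun y => jet 1 (al y) (plus (snd y : real_slice E) xi0) * (1 * jet_fst 3 0 y + jet_fst 3 0 p0))).
    + apply (smooth_mult V (fun y => jet 1 (al y) (plus (snd y : real_slice E) xi0))).
      * apply smooth_eval; [exact HE | apply HLf, D0 | intros y [h _]; exact h].
      * apply smooth_linear, HLf, D0.
    + apply smooth_inv_affine; [apply HLs, E0 | intros y [_ h]; exact h].
  - intros y Fy My; destruct (B_DE_elim C0 D E (param y) HC HD HE D01 My) as [_ [q1 [q2 [_ [_ [_ [_ q8]]]]]]].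
    assert (A : jet_fst 0 0 (param y) = al y) by (apply (param0 0%nat); lia).
    rewrite A in q1, q2.
    assert (HCi : 0 < / (2 * C0)) by (apply Rinv_0_lt_compat; lra).
    assert (Vy1 : E (RtoC (al y))) by (apply q2; lra).
    assert (Vy2 : 0 < jet_snd 3 0 y + jet_snd 3 0 p0) by (rewrite <- param_snd by exact E0; exact q8).
    split; [split; [exact Vy1 | lra] |].
    destruct (RtoC_open E (al y) HE Vy1) as [r [Hr Hball]].
    destruct (bounded_linear_close _ y r (HLf 0%nat 0 D0) Hr) as [d1 [Hd1 H1]].
    destruct (bounded_linear_close _ y _ (HLs 3%nat 0 E0) Vy2) as [d2 [Hd2 H2]].
    choose_below d [d1; d2]; exists d; split; [assumption |]; intros z Hz.
    specialize (H1 z ltac:(lra)); specialize (H2 z ltac:(lra)).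
    split.
    + apply Hball; unfold al; replace (jet_fst 0 0 z + a0 - (jet_fst 0 0 y + a0)) with (jet_fst 0 0 z - jet_fst 0 0 y) by ring; exact H1.
    + apply Rabs_lt_between in H2; lra.
  - intros y Fy My; destruct (B_DE_elim C0 D E (param y) HC HD HE D01 My) as [Qeq Qop].
    destruct (pair_open_stable C0 D E (param y) HC HD HE D01 Qeq Qop) as [eps [He H]].
    exists eps; split; [exact He |]; intros z Fz Vz Hz.
    assert (Qz : pair_equations (param z)) by (apply Heq; assumption).
    exact (B_DE_intro C0 D E (param z) HC HD HE D01 Qz (H (param z) Qz Hz)).
Qed.

Lemma topological_disk_open (W : C -> Prop) : topological_disk W -> open W.
Proof. intros [H _]; exact H. Qed.

Theorem proposition1p5 (C0 : R) (D E : C -> Prop)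
  (C0_gt1 : 1 < C0)
  (D_disk : topological_disk D) (E_disk : topological_disk E)
  (D_sym : symmetric_about_R D) (E_sym : symmetric_about_R E)
  (D_01 : forall x : R, 0 <= x <= 1 -> D (RtoC x)) :
  exists F : pair_space D E -> Prop,
    finite_codimension F /\ banach_manifold (B_DE C0 D E) F.
Proof.
  assert (HD := topological_disk_open D D_disk); assert (HE := topological_disk_open E E_disk).
  assert (Hc : forall u : nat -> pair_space D E, cauchy_seq u -> exists l, seq_limit u l)
    by (intros u; apply pair_complete; assumption).
  destruct (classic (exists p, B_DE C0 D E p)) as [[p0 Hp0] | Hn].
  - assert (E0 : E (RtoC 0)).
    { destruct Hp0 as [_ [HE0 _]]; apply HE0; unfold segment; split; [apply Rmin_r | apply Rmax_r]. }
    assert (HL : List.Forall bounded_linear (model_functionals : list (pair_space D E -> R))).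
    { assert (HLf : forall n x, 0 <= x <= 1 -> bounded_linear (jet_fst n x : pair_space D E -> R))
        by (intros; apply jet_fst_bounded_linear; auto).
      assert (HLs : forall n, bounded_linear (jet_snd n 0 : pair_space D E -> R))
        by (intros; apply jet_snd_bounded_linear; assumption).
      unfold model_functionals; do 4 (apply List.Forall_cons; [apply HLf; lra |]).
      do 3 (apply List.Forall_cons; [apply HLs |]); apply List.Forall_nil. }
    exists (common_kernel model_functionals); split; [apply common_kernel_codimension, HL |].
    split; [apply common_kernel_banach; assumption |].
    apply (B_DE_atlas C0 D E p0); assumption.
  (* If there is no pair, the empty atlas serves, with the whole space as model: the common kernel
     of no functionals. *)
  - exists (common_kernel []); split; [apply common_kernel_codimension; constructor |].
    split; [apply common_kernel_banach; [exact Hc | constructor] |].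
    exists (fun _ => False); split; [split; [| split] |].
    + intros c [].
    + intros x Hx; exfalso; apply Hn; exists x; exact Hx.
    + intros c c' [].
    + intros c [].
Qed.
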